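(* Let $(A,\mathfrak{m})$ be a Cohen-Macaulay local ring of dimension $d \geq 2$ with infinite residue field, and let $I$ be an $\mathfrak{m}$-primary ideal of $A$. Let $G(I) = \bigoplus_{n\geq 0} I^n/I^{n+1}$ be the associated graded ring of $I$. Fix an integer $r$ with $1 \leq r \leq d-1$. If $\dim H^i(G(I))^\vee \leq i-1$ for all $1 \leq i \leq r$, then $(I^n)_{d-r} = \widetilde{I^n}$ for all $n \geq 1$.
   Context: Rings are commutative Noetherian. $\lambda$ denotes length. For an $\mathfrak{m}$-primary ideal $K$ of a Noetherian local ring $(A,\mathfrak{m})$ of dimension $d$, the Hilbert coefficients $e_0(K),\dots,e_d(K)$ are the integers such that $\lambda(A/K^{n+1}) = \sum_{i=0}^{d}(-1)^i e_i(K)\binom{n+d-i}{d-i}$ for all $n\gg 0$. Coefficient ideals: for an $\mathfrak{m}$-primary ideal $K$ and $0\le i\le d$, let $E_i(K)$ be the set of ($\mathfrak{m}$-primary) ideals $J \supseteq K$ with $e_j(J)=e_j(K)$ for $0\le j\le i$. When $A$ is quasi-unmixed with infinite residue field (in particular when $A$ is Cohen-Macaulay with infinite residue field), $E_i(K)$ has a unique maximal element (Rees for $i=0$, Shah in general), denoted $K_i$ and called the $i$-th coefficient ideal of $K$. Thus $(I^n)_{d-r}$ is the $(d-r)$-th coefficient ideal of the ideal $I^n$. Ratliff-Rush closure: $\widetilde{K} = \bigcup_{m\ge 1}(K^{m+1}:K^m)$. $H^i(G(I))$ is the $i$-th local cohomology module of $G(I)$ with respect to $G(I)_+ = \bigoplus_{n\ge1}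 I^n/I^{n+1}$. It is a graded $*$-Artinian module (descending chains of graded submodules stabilize), and its graded Matlis dual $H^i(G(I))^\vee$ (with $(E^\vee)_n = \operatorname{Hom}_{A/I}(E_{-n}, E_{A/I}(A/\mathfrak{m}))$, where $E_{A/I}(A/\mathfrak m)$ is the injective hull of the residue field) is a finitely generated graded $G(I)$-module; $\dim$ is its Krull dimension. The zero module has dimension $-1$. *)

(* Defs.v *)
From HB Require Import structures.
From mathcomp Require Import all_boot all_order all_algebra.
From mathcomp Require Import generic_quotient ring_quotient.
From mathcomp Require Import zify.
From mathcomp Require Import boolp classical_sets functions cardinality.

Set Implicit Arguments.
Unset Strict Implicit.
Unset Printing Implicit Defensive.

Import Order.TTheory GRing.Theory Num.Theory.
Local Open Scope ring_scope.
Local Open Scope quotient_scope.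

(* Ideals are the submodules of the regular module, and may be the whole ring;
   MathComp's idealr is reserved for proper ideals. *)
Notation ideal R := (submodClosed R^o).

Section Modules.
Variable R : pzRingType.

Section SubmodZmod.
Variables (M : lmodType R) (N : submodClosed M).

(* submodClosed does not inherit from zmodClosed, which quotients require. *)
Definition submod_pred : {pred M} := fun x => x \in N.

Fact submod_pred_zmod_closed : zmod_closed submod_pred.
Proof. exact: GRing.submod_closedB (submodClosedP N). Qed.
HB.instance Definition _ :=
  GRing.isZmodClosed.Build M submod_pred submod_pred_zmod_closed.
End SubmodZmod.

Definition quotmod (M : lmodType R) (N : submodClosed M) : Type :=
  Quotient.quot (submod_pred N).

Section Quotmod.
Variables (M : lmodType R) (N : submodClosed M).

HB.instance Definition _ := GRing.Zmodule.on (quotmod N).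
HB.instance Definition _ := EqQuotient.on (quotmod N).

Definition quotmod_pi (x : M) : quotmod N := \pi_(Quotient.quot (submod_pred N)) x.

Lemma quotmod_piE (x y : M) : (quotmod_pi x = quotmod_pi y) <-> (x - y \in N).
Proof.
have -> : (x - y \in N) = (x - y \in submod_pred N) by [].
by rewrite Quotient.idealrBE; split=> [/eqP|/eqP].
Qed.

Lemma quotmod_pi_repr (u : quotmod N) : exists x, u = quotmod_pi x.
Proof. by exists (repr (u : (Quotient.quot (submod_pred N)))); rewrite /quotmod_pi reprK. Qed.

Lemma quotmod_piD : {morph quotmod_pi : x y / x + y}.
Proof. by move=> x y; rewrite /quotmod_pi raddfD. Qed.

Definition quotmod_scale (a : R) (u : quotmod N) : quotmod N :=
  quotmod_pi (a *: repr (u : (Quotient.quot (submod_pred N)))).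

Lemma quotmod_piZ a x : quotmod_scale a (quotmod_pi x) = quotmod_pi (a *: x).
Proof.
apply/quotmod_piE; rewrite -scalerBr rpredZ //; apply/quotmod_piE.
by rewrite /quotmod_pi reprK.
Qed.

Fact quotmod_scaleA a b u :
  quotmod_scale a (quotmod_scale b u) = quotmod_scale (a * b) u.
Proof. by have [x ->] := quotmod_pi_repr u; rewrite !quotmod_piZ scalerA. Qed.
Fact quotmod_scale1 : left_id 1 quotmod_scale.
Proof. by move=> u; have [x ->] := quotmod_pi_repr u; rewrite quotmod_piZ scale1r. Qed.
Fact quotmod_scaleDr : right_distributive quotmod_scale +%R.
Proof.
move=> a u v; have [x ->] := quotmod_pi_repr u; have [y ->] := quotmod_pi_repr v.
by rewrite -quotmod_piD !quotmod_piZ scalerDr quotmod_piD.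
Qed.
Fact quotmod_scaleDl u : {morph quotmod_scale^~ u : a b / a + b}.
Proof.
move=> a b /=; have [x ->] := quotmod_pi_repr u.
by rewrite !quotmod_piZ scalerDl quotmod_piD.
Qed.

HB.instance Definition _ := GRing.Zmodule_isLmodule.Build R (quotmod N)
  quotmod_scaleA quotmod_scale1 quotmod_scaleDr quotmod_scaleDl.

Fact quotmod_pi_zmod_morphism : zmod_morphism quotmod_pi.
Proof. by move=> x y; rewrite /quotmod_pi raddfB. Qed.
Fact quotmod_pi_scalable : scalable quotmod_pi.
Proof. by move=> a x; rewrite -quotmod_piZ. Qed.
HB.instance Definition _ := GRing.isZmodMorphism.Build M (quotmod N) quotmod_pi
  quotmod_pi_zmod_morphism.
HB.instance Definition _ := GRing.isScalable.Build R M (quotmod N) *:%R quotmod_pi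
  quotmod_pi_scalable.
End Quotmod.

Definition strict_sub (T : Type) (P Q : {pred T}) : Prop :=
  {subset P <= Q} /\ ~ {subset Q <= P}.

Definition has_submod_chain (M : lmodType R) (n : nat) : Prop :=
  exists N : nat -> submodClosed M,
    forall k, (k < n)%N -> strict_sub (N k) (N k.+1).

Definition has_length (M : lmodType R) (l : nat) : Prop :=
  has_submod_chain M l /\ forall n, has_submod_chain M n -> (n <= l)%N.

Definition injective_module (E : lmodType R) : Prop :=
  forall (M N : lmodType R) (f : {linear M -> N}) (g : {linear M -> E}),
    injective f -> exists h : {linear N -> E}, forall x, h (f x) = g x.

Definition injective_hull (M E : lmodType R) : Prop :=
  injective_module E /\
  exists2 j : {linear M -> E}, injective j &
    forall N : submodClosed E, (exists2 y, y \in N & y != 0) ->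
      exists2 x, j x \in N & j x != 0.

End Modules.

Section Rings.
Variable R : comNzRingType.

Definition noetherian : Prop :=
  forall J : nat -> ideal R, (forall k, {subset J k <= J k.+1}) ->
    exists n, forall k, (n <= k)%N -> J k =i J n.

Definition maximal_ideal (J : idealr R) : Prop :=
  forall K : idealr R, {subset J <= K} -> K =i J.

Definition local_ring (m : idealr R) : Prop :=
  maximal_ideal m /\ forall J : idealr R, maximal_ideal J -> J =i m.

Definition prime_chain (n : nat) (P : nat -> prime_idealr R) : Prop :=
  forall k, (k < n)%N -> strict_sub (P k) (P k.+1).

Definition krull_dim (d : nat) : Prop :=
  (exists P, prime_chain d P) /\ forall n P, prime_chain n P -> (n <= d)%N.

(* P is in the support of M, i.e. M_P is nonzero. *)
Definition in_supp (M : lmodType R) (P : prime_idealr R) : Prop :=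
  exists x : M, forall a, a *: x = 0 -> a \in P.

(* The dimension of the support; the zero module satisfies the bound -1. *)
Definition module_dim_le (M : lmodType R) (z : int) : Prop :=
  forall n P, (forall k, (k <= n)%N -> in_supp M (P k)) -> prime_chain n P ->
    n%:Z <= z.

Lemma ideal_mull (J : ideal R) (a b : R) : b \in J -> a * b \in J.
Proof. exact: (@rpredZ R R^o J a b). Qed.

Lemma ideal_sum (J : ideal R) n (F : 'I_n -> R) :
  (forall k, F k \in J) -> \sum_k F k \in J.
Proof. by move=> h; apply: (@rpred_sum R^o J). Qed.

Section IdealGen.
Variable S : set R.

Definition ideal_gen : {pred R^o} :=
  fun a => `[< forall J : ideal R, (forall y, S y -> y \in J) -> a \in J >].

Fact ideal_gen_closed : submod_closed ideal_gen.
Proof.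
split=> [|a u v /asboolP hu /asboolP hv]; apply/asboolP => J hJ.
  exact: rpred0.
by apply: rpredD; [apply: rpredZ; apply: hu | apply: hv].
Qed.
HB.instance Definition _ :=
  GRing.isSubmodClosed.Build R R^o ideal_gen ideal_gen_closed.
End IdealGen.

Lemma mem_ideal_gen (S : set R) y : S y -> y \in ideal_gen S.
Proof. by move=> Sy; apply/asboolP => J; apply. Qed.

Definition ideal_pow (K : {pred R}) (n : nat) : ideal R :=
  ideal_gen [set a | exists2 f : 'I_n -> R,
                       (forall k, f k \in K) & a = \prod_(k < n) f k].

Definition regular_seq (m : {pred R}) (xs : seq R) : Prop :=
  [/\ {subset xs <= m},
      forall k, (k < size xs)%N -> forall a : R,
        let J := ideal_gen [set y | y \in take k xs] in
        xs`_k * a \in J -> a \in J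
    & 1 \notin ideal_gen [set y | y \in xs]].

Definition has_depth (m : {pred R}) (n : nat) : Prop :=
  (exists2 xs, regular_seq m xs & size xs = n) /\
  forall xs, regular_seq m xs -> (size xs <= n)%N.

Definition cohen_macaulay (m : {pred R}) : Prop :=
  exists2 d, krull_dim d & has_depth m d.

Definition m_primary (m Q : {pred R}) : Prop :=
  [/\ 1 \notin Q,
      forall a b, a * b \in Q -> a \notin Q -> exists n, b ^+ n \in Q
    & forall a, (a \in m) <-> (exists n, a ^+ n \in Q)].

Definition hilbert_coeffs (d : nat) (K : {pred R}) (e : nat -> int) : Prop :=
  exists N, forall n, (N <= n)%N ->
    exists2 l, has_length (quotmod (ideal_pow K n.+1)) l &
      l%:Z = \sum_(i < d.+1) (-1) ^+ i * e i * 'C(n + d - i, d - i)%:Z.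

Definition coeff_class (m : {pred R}) (d i : nat) (K J : ideal R) : Prop :=
  [/\ m_primary m J, {subset K <= J}
    & exists e e', [/\ hilbert_coeffs d K e, hilbert_coeffs d J e'
                     & forall j, (j <= i)%N -> e' j = e j]].

Definition maximal_in (C : ideal R -> Prop) (J : ideal R) : Prop :=
  C J /\ forall J', C J' -> {subset J <= J'} -> J' =i J.

Definition coefficient_ideal (m : {pred R}) (d i : nat) (K J : ideal R) : Prop :=
  maximal_in (coeff_class m d i K) J /\
  forall J', maximal_in (coeff_class m d i K) J' -> J' =i J.

Section PowFacts.
Variable K : {pred R}.

Lemma ideal_powM i j (a b : R) : a \in ideal_pow K i -> b \in ideal_pow K j ->
  a * b \in ideal_pow K (i + j).
Proof.
move=> /asboolP ha /asboolP hb.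
pose L1 : {pred R^o} := fun c => `[< forall b', b' \in ideal_pow K j ->
  (c : R) * b' \in ideal_pow K (i + j) >].
have cl1 : submod_closed L1.
  split=> [|c u v /asboolP hu /asboolP hv]; apply/asboolP => b' hb'.
    by rewrite mul0r; apply: rpred0.
  rewrite mulrDl -[c *: u]/(c * (u : R)) -mulrA.
  by apply: rpredD; [apply/ideal_mull/hu|apply: hv].
pose L1i := GRing.isSubmodClosed.Build R R^o L1 cl1.
pose L1s : ideal R := HB.pack L1 L1i.
suff : a \in L1s by move/asboolP; apply; apply/asboolP.
apply: ha => _ [f hf ->]; apply/asboolP => b' /asboolP hb'.
set u := \prod_(k < i) f k.
pose L2 : {pred R^o} := fun c => u * (c : R) \in ideal_pow K (i + j).
have cl2 : submod_closed L2.
  split=> [|c v w hv hw]; rewrite /L2 /in_mem /=.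
    by rewrite mulr0; apply: rpred0.
  rewrite mulrDr -[c *: v]/(c * (v : R)) mulrCA.
  by apply: rpredD; [apply/ideal_mull/hv|apply: hw].
pose L2i := GRing.isSubmodClosed.Build R R^o L2 cl2.
pose L2s : ideal R := HB.pack L2 L2i.
suff : b' \in L2s by [].
apply: hb' => _ [g hg ->]; rewrite /in_mem /= /L2.
apply: mem_ideal_gen; exists (fun k : 'I_(i + j) => match fintype.split k with inl k => f k | inr k => g k end).
  by move=> k; case: fintype.split.
rewrite big_split_ord /=; congr (_ * _); apply: eq_bigr => k _.
  by rewrite (unsplitK (inl k : 'I_i + 'I_j)).
by rewrite (unsplitK (inr k : 'I_i + 'I_j)).
Qed.

Lemma ideal_pow0 (a : R) : a \in ideal_pow K 0.
Proof.
have h1 : (1 : R^o) \in ideal_pow K 0.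
  by apply: mem_ideal_gen; exists (fun _ => 0) => [[]//|]; rewrite big_ord0.
by rewrite -[a]mulr1; apply: ideal_mull.
Qed.

End PowFacts.

Section RatliffRush.
Variable K : ideal R.

Definition ratliff_rush_pred : {pred R^o} := fun a =>
  `[< exists2 n, (1 <= n)%N &
      forall b, b \in ideal_pow K n -> (a : R) * b \in ideal_pow K n.+1 >].

Lemma ratliff_rushS a n :
  (forall b, b \in ideal_pow K n -> (a : R) * b \in ideal_pow K n.+1) ->
  forall k b, (n <= k)%N -> b \in ideal_pow K k -> (a : R) * b \in ideal_pow K k.+1.
Proof.
move=> h k b; elim: k b => [|k IH] b; first by rewrite leqn0 => /eqP E; move: h; rewrite E; apply.
rewrite leq_eqVlt => /orP[/eqP <-|]; first exact: h.
rewrite ltnS => nk.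
pose L : {pred R^o} := fun c => a * (c : R) \in ideal_pow K k.+2.
have cl : submod_closed L.
  split=> [|c v w hv hw]; rewrite /L /in_mem /=.
    by rewrite mulr0; apply: rpred0.
  rewrite mulrDr -[c *: v]/(c * (v : R)) mulrCA.
  by apply: rpredD; [apply/ideal_mull/hv|apply: hw].
pose Li := GRing.isSubmodClosed.Build R R^o L cl.
pose Ls : ideal R := HB.pack L Li.
move=> /asboolP /(_ Ls); apply => _ [f hf ->]; rewrite /in_mem /= /L.
rewrite big_ord_recl mulrCA -[k.+2]add1n; apply: ideal_powM.
  apply: mem_ideal_gen; exists (fun _ => f ord0) => [_|]; first exact: hf.
  by rewrite big_ord1.
by apply: IH => //; apply: mem_ideal_gen; exists (fun i => f (lift ord0 i)).
Qed.

Fact ratliff_rush_closed : submod_closed ratliff_rush_pred.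
Proof.
split.
  by apply/asboolP; exists 1%N => // b _; rewrite mul0r; apply: rpred0.
move=> c u v /asboolP[n n1 hn] /asboolP[p p1 hp]; apply/asboolP.
exists (maxn n p); first by rewrite leq_max n1.
move=> b hb; rewrite mulrDl -[c *: u]/(c * (u : R)) -mulrA; apply: rpredD.
  by apply: ideal_mull; apply: (ratliff_rushS hn) => //; apply: leq_maxl.
by apply: (ratliff_rushS hp) => //; apply: leq_maxr.
Qed.
HB.instance Definition _ :=
  GRing.isSubmodClosed.Build R R^o ratliff_rush_pred ratliff_rush_closed.

Definition ratliff_rush : ideal R := ratliff_rush_pred.
End RatliffRush.

End Rings.

Section AssociatedGraded.
Variables (A : comNzRingType) (I : idealr A).

(* The Rees algebra, as the polynomials whose n-th coefficient is in I^n. *)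
Definition rees_pred : {pred {poly A}} :=
  fun p => `[< forall n, p`_n \in ideal_pow I n >].

Fact rees_closed : subring_closed rees_pred.
Proof.
split.
- apply/asboolP => n; rewrite coef1; case: n => [|n] /=; first exact: ideal_pow0.
  exact: (rpred0 (ideal_pow I n.+1)).
- move=> p q /asboolP hp /asboolP hq; apply/asboolP => n.
  rewrite coefB -mulN1r; apply: (rpredD (hp n)).
  exact: (ideal_mull _ (hq n)).
move=> p q /asboolP hp /asboolP hq; apply/asboolP => n.
rewrite coefM; apply: ideal_sum => j.
by rewrite -[X in ideal_pow I X](subnKC (ltn_ord j : (j <= n)%N)); apply: ideal_powM.
Qed.
HB.instance Definition _ := GRing.isSubringClosed.Build {poly A} rees_pred rees_closed.

Record rees := Rees { rees_val :> {poly A}; rees_valP : rees_val \in rees_pred }.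
HB.instance Definition _ := [isSub for rees_val].
HB.instance Definition _ := [Choice of rees by <:].
HB.instance Definition _ := [SubChoice_isSubComNzRing of rees by <:].

(* G(I) is the Rees algebra modulo its extension of I. *)
Definition rees_ker : {pred rees} :=
  fun p => `[< forall n, (rees_val p)`_n \in ideal_pow I n.+1 >].

Lemma ideal_pow1_sub (a : A) : a \in ideal_pow I 1 -> a \in I.
Proof.
pose L : {pred A^o} := fun c => (c : A) \in (I : {pred A}).
have cl : submod_closed L.
  split=> [|c v w hv hw]; first exact: idealr0.
  by rewrite /L /in_mem /=; apply: rpredD => //; apply: idealMr.
pose Li := GRing.isSubmodClosed.Build A A^o L cl.
pose Ls : ideal A := HB.pack L Li.
move=> /asboolP /(_ Ls); apply => _ [f hf ->].
by rewrite big_ord1; apply: hf.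
Qed.

Fact rees_ker_idealr : idealr_closed rees_ker.
Proof.
split.
- by apply/asboolP => n; rewrite coef0; apply: (rpred0 (ideal_pow I n.+1)).
- apply/negP => /asboolP /(_ 0%N); rewrite coef1 /= => /ideal_pow1_sub.
  by rewrite idealr1.
move=> a p q /asboolP hp /asboolP hq; apply/asboolP => n /=.
rewrite coefD; apply: (rpredD _ (hq n)).
rewrite coefM; apply: ideal_sum => j.
have /asboolP ha := rees_valP a.
by have := ideal_powM (ha j) (hp (n - j)%N); rewrite addnS subnKC // -ltnS.
Qed.
HB.instance Definition _ := isIdealr.Build rees rees_ker rees_ker_idealr.

Definition gr : comNzRingType := {ideal_quot rees_ker}.

Definition gr_pi (p : rees) : gr := \pi_{ideal_quot rees_ker} p.

(* The homogeneous component of degree k, zero for negative k. *)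
Definition gr_piece (k : int) : {pred gr} :=
  fun g => `[< exists2 p : rees,
     forall n : nat, n%:Z != k -> (rees_val p)`_n = 0 & g = gr_pi p >].

Definition gr_irrelevant : {pred gr} :=
  fun g => `[< exists2 p : rees, (rees_val p)`_0 = 0 & g = gr_pi p >].

Fact polyC_rees (a : A) : a%:P \in rees_pred.
Proof.
apply/asboolP => n; rewrite coefC; case: n => [|n] /=; first exact: ideal_pow0.
exact: (rpred0 (ideal_pow I n.+1)).
Qed.

Definition gr_const (a : A) : gr := gr_pi (Rees (polyC_rees a)).

End AssociatedGraded.

Arguments gr_piece {A} I k.
Arguments gr_irrelevant {A} I.
Arguments gr_const {A} I a.

(* The Cech complex of R with respect to x_0, ..., x_(s-1), whose cohomology is
   the local cohomology of R with respect to the ideal that they generate.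
   The localization of R at x_S = \prod_(j in S) x_j is presented as
   R[T] / (x_S T - 1), where T stands for 1 / x_S; the restriction map from
   the localization at x_(S \ j) to that at x_S is then T |-> x_j T. *)
Section Cech.
Variables (R : comNzRingType) (s : nat) (x : 'I_s -> R).

Definition cech_cochain : Type := {ffun {set 'I_s} -> {poly R}}.
HB.instance Definition _ := GRing.Lmodule.on cech_cochain.

(* c vanishes in the product of the localizations. *)
Definition cech_null : {pred cech_cochain} := fun c =>
  `[< forall S, exists q, c S = q * ((\prod_(j in S) x j) *: 'X - 1) >].

Fact cech_null_closed : submod_closed cech_null.
Proof.
split=> [|a u v /asboolP hu /asboolP hv]; apply/asboolP => S.
  by exists 0; rewrite ffunE mul0r.
have [p hp] := hu S; have [q hq] := hv S; exists (a *: p + q).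
by rewrite !ffunE hp hq mulrDl -scalerAl.
Qed.
HB.instance Definition _ :=
  GRing.isSubmodClosed.Build R cech_cochain cech_null cech_null_closed.

Definition cech_d (c : cech_cochain) : cech_cochain :=
  [ffun S : {set 'I_s} => \sum_(j in S)
     (-1) ^+ #|[set k in S | (k < j)%N]| *: (c (S :\ j) \Po (x j *: 'X))].

Fact cech_d_linear : linear cech_d.
Proof.
move=> a u v; apply/ffunP => S; rewrite !ffunE scaler_sumr -big_split /=.
apply: eq_bigr => j _; rewrite !ffunE comp_polyD comp_polyZ scalerDr.
by rewrite !scalerA mulrC.
Qed.
HB.instance Definition _ :=
  GRing.isLinear.Build R cech_cochain cech_cochain *:%R cech_d cech_d_linear.

Definition cech_supported (i : nat) (c : cech_cochain) : Prop :=
  forall S : {set 'I_s}, #|S| != i -> c S = 0.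

Definition cech_cocycle_pred (i : nat) : {pred cech_cochain} :=
  fun c => `[< cech_supported i c /\ cech_d c \in cech_null >].

Fact cech_cocycle_closed i : submod_closed (cech_cocycle_pred i).
Proof.
split=> [|a u v /asboolP[hu du] /asboolP[hv dv]]; apply/asboolP; split.
- by move=> S _; rewrite ffunE.
- by rewrite raddf0; apply: rpred0.
- by move=> S hS; rewrite !ffunE hu // hv // scaler0 addr0.
by rewrite linearP; apply: rpredD => //; apply: rpredZ.
Qed.
HB.instance Definition _ i := GRing.isSubmodClosed.Build R cech_cochain
  (cech_cocycle_pred i) (cech_cocycle_closed i).

Record cech_cocycle (i : nat) := CechCocycle {
  cocycle_val :> cech_cochain;
  cocycle_valP : cocycle_val \in cech_cocycle_pred i
}.
HB.instance Definition _ i := [isSub for @cocycle_val i].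
HB.instance Definition _ i := [Choice of cech_cocycle i by <:].
HB.instance Definition _ i := [SubChoice_isSubZmodule of cech_cocycle i by <:].
HB.instance Definition _ i := [SubZmodule_isSubLmodule of cech_cocycle i by <:].

Definition cech_coboundary (i : nat) : {pred cech_cocycle i} := fun c =>
  `[< exists2 b : cech_cochain, (forall S : {set 'I_s}, #|S|.+1 != i -> b S = 0) &
        cocycle_val c - cech_d b \in cech_null >].

Fact cech_coboundary_closed i : submod_closed (@cech_coboundary i).
Proof.
split=> [|a u v /asboolP[b hb db] /asboolP[c hc dc]]; apply/asboolP.
  exists 0; first by move=> S _; rewrite ffunE.
  rewrite (_ : cocycle_val 0 = 0) // sub0r -[cech_d 0]/((cech_d : {linear _ -> _}) 0).
  by rewrite linear0 oppr0; apply: rpred0.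
exists (a *: b + c); first by move=> S hS; rewrite !ffunE hb // hc // scaler0 addr0.
rewrite (_ : cocycle_val (a *: u + v) = a *: cocycle_val u + cocycle_val v) //.
rewrite linearP opprD addrACA -scalerBr.
by apply: rpredD => //; apply: rpredZ.
Qed.
HB.instance Definition _ i := GRing.isSubmodClosed.Build R (cech_cocycle i)
  (@cech_coboundary i) (cech_coboundary_closed i).

Definition cech_cohomology (i : nat) : lmodType R :=
  quotmod (@cech_coboundary i).

End Cech.

Section LocalCohomologyDual.
Variables (A : comNzRingType) (I : idealr A).

Lemma gr_pieceM (a b : int) (g h : gr I) :
  g \in gr_piece I a -> h \in gr_piece I b -> g * h \in gr_piece I (a + b).
Proof.
move=> /asboolP[p hp ->] /asboolP[q hq ->]; apply/asboolP.
exists (p * q); last by rewrite /gr_pi rmorphM.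
move=> n hn; rewrite /= coefM big1 // => j _.
have [ja|/hp ->] := eqVneq (j%:Z) a; last by rewrite mul0r.
have [jb|/hq ->] := eqVneq ((n - j)%N%:Z) b; last by rewrite mulr0.
by case/eqP: hn; rewrite -ja -jb -PoszD subnKC // -ltnS.
Qed.

Fact rees_monomial (p : rees I) (k : nat) : (rees_val p)`_k *: 'X^k \in rees_pred I.
Proof.
apply/asboolP => n; rewrite coefZ coefXn; case: eqP => [->|_] /=.
  by rewrite mulr1; have /asboolP := rees_valP p; apply.
by rewrite mulr0; apply: (rpred0 (ideal_pow I n)).
Qed.

Lemma gr_pi_sum (p : rees I) :
  gr_pi p = \sum_(k < size (rees_val p)) gr_pi (Rees (rees_monomial p k)).
Proof.
rewrite /gr_pi -raddf_sum; congr (\pi_ _ _); apply: val_inj => /=.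
have -> n (F : 'I_n -> rees I) : rees_val (\sum_k F k) = \sum_k rees_val (F k).
  by apply: (big_morph (@rees_val A I)).
by rewrite -[LHS]coefK poly_def.
Qed.

Variables (s : nat) (x : 'I_s -> gr I) (i : nat).
Local Notation H := (cech_cohomology x i).

(* The degree n component when all x_j have degree 1, so that T^k has degree
   - k #|S| in the component indexed by S. *)
Definition cech_piece (n : int) : {pred H} := fun h =>
  `[< exists2 z : cech_cocycle x i,
        forall (S : {set 'I_s}) k,
          (cocycle_val z S)`_k \in gr_piece I (n + (k * #|S|)%:Z)
      & h = quotmod_pi (@cech_coboundary _ _ x i) z >].

Lemma cech_pieceZ (a n : int) (g : gr I) (h : H) :
  g \in gr_piece I a -> h \in cech_piece n -> g *: h \in cech_piece (a + n).
Proof.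
move=> hg /asboolP[z hz ->]; apply/asboolP; exists (g *: z); last by rewrite linearZ.
move=> S k; rewrite (_ : cocycle_val (g *: z) = g *: cocycle_val z) //.
by rewrite ffunE coefZ -addrA; apply: gr_pieceM.
Qed.

Variable E : lmodType {ideal_quot I}.

(* The direct sum over n of Hom_(A/I)(H_(-n), E), as the space of the
   A/I-linear maps on H that vanish on all but finitely many components. *)
Definition matlis_pred : {pred (H -> E)} := fun f =>
  `[< [/\ forall u v, f (u + v) = f u + f v,
          forall a u, f (gr_const I a *: u) = \pi_{ideal_quot I} a *: f u
        & exists N : nat, forall (n : int) u,
            N%:Z < `|n| -> u \in cech_piece n -> f u = 0] >].

Fact matlis_zmod_closed : zmod_closed matlis_pred.
Proof.
split=> [|f g /asboolP[fD fZ [N fN]] /asboolP[gD gZ [P gP]]]; apply/asboolP.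
  by split=> [u v|a u|]; [rewrite addr0|rewrite scaler0|exists 0%N].
split=> [u v|a u|].
- by rewrite !fctE fD gD opprD addrACA.
- by rewrite !fctE fZ gZ scalerBr.
exists (maxn N P) => n u hn hu; rewrite !fctE (fN n) ?(gP n) ?subr0 //.
  by apply: le_lt_trans hn; rewrite lez_nat leq_maxr.
by apply: le_lt_trans hn; rewrite lez_nat leq_maxl.
Qed.
HB.instance Definition _ :=
  GRing.isZmodClosed.Build (H -> E) matlis_pred matlis_zmod_closed.

Record matlis_dual := MatlisDual {
  matlis_val : H -> E;
  matlis_valP : matlis_val \in matlis_pred
}.
HB.instance Definition _ := [isSub for matlis_val].
HB.instance Definition _ := [Choice of matlis_dual by <:].
HB.instance Definition _ := [SubChoice_isSubZmodule of matlis_dual by <:].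

Fact matlis_scale_closed (g : gr I) (f : matlis_dual) :
  (fun u => matlis_val f (g *: u)) \in matlis_pred.
Proof.
case: f => f /= /asboolP[fD fZ [N fN]]; apply/asboolP; split=> [u v|a u|].
- by rewrite scalerDr fD.
- by rewrite -fZ !scalerA mulrC.
have f0 : f 0 = 0 by apply: (addrI (f 0)); rewrite -fD !addr0.
have [p ->] : exists p, g = gr_pi p by exists (repr g); rewrite /gr_pi reprK.
exists (N + size (rees_val p))%N => n u hn hu.
rewrite gr_pi_sum scaler_suml (big_morph f fD f0) big1 // => k _.
apply: (fN (k%:Z + n)); last first.
  apply: cech_pieceZ hu; apply/asboolP; exists (Rees (rees_monomial p k)) => //.
  move=> j; rewrite /= coefZ coefXn eqz_nat => /negPf ->.
  by rewrite mulr0.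
have := ltn_ord k; move: (nat_of_ord k) hn => {}k; lia.
Qed.

Definition matlis_scale (g : gr I) (f : matlis_dual) : matlis_dual :=
  MatlisDual (matlis_scale_closed g f).

Fact matlis_scaleA g h f :
  matlis_scale g (matlis_scale h f) = matlis_scale (g * h) f.
Proof. by apply: val_inj; apply/funext => u /=; rewrite scalerA mulrC. Qed.
Fact matlis_scale1 : left_id 1 matlis_scale.
Proof. by move=> f; apply: val_inj; apply/funext => u /=; rewrite scale1r. Qed.
Fact matlis_scaleDr : right_distributive matlis_scale +%R.
Proof. by move=> g f h; apply: val_inj; apply/funext. Qed.
Fact matlis_scaleDl f : {morph matlis_scale^~ f : g h / g + h}.
Proof.
move=> g h; apply: val_inj; apply/funext => u /=; rewrite scalerDl.
by case: f => f /= /asboolP[].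
Qed.
HB.instance Definition _ := GRing.Zmodule_isLmodule.Build (gr I) matlis_dual
  matlis_scaleA matlis_scale1 matlis_scaleDr matlis_scaleDl.

End LocalCohomologyDual.

Section ResidueField.
Variables (A : comNzRingType) (I m : idealr A).

Definition max_image : {pred {ideal_quot I}^o} :=
  fun y => `[< exists2 a, a \in m & y = \pi_{ideal_quot I} a >].

Fact max_image_closed : submod_closed max_image.
Proof.
split=> [|c u v /asboolP[a ha ->] /asboolP[b hb ->]]; apply/asboolP.
  by exists 0; [exact: rpred0 | rewrite raddf0].
have -> : c = \pi_{ideal_quot I} (repr c) by rewrite reprK.
exists (repr c * a + b); first by apply: rpredD => //; apply: idealMr.
by rewrite rmorphD rmorphM.
Qed.
HB.instance Definition _ := GRing.isSubmodClosed.Build {ideal_quot I}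
  {ideal_quot I}^o max_image max_image_closed.

(* The residue field of A as a module over A/I, when I is contained in m. *)
Definition residue_module : lmodType {ideal_quot I} := quotmod max_image.

End ResidueField.

(* Main.v *)
(* Put K = I^n. The Ratliff-Rush closure of K has the same large powers as K, hence the same
   Hilbert polynomial, so it only has to be shown that every J in the class of K is contained
   in it. If some y in J is not, there is an initial form h = (z y)^* in G = G(I), killed by
   no power of G_+, whose annihilator is a prime P. Let Y_1, ..., Y_t be elements of degree 1
   forming a Noether normalization of G / P over the residue field; then t >= 1.
   The multiples of h by monomials in Y are independent, so they give elements of J^p
   independent modulo K^p, about p^(t-1) of them. As e_0, ..., e_(d-r) agree on K and J, the
   length of J^p / K^p is O(p^(r-1)), and therefore t <= r.
   On the other hand the class of h / (Y_1 ... Y_t)^k in H^t_Y(G) is nonzero for large k, and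
   injectivity of E gives a functional f on H^t_Y(G) that does not vanish on it. As
   Y lies in G_+, f induces a functional on H^t(G). The leading coefficient of a multiple
   of a in k[Y] shows that an element a of its annihilator lies in P. So the support of
   H^t(G)^dual contains all primes over P, and the chains of these reach length t,
   against the hypothesis that its dimension is at most t - 1. *)
Require Import Defs.
From HB Require Import structures.
From mathcomp Require Import all_boot all_order all_algebra all_fingroup.
From mathcomp Require Import generic_quotient ring_quotient.
From mathcomp Require Import boolp classical_sets functions cardinality.
From mathcomp Require Import zify ring.
From mathcomp Require Import mpoly.

Set Implicit Arguments.
Unset Strict Implicit.
Unset Printing Implicit Defensive.

Import Order.TTheory GRing.Theory Num.Theory.
Local Open Scope ring_scope.
Local Open Scope quotient_scope.
Local Open Scope classical_set_scope.

(** * Ideals as sets *)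

(** The functor H^t_Y is only right exact, so a class of h / (Y_1 ... Y_t)^k that is nonzero over Gh
    may die in G, being hit from H^(t-1)_Y(G / Gh). The remedy is to divide by an ideal b maximal
    with zero trace on Gh, which makes P nilpotent, and to enlarge Gh + b by copies of G / P until
    it contains a nonzero polynomial in Y modulo P. Each step loses at most one nonzero polynomial
    factor, and the class in G / P survives all such factors. No map between the Cech complexes of x
    and Y is built. A cocycle for x is read at a level k as a Koszul cocycle on the x_j^k and
    contracted with rows that express the Y_i^N through the x_j^k; the functional is evaluated on
    the result. Independence of k, N and the rows takes the place of functoriality, and for the
    cocycle made from h the contraction is a determinant. Hilbert-Serre bounds the degree of the
    Hilbert polynomial only by the number of generators of the ideal. Powers of a regular sequence
    of length d bring it down to d, and its first element is the nonzerodivisor of the determinant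
    trick that compares powers with the Ratliff-Rush closure. *)

Section Ideals.
Variable R : comNzRingType.
Implicit Types (J K U V W : set R) (a b c g : R).

(** As plain sets, extensionally equal ideals are equal, so stabilization and maximality can be
    stated with [=]. The bundled [ideal R] is rebuilt where the definitions ask for it. *)
Definition is_ideal J :=
  [/\ J 0, forall a b, J a -> J b -> J (a + b) & forall a b, J b -> J (a * b)].

Section Closure.
Variables (J : set R) (idJ : is_ideal J).

Lemma idl0 : J 0. Proof. by case: idJ. Qed.
Lemma idlD a b : J a -> J b -> J (a + b). Proof. by case: idJ => _ + _; apply. Qed.
Lemma idlM a b : J b -> J (a * b). Proof. by case: idJ => _ _; apply. Qed.
Lemma idlMr a b : J b -> J (b * a). Proof. by rewrite mulrC; apply: idlM. Qed.
Lemma idlN a : J a -> J (- a). Proof. by rewrite -mulN1r; apply: idlM. Qed.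
Lemma idlB a b : J a -> J b -> J (a - b).
Proof. by move=> ha hb; apply: idlD => //; apply: idlN. Qed.
Lemma idl_sum (T : Type) (r : seq T) (P : pred T) (F : T -> R) :
  (forall i, P i -> J (F i)) -> J (\sum_(i <- r | P i) F i).
Proof. by move=> h; apply: (big_ind J) => //; [exact: idl0|exact: idlD]. Qed.
Lemma idlBl a b : J (a - b) -> J a -> J b.
Proof. by move=> h ha; rewrite -[b](subKr a); apply: idlB. Qed.
Lemma idlBr a b : J (a - b) -> J b -> J a.
Proof. by move=> h hb; rewrite -[a](subrK b); apply: idlD. Qed.
End Closure.

Definition idl_pred J : {pred R^o} := fun a => `[< J a >].

Lemma idl_closed J : is_ideal J -> submod_closed (idl_pred J).
Proof.
move=> idJ; split=> [|a u v /asboolP hu /asboolP hv]; apply/asboolP; first exact: idl0.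
by apply: idlD => //; apply: idlM.
Qed.

Lemma ideal_is (J : ideal R) : is_ideal [set a | a \in J].
Proof.
split=> [|a b ha hb|a b hb] /=; first exact: (@rpred0 R^o J).
- exact: (@rpredD R^o J).
- exact: ideal_mull.
Qed.

Lemma idealr_is (J : idealr R) : is_ideal [set a | a \in J].
Proof. by split=> [|a b ha hb|a b hb] /=; [exact: rpred0|exact: rpredD|exact: idealMr]. Qed.

Lemma ideal_of J : is_ideal J -> exists K : ideal R, forall a, (a \in K) <-> J a.
Proof.
move=> idJ; pose Ji := GRing.isSubmodClosed.Build R R^o (idl_pred J) (idl_closed idJ).
pose K : ideal R := HB.pack (idl_pred J) Ji.
by exists K => a; split => [/asboolP|ha] //; apply/asboolP.
Qed.

Lemma idealr_of J : is_ideal J -> ~ J 1 -> exists K : idealr R, forall a, (a \in K) <-> J a.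
Proof.
move=> idJ J1.
have cl : idealr_closed (idl_pred J).
  split; first by apply/asboolP; exact: idl0.
    by apply/negP => /asboolP.
  by move=> a u v /asboolP hu /asboolP hv; apply/asboolP; apply: idlD => //; apply: idlM.
pose Ji := isIdealr.Build R (idl_pred J) cl.
pose K : idealr R := HB.pack (idl_pred J) Ji.
by exists K => a; split => [/asboolP|ha] //; apply/asboolP.
Qed.

Definition prime_set J := [/\ is_ideal J, ~ J 1 & forall a b, J (a * b) -> J a \/ J b].

Lemma prime_idealr_of J : prime_set J ->
  exists K : prime_idealr R, forall a, (a \in K) <-> J a.
Proof.
case=> idJ J1 pJ.
have cl : idealr_closed (idl_pred J).
  split; first by apply/asboolP; exact: idl0.
    by apply/negP => /asboolP.
  by move=> a u v /asboolP hu /asboolP hv; apply/asboolP; apply: idlD => //; apply: idlM.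
have pcl : prime_idealr_closed (idl_pred J).
  by move=> a b /asboolP /pJ [h|h]; apply/orP; [left|right]; apply/asboolP.
pose Ji := isIdealr.Build R (idl_pred J) cl.
pose Jp := isPrimeIdealrClosed.Build R (idl_pred J) pcl.
pose K : prime_idealr R := HB.pack (idl_pred J) Ji Jp.
by exists K => a; split => [/asboolP|ha] //; apply/asboolP.
Qed.

Definition noeth := forall J : nat -> set R, (forall k, is_ideal (J k)) ->
  (forall k, J k `<=` J k.+1) -> exists n, forall k, (n <= k)%N -> J k = J n.

Lemma noetherianP : noetherian R <-> noeth.
Proof.
split=> [h J idJ sJ|h J sJ].
  have /choice[K hK] : forall k, exists K : ideal R, forall a, (a \in K) <-> J k a.
    by move=> k; apply: ideal_of.
  have [k a /hK /sJ /hK //|n hn] := h K.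
  exists n => k /hn e; apply/seteqP; split=> a /hK.
    by rewrite e => /hK.
  by rewrite -e => /hK.
have [k|k a|n hn] := h (fun k => [set a | a \in J k]); first exact: ideal_is.
  exact: sJ.
exists n => k /hn e a; apply/idP/idP => ha.
  by have : [set a | a \in J k] a := ha; rewrite e.
by have : [set a | a \in J n] a := ha; rewrite -e.
Qed.

Definition addi V g : set R := [set a | exists2 v, V v & exists c, a = v + c * g].

Lemma addi_ideal V g : is_ideal V -> is_ideal (addi V g).
Proof.
move=> idV; split; first by exists 0; [exact: idl0|exists 0; rewrite mul0r addr0].
  move=> _ _ [v hv [c ->]] [w hw [d ->]]; exists (v + w); first exact: idlD.
  by exists (c + d); ring.
move=> a _ [v hv [c ->]]; exists (a * v); first exact: idlM.
by exists (a * c); ring.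
Qed.
Lemma addi_sub V g : V `<=` addi V g.
Proof. by move=> v hv; exists v => //; exists 0; rewrite mul0r addr0. Qed.
Lemma addi_gen V g : V 0 -> addi V g g.
Proof. by move=> V0; exists 0 => //; exists 1; rewrite mul1r add0r. Qed.
Lemma addi_min V g W : is_ideal W -> V `<=` W -> W g -> addi V g `<=` W.
Proof. by move=> idW VW Wg _ [v hv [c ->]]; apply: idlD => //; [exact: VW|exact: idlM]. Qed.

Fixpoint addis V (s : seq R) : set R := if s is g :: s' then addi (addis V s') g else V.

Lemma addis_ideal V s : is_ideal V -> is_ideal (addis V s).
Proof. by move=> idV; elim: s => //= g s IH; apply: addi_ideal. Qed.
Lemma addis_sub V s : V `<=` addis V s.
Proof. by elim: s => //= g s IH a /IH; apply: addi_sub. Qed.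
Lemma addis_gen V s g : is_ideal V -> g \in s -> addis V s g.
Proof.
move=> idV; elim: s => //= u s IH; rewrite inE => /orP[/eqP->|/IH].
  by apply: addi_gen; apply: idl0; apply: addis_ideal.
exact: addi_sub.
Qed.
Lemma addis_min V s W : is_ideal W -> V `<=` W -> (forall g, g \in s -> W g) ->
  addis V s `<=` W.
Proof.
move=> idW VW; elim: s => //= g s IH h; apply: addi_min => //.
  by apply: IH => u us; apply: h; rewrite inE us orbT.
by apply: h; rewrite inE eqxx.
Qed.

Lemma set0_ideal : is_ideal [set 0].
Proof. by split=> [//|a b -> ->|a b ->]; rewrite /= ?addr0 ?mulr0. Qed.
Lemma setT_ideal : is_ideal setT. Proof. by []. Qed.
Lemma setI_ideal U V : is_ideal U -> is_ideal V -> is_ideal (U `&` V).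
Proof.
move=> idU idV; split=> [|a b [? ?] [? ?]|a b [? ?]].
- by split; apply: idl0.
- by split; apply: idlD.
- by split; apply: idlM.
Qed.

Definition seq_ideal (s : seq R) := addis [set 0] s.
Lemma seq_ideal_is s : is_ideal (seq_ideal s).
Proof. exact/addis_ideal/set0_ideal. Qed.

Lemma seq_idealE s a : seq_ideal s a -> exists c : 'I_(size s) -> R,
  a = \sum_i c i * s`_i.
Proof.
elim: s a => [a ->|g s IH _ [v /IH[c ->] [d ->]]] /=.
  by exists (fun _ => 0); rewrite big_ord0.
exists (fun i => if unlift ord0 i is Some j then c j else d).
rewrite big_ord_recl unlift_none addrC; congr (_ + _).
by apply: eq_bigr => i _; rewrite liftK.
Qed.

(* Dependent choice turns the ascending chain condition into this maximum principle. *)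
Lemma noeth_max (F : set (set R)) : noeth -> (forall J, F J -> is_ideal J) ->
  (exists J, F J) -> exists2 J, F J & forall K, F K -> J `<=` K -> K = J.
Proof.
move=> nR idF [J0 FJ0]; apply: contrapT => nomax.
have step (J : {J | F J}) : exists K : {J | F J}, sval J `<=` sval K /\ sval K <> sval J.
  case: J => J FJ; apply: contrapT => h; apply: nomax; exists J => // K FK JK.
  by apply: contrapT => ne; apply: h; exists (exist _ K FK).
have [f hf] := choice step.
pose c k := iter k f (exist _ J0 FJ0).
have [k|k|n hn] := nR (fun k => sval (c k)).
- by case: (c k) => J /= /idF.
- by have [] := hf (c k).
- by have [_] := hf (c n); case; rewrite -[f (c n)]/(c n.+1) hn.
Qed.

Lemma noeth_fg J : noeth -> is_ideal J -> exists s, J = seq_ideal s.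
Proof.
move=> nR idJ.
have [||K [s ->] sJ] := @noeth_max [set K | exists2 s, K = seq_ideal s & K `<=` J] nR.
- by move=> _ [s -> _]; apply: seq_ideal_is.
- exists (seq_ideal [::]), [::] => // a ->; exact: idl0.
move=> hmax; exists s; apply/seteqP; split=> // a Ja.
rewrite -(hmax (seq_ideal (a :: s))); last exact: addi_sub.
  by apply: addi_gen; apply: idl0; apply: seq_ideal_is.
by exists (a :: s) => //; apply: addi_min.
Qed.

Definition mult_set (T : set R) := T 1 /\ forall a b, T a -> T b -> T (a * b).

(** An ideal maximal among those over [J] that miss [T] is prime: enlarging it by [a] and by [b]
    yields two elements of [T] whose product lies in it as soon as [a * b] does. *)
Lemma prime_avoiding J (T : set R) : noeth -> is_ideal J -> mult_set T ->
  (forall a, T a -> ~ J a) ->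
  exists P, [/\ prime_set P, J `<=` P & forall a, T a -> ~ P a].
Proof.
move=> nR idJ [T1 TM] JT.
have [|| P [idP JP TP] hmax] := @noeth_max
  [set P | [/\ is_ideal P, J `<=` P & forall a, T a -> ~ P a]] nR.
- by move=> P [].
- by exists J; split.
exists P; split=> //; split=> // [|a b Pab]; first exact: TP.
apply: contrapT => /not_orP[Pa Pb].
have meet g : ~ P g -> exists t, T t /\ addi P g t.
  move=> Pg; apply: contrapT => h; apply: Pg.
  rewrite -(hmax (addi P g)); [by apply: addi_gen; apply: idl0| |exact: addi_sub].
  split; [exact: addi_ideal|by move=> u /JP; apply: addi_sub|].
  by move=> u Tu Pu; apply: h; exists u.
have [u [Tu [p Pp [c cE]]]] := meet a Pa; have [v [Tv [q Pq [d dE]]]] := meet b Pb.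
apply: (TP _ (TM _ _ Tu Tv)); rewrite cE dE.
have -> : (p + c * a) * (q + d * b) = (q + d * b) * p + (c * a * q + c * d * (a * b)) by ring.
by apply: idlD => //; [exact: idlM|apply: idlD => //; exact: idlM].
Qed.

End Ideals.

Lemma noeth_surj (R S : comNzRingType) (f : {rmorphism R -> S}) :
  (forall b, exists a, b = f a) -> noeth R -> noeth S.
Proof.
move=> sf nR J idJ sJ.
have [k|k a|n hn] := nR (fun k => f @^-1` J k).
- split=> [|a b|a b]; rewrite /preimage /= ?rmorph0 ?rmorphD ?rmorphM.
  + exact: idl0.
  + exact: idlD.
  + exact: idlM.
- exact: sJ.
exists n => k /hn e; apply/seteqP; split=> b; have [a ->] := sf b => ha.
  by have : (f @^-1` J k) a := ha; rewrite e.
by have : (f @^-1` J n) a := ha; rewrite -e.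
Qed.

(** * Hilbert's basis theorem and finitely generated algebras *)

Section HilbertBasis.
Variable R : comNzRingType.

(** The coefficient at [n] may vanish, so the set is closed under addition without a case
    distinction on degrees. *)
Definition lead_ideal (J : set {poly R}) n : set R :=
  [set a | exists p, [/\ J p, (size p <= n.+1)%N & a = p`_n]].

Lemma lead_ideal_is J n : is_ideal J -> is_ideal (lead_ideal J n).
Proof.
move=> idJ; split.
- by exists 0; rewrite size_poly0 coef0; split=> //; apply: idl0.
- move=> _ _ [p [Jp sp ->]] [q [Jq sq ->]]; exists (p + q); rewrite coefD; split=> //.
    exact: idlD.
  by apply: leq_trans (size_polyD _ _) _; rewrite geq_max sp.
move=> a _ [p [Jp sp ->]]; exists (a%:P * p); rewrite coefCM; split=> //.
  exact: idlM.
by rewrite mul_polyC; apply: leq_trans (size_scale_leq _ _) sp.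
Qed.

Lemma lead_idealS J n : is_ideal J -> lead_ideal J n `<=` lead_ideal J n.+1.
Proof.
move=> idJ _ [p [Jp sp ->]]; exists (p * 'X); rewrite coefMX /=; split=> //.
  exact: idlMr.
by apply: leq_trans (size_polyMleq _ _) _; rewrite size_polyX addn2.
Qed.

Lemma lead_ideal_le J n n' : is_ideal J -> (n <= n')%N -> lead_ideal J n `<=` lead_ideal J n'.
Proof.
move=> idJ /subnK <-; elim: (n' - n)%N => [|k IH] // a /IH.
exact: lead_idealS.
Qed.

Lemma lead_ideal_mono J K n : J `<=` K -> lead_ideal J n `<=` lead_ideal K n.
Proof. by move=> JK _ [p [/JK Jp sp ->]]; exists p. Qed.

(** Induction on the size of an element of [K]: an element of [J] with the same top coefficient is
    subtracted. *)
Lemma lead_ideal_eq J K : is_ideal J -> is_ideal K -> J `<=` K ->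
  (forall n, lead_ideal K n `<=` lead_ideal J n) -> K = J.
Proof.
move=> idJ idK JK h; apply/seteqP; split=> // p.
have [n] := ubnP (size p); elim: n p => // n IH p; rewrite ltnS => sp Kp.
have [q [Jq sq e]] : lead_ideal J (size p).-1 p`_(size p).-1.
  by apply: h; exists p; split=> //; apply: leqSpred.
have [p0|p0] := eqVneq p 0; first by rewrite p0; apply: idl0.
have sp1 : (size p).-1.+1 = size p by rewrite prednK // lt0n size_poly_eq0.
rewrite -[p](subrK q); apply: idlD => //; apply: IH; last by apply: idlB => //; apply: JK.
apply: leq_trans sp; rewrite -[X in (_ < X)%N]sp1 ltnS; apply/leq_sizeP => j hj; rewrite coefB.
have [->|jn] := eqVneq j (size p).-1; first by rewrite e subrr.
have {}hj : (size p <= j)%N by rewrite -sp1 ltn_neqAle eq_sym jn.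
by rewrite !nth_default ?subrr //; apply: leq_trans sq _; rewrite sp1.
Qed.

Lemma hilbert_basis : noeth R -> noeth {poly R}.
Proof.
move=> nR J idJ sJ.
have sJk k k' : (k <= k')%N -> J k `<=` J k'.
  by move/subnK <-; elim: (k' - k)%N => [|i IH] // a /IH; apply: sJ.
(* The diagonal settles all degrees from [k0] on at once; the finitely many degrees below are
   settled one by one. *)
have [k|k a|k0 hk0] := nR (fun k => lead_ideal (J k) k); first exact: lead_ideal_is.
  by move=> h; apply: lead_idealS => //; apply: lead_ideal_mono h.
have stab i : exists ki, forall k, (ki <= k)%N -> lead_ideal (J k) i = lead_ideal (J ki) i.
  by apply: nR => k; [exact: lead_ideal_is|exact: lead_ideal_mono].
have [K hK] := choice stab; exists (maxn k0 (\max_(i < k0) K i)) => k hk.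
set k1 := maxn _ _ in hk *.
apply: lead_ideal_eq => //; first exact: sJk.
move=> n; have [nk|nk] := ltnP n k0.
  have h : (K n <= k1)%N by rewrite leq_max (leq_bigmax (Ordinal nk)) orbT.
  by rewrite !(hK n) //; apply: leq_trans hk.
have k01 : (k0 <= k1)%N by rewrite leq_maxl.
apply: (@subset_trans _ (lead_ideal (J (maxn k n)) (maxn k n))).
  apply: subset_trans (lead_ideal_le _ (leq_maxr k n)); last exact: idJ.
  by apply: lead_ideal_mono; apply: sJk; apply: leq_maxl.
rewrite hk0; last by rewrite leq_max nk orbT.
apply: subset_trans (lead_ideal_le _ nk); last exact: idJ.
by apply: lead_ideal_mono; apply: sJk.
Qed.
End HilbertBasis.

Fixpoint iter_poly (R : comNzRingType) (s : nat) : comNzRingType :=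
  if s is s'.+1 then {poly iter_poly R s'} else R.

Lemma iter_poly_noeth (R : comNzRingType) s : noeth R -> noeth (iter_poly R s).
Proof. by move=> nR; elim: s => //= s IH; apply: hilbert_basis. Qed.

Lemma iter_poly_eval (R S : comNzRingType) (f : {rmorphism R -> S}) (x : seq S) :
  exists e : {rmorphism iter_poly R (size x) -> S},
    (forall a, exists b, e b = f a) /\ (forall i, i \in x -> exists b, e b = i).
Proof.
elim: x => [|y x [e [eR ex]]] /=; first by exists f; split=> // a; exists a.
pose c : commr_rmorph e y := fun a => mulrC _ _.
exists (horner_morph c); split=> [a|i].
  by have [b <-] := eR a; exists b%:P; rewrite /= horner_morphC.
rewrite inE => /orP[/eqP->|/ex[b <-]]; first by exists 'X; rewrite /= horner_morphX.
by exists b%:P; rewrite /= horner_morphC.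
Qed.

(** Generation is stated as an induction principle, which for the Rees algebra is easier to verify
    than a surjection from polynomials. *)
Lemma fg_algebra_noeth (R S : comNzRingType) (f : {rmorphism R -> S}) (x : seq S) :
  noeth R ->
  (forall P : set S, (forall a, P (f a)) -> (forall i, i \in x -> P i) ->
     (forall a b, P a -> P b -> P (a + b)) -> (forall a b, P a -> P b -> P (a * b)) ->
     forall b, P b) ->
  noeth S.
Proof.
move=> nR gen; have [e [eR ex]] := iter_poly_eval f x.
apply: (noeth_surj (f := e)); last exact: iter_poly_noeth.
apply: (gen (fun b => exists a, b = e a)) => [a|i /ex[b <-]||].
- by have [b <-] := eR a; exists b.
- by exists b.
- by move=> _ _ [a ->] [b ->]; exists (a + b); rewrite rmorphD.
- by move=> _ _ [a ->] [b ->]; exists (a * b); rewrite rmorphM.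
Qed.

(** * Length and chains of ideals *)

Section Chains.
Variable R : comNzRingType.
Implicit Types (J N U V W X Y : set R).

Definition ideal_chain V U n := exists N : nat -> set R,
  [/\ forall k, is_ideal (N k), forall k, (k <= n)%N -> V `<=` N k /\ N k `<=` U
    & forall k, (k < n)%N -> N k `<=` N k.+1 /\ ~ (N k.+1 `<=` N k)].

Definition len_le V U b := forall n, ideal_chain V U n -> (n <= b)%N.
(* The module U / V has length l. *)
Definition len V U l := ideal_chain V U l /\ len_le V U l.

Lemma chain0 V U : is_ideal V -> V `<=` U -> ideal_chain V U 0.
Proof. by move=> idV VU; exists (fun _ => V); split=> // k _; split=> // a. Qed.

Lemma chain_mono V U V' U' n : V' `<=` V -> U `<=` U' ->
  ideal_chain V U n -> ideal_chain V' U' n.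
Proof.
move=> hV hU [N [idN bN sN]]; exists N; split=> // k /bN[h1 h2].
by split; [exact: subset_trans h1|exact: subset_trans hU].
Qed.

Lemma chain_rcons V X Y n : is_ideal Y -> X `<=` Y -> ~ (Y `<=` X) ->
  ideal_chain V X n -> ideal_chain V Y n.+1.
Proof.
move=> idY XY YX [N [idN bN sN]]; exists (fun k => if (k <= n)%N then N k else Y).
split=> [k|k kn|k]; first by case: ifP.
  case: ifP => [/bN[h1 h2]|_]; first by split=> //; apply: subset_trans XY.
  by split=> //; have [h1 h2] := bN _ (leqnn n); apply: subset_trans h1 (subset_trans h2 XY).
rewrite ltnS => kn; rewrite kn; case: ifP => [|/negbT]; first by move/sN.
rewrite -ltnNge ltnS => nk; have -> : k = n by apply/eqP; rewrite eqn_leq kn.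
have [h1 h2] := bN _ (leqnn n); split; first exact: subset_trans XY.
by move=> h; apply: YX; apply: subset_trans h2.
Qed.

(** Strict steps stay strict because [f] reflects inclusions. This is asked only between [V] and
    [U], since the colons and sums used for [f] reflect inclusions only there. *)
Lemma chain_map (f : set R -> set R) V U V' U' n :
  (forall N, is_ideal N -> V `<=` N -> N `<=` U -> [/\ is_ideal (f N), V' `<=` f N & f N `<=` U']) ->
  (forall N N', is_ideal N -> is_ideal N' -> N `<=` N' -> f N `<=` f N') ->
  (forall N N', is_ideal N -> is_ideal N' -> V `<=` N -> N `<=` N' -> N' `<=` U ->
     f N' `<=` f N -> N' `<=` N) ->
  ideal_chain V U n -> ideal_chain V' U' n.
Proof.
move=> hf fm fr [N [idN bN sN]].
exists (fun k => f (N (minn k n))); split=> [k|k kn|k kn].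
- by have [] := hf _ (idN (minn k n)) (bN _ (geq_minr _ _)).1 (bN _ (geq_minr _ _)).2.
- by have [] := hf _ (idN (minn k n)) (bN _ (geq_minr _ _)).1 (bN _ (geq_minr _ _)).2.
rewrite (minn_idPl kn) (minn_idPl (ltnW kn)); have [h1 h2] := sN _ kn; split; first exact: fm.
by move=> h; apply: h2; apply: fr h => //; [case: (bN k (ltnW kn))|case: (bN k.+1 kn)].
Qed.

Definition sumi U V : set R := [set a | exists2 u, U u & exists2 v, V v & a = u + v].

Lemma sumi_ideal U V : is_ideal U -> is_ideal V -> is_ideal (sumi U V).
Proof.
move=> idU idV; split.
- by exists 0; [exact: idl0|exists 0; [exact: idl0|rewrite addr0]].
- move=> _ _ [u hu [v hv ->]] [u' hu' [v' hv' ->]]; exists (u + u'); first exact: idlD.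
  by exists (v + v'); [exact: idlD|ring].
move=> a _ [u hu [v hv ->]]; exists (a * u); first exact: idlM.
by exists (a * v); [exact: idlM|rewrite mulrDr].
Qed.

Lemma sumi_l U V : V 0 -> U `<=` sumi U V.
Proof. by move=> V0 u Uu; exists u => //; exists 0 => //; rewrite addr0. Qed.
Lemma sumi_r U V : U 0 -> V `<=` sumi U V.
Proof. by move=> U0 v Vv; exists 0 => //; exists v => //; rewrite add0r. Qed.
Lemma sumi_min U V W : is_ideal W -> U `<=` W -> V `<=` W -> sumi U V `<=` W.
Proof. by move=> idW UW VW _ [u hu [v hv ->]]; apply: idlD => //; [apply: UW|apply: VW]. Qed.

(* By modularity, a strict step of a chain stays strict in its trace on W or in its sum with W. *)
Lemma len_le_add V W U a b : is_ideal V -> is_ideal W -> V `<=` W -> W `<=` U -> is_ideal U ->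
  len_le V W a -> len_le W U b -> len_le V U (a + b).
Proof.
move=> idV idW VW WU idU ha hb n [N [idN bN sN]].
suff H k : (k <= n)%N -> exists a' b',
    [/\ ideal_chain V (N k `&` W) a', ideal_chain W (sumi (N k) W) b' & (k <= a' + b')%N].
  have [a' [b' [c1 c2 le]]] := H n (leqnn n); apply: leq_trans le _; apply: leq_add.
    by apply: ha; apply: chain_mono c1 => // x [].
  apply: hb; apply: chain_mono c2 => //; apply: sumi_min => //.
  by have [] := bN n (leqnn n).
elim: k => [_|k IH kn].
  exists 0%N, 0%N; have [h1 h2] := bN 0%N (leq0n _); split=> //; apply: chain0 => //.
    by move=> x Vx; split; [apply: h1|apply: VW].
  by apply: sumi_r; apply: idl0.
have [a' [b' [c1 c2 le]]] := IH (ltnW kn); have [h1 h2] := sN _ kn.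
have sI : N k `&` W `<=` N k.+1 `&` W by move=> x [/h1].
have sS : sumi (N k) W `<=` sumi (N k.+1) W.
  by apply: sumi_min; [exact: sumi_ideal|apply: subset_trans h1 _; apply: sumi_l; apply: idl0
    |apply: sumi_r; apply: idl0].
have [hI|hI] := pselect (N k.+1 `&` W `<=` N k `&` W); last first.
  exists a'.+1, b'; split; [|exact: chain_mono c2|by rewrite addSn].
  by apply: chain_rcons c1 => //; apply: setI_ideal.
exists a', b'.+1; split; [exact: chain_mono c1| |by rewrite addnS].
apply: chain_rcons c2 => //; first exact: sumi_ideal.
move=> hS; apply: h2 => x hx.
have [y hy [w hw e]] : sumi (N k) W x by apply: hS; apply: sumi_l hx; apply: idl0.
have [] : (N k `&` W) w.
  by apply: hI; split=> //; rewrite -[w](addKr y) -e addrC; apply: idlB => //; apply: h1.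
by rewrite e => hw' _; apply: idlD.
Qed.

Lemma chain_cat V W U a b : ideal_chain V W a -> ideal_chain W U b -> ideal_chain V U (a + b).
Proof.
move=> c1 [N [idN bN sN]].
have WN k : (k <= b)%N -> W `<=` N k by move=> /bN[].
suff H k : (k <= b)%N -> ideal_chain V (N k) (a + k).
  by apply: chain_mono (H b (leqnn b)) => //; have [] := bN b (leqnn b).
elim: k => [_|k IH kb]; first by rewrite addn0; apply: chain_mono c1 => //; apply: WN.
by rewrite addnS; have [h1 h2] := sN _ kb; apply: chain_rcons (IH (ltnW kb)).
Qed.

Lemma len_le_mono V U V' U' b : V' `<=` V -> U `<=` U' -> len_le V' U' b -> len_le V U b.
Proof. by move=> h1 h2 h n c; apply: h; apply: chain_mono c. Qed.

Lemma len_ex V U b : is_ideal V -> V `<=` U -> len_le V U b -> exists2 l, len V U l & (l <= b)%N.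
Proof.
move=> idV VU h; pose P n := `[< ideal_chain V U n >].
have exP : exists n, P n by exists 0%N; apply/asboolP; apply: chain0.
have bP n : P n -> (n <= b)%N by move/asboolP/h.
have [l /asboolP cl hl] := ex_maxnP exP bP.
by exists l; [split=> // n c; apply: hl; apply/asboolP|apply: h].
Qed.

Lemma len_uniq V U l l' : len V U l -> len V U l' -> l = l'.
Proof. by move=> [c h] [c' h']; apply/eqP; rewrite eqn_leq h // h'. Qed.

Lemma len_add V W U a b : is_ideal V -> is_ideal W -> V `<=` W -> W `<=` U -> is_ideal U ->
  len V W a -> len W U b -> len V U (a + b).
Proof.
move=> idV idW VW WU idU [c h] [c' h']; split; first exact: chain_cat c c'.
exact: len_le_add h h'.
Qed.

Lemma len_split V W U l : is_ideal V -> is_ideal W -> is_ideal U -> V `<=` W -> W `<=` U ->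
  len V U l -> exists a b, [/\ len V W a, len W U b & l = (a + b)%N].
Proof.
move=> idV idW idU VW WU h.
have [a ha _] := len_ex idV VW (len_le_mono (fun=> id) WU h.2).
have [b hb _] := len_ex idW WU (len_le_mono VW (fun=> id) h.2).
exists a, b; split=> //; exact: len_uniq h (len_add idV idW VW WU idU ha hb).
Qed.

Definition colon V g : set R := [set a | V (a * g)].
Lemma colon_ideal V g : is_ideal V -> is_ideal (colon V g).
Proof.
move=> idV; split=> [|a b ha hb|a b hb]; rewrite /colon /=.
- by rewrite mul0r; apply: idl0.
- by rewrite mulrDl; apply: idlD.
- by rewrite -mulrA; apply: idlM.
Qed.

(** Multiplication by [g] makes the module a quotient of [R / Q]; chains are pulled back by taking
    colons. *)
Lemma len_le_cyclic V g (Q : set R) b : is_ideal V -> (forall q, Q q -> V (q * g)) ->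
  len_le Q setT b -> len_le V (addi V g) b.
Proof.
move=> idV hQ h n c; apply: h; apply: (chain_map (f := fun N => colon N g)) c => [N idN VN NU|N N' _ _ NN a|N N' idN idN' VN NN NU hc].
- by split=> //; [exact: colon_ideal|move=> q /hQ; apply: VN].
- by rewrite /colon /= => /NN.
move=> x hx; have [v Vv [a e]] := NU _ hx.
have : colon N' g a by rewrite /colon /=; apply: (idlBl idN' (a := x)) => //; rewrite e addrK; apply/NN/VN.
by move/hc => hag; rewrite e; apply: idlD => //; apply: VN.
Qed.

Lemma len_le_refl V : len_le V V 0.
Proof.
move=> [//|n] [N [idN bN sN]]; have [h1 h2] := sN 0%N isT; case: h2.
by have [_ h] := bN 1%N isT; have [h' _] := bN 0%N isT; apply: subset_trans h'.
Qed.

(** Each of the [n] layers between consecutive powers of [g] is a quotient of the ring modulo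
    [addi V g]. *)
Lemma len_le_addi_pow V g b n : is_ideal V -> len_le (addi V g) setT b ->
  len_le (addi V (g ^+ n)) setT (n * b).
Proof.
move=> idV h; elim: n => [|n IH].
  rewrite mul0n; apply: len_le_mono (@len_le_refl setT) => //.
  by move=> a _; exists 0; [exact: idl0|exists a; rewrite add0r mulr1].
rewrite mulSn; have idn k := addi_ideal (g ^+ k) idV.
have sn : addi V (g ^+ n.+1) `<=` addi V (g ^+ n).
  apply: addi_min => //; first exact: addi_sub.
  by rewrite exprS; apply: idlM => //; apply: addi_gen; apply: idl0.
apply: (len_le_add (W := addi V (g ^+ n))) => //.
apply: len_le_mono (len_le_cyclic (g := g ^+ n) (idn n.+1) _ h) => //.
  apply: addi_min => //; first exact: addi_ideal.
    by apply: subset_trans (@addi_sub _ _ _); apply: addi_sub.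
  by apply: addi_gen; apply: idl0.
move=> _ [v Vv [c ->]]; rewrite mulrDl -mulrA -exprS; apply: idlD => //.
  by apply: addi_sub; apply: idlMr.
by apply: idlM => //; apply: addi_gen; apply: idl0.
Qed.

Lemma addis_addi V g s : is_ideal V -> addis (addi V g) s = addi (addis V s) g.
Proof.
move=> idV; have idVg := addi_ideal g idV; apply/seteqP; split.
  apply: addis_min; first exact/addi_ideal/addis_ideal.
    apply: addi_min; first exact/addi_ideal/addis_ideal.
      by apply: subset_trans (@addi_sub _ _ _); apply: addis_sub.
    by apply: addi_gen; apply: idl0; apply: addis_ideal.
  by move=> u us; apply: addi_sub; apply: addis_gen.
apply: addi_min; first exact: addis_ideal.
  apply: addis_min; first exact: addis_ideal.
    by apply: subset_trans (@addis_sub _ _ _); apply: addi_sub.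
  by move=> u us; apply: addis_gen.
by apply: addis_sub; apply: addi_gen; apply: idl0.
Qed.

(** Every generator contributes one factor [n]; for a system of parameters this is growth of order
    [d]. *)
Lemma len_le_addis_pow V s b n : is_ideal V -> len_le (addis V s) setT b ->
  len_le (addis V [seq g ^+ n | g <- s]) setT (n ^ size s * b).
Proof.
elim: s V b => [|g s IH] V b idV /= h; first by rewrite expn0 mul1n.
rewrite expnS -mulnA; apply: len_le_addi_pow; first exact: addis_ideal.
rewrite -addis_addi //; apply: IH; first exact: addi_ideal.
by rewrite addis_addi.
Qed.

End Chains.

Lemma has_lengthP (R : comNzRingType) (N : ideal R) l :
  has_length (quotmod N) l <-> len [set a | a \in N] setT l.
Proof.
have idN := ideal_is N.
suff E n : has_submod_chain (quotmod N) n <-> ideal_chain [set a | a \in N] setT n.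
  by split=> -[c h]; split; [exact/E|move=> n /E /h|exact/E|move=> n /E /h].
pose p := @quotmod_pi R R^o N.
have p00 : p 0 = 0 by apply: (raddf0 (@quotmod_pi R R^o N)).
have pD a b : p (a + b) = p a + p b by apply: (raddfD (@quotmod_pi R R^o N)).
have pZ a (b : R) : p (a * b) = a *: p b := esym (@quotmod_piZ R R^o N a b).
have p0 a : a \in N -> p a = 0.
  by move=> ha; rewrite -p00; apply/quotmod_piE; rewrite subr0.
split=> [[M sM]|[M [idM bM sM]]].
  exists (fun k => [set a | p a \in M k]); split=> [k|k _|k kn].
  - split=> [|a b ha hb|a b hb] /=; first by rewrite p00 rpred0.
      by rewrite pD rpredD.
    by rewrite pZ rpredZ.
  - by split=> // a /= ha; rewrite p0 // rpred0.
  have [h1 h2] := sM k kn; split=> [a /h1 //|h]; apply: h2 => u.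
  by have [a ->] := quotmod_pi_repr u; apply: h.
have pM k a b : (k <= n)%N -> p a = p b -> M k a -> M k b.
  move=> /bM[h _] /quotmod_piE /h hab ha; exact: idlBl hab ha.
pose L k : {pred quotmod N} := fun u => `[< exists2 a, M (minn k n) a & u = p a >].
have clL k : submod_closed (L k).
  split=> [|c u v /asboolP[a ha ->] /asboolP[b hb ->]]; apply/asboolP.
    by exists 0; [exact: idl0|rewrite p00].
  exists (c * a + b); first by apply: (idlD (idM _)) => //; apply: (idlM (idM _)).
  by rewrite pD pZ.
pose Li k := GRing.isSubmodClosed.Build R (quotmod N) (L k) (clL k).
pose Ls k : submodClosed (quotmod N) := HB.pack (L k) (Li k).
have LsE k a : (k <= n)%N -> (p a \in Ls k) <-> M k a.
  move=> kn; split=> [/asboolP[b]|ha]; last by apply/asboolP; exists a; rewrite ?(minn_idPl kn).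
  rewrite (minn_idPl kn) => hb e; exact: (pM k b a kn (esym e) hb).
exists Ls => k kn; have [h1 h2] := sM k kn; split=> [u|h].
  by have [a ->] := quotmod_pi_repr u; move=> /(LsE _ _ (ltnW kn)) /h1 /(LsE _ _ kn).
by apply: h2 => a /(LsE _ _ kn) /h /(LsE _ _ (ltnW kn)).
Qed.

(** * Local rings: finite colength and regular sequences *)

Section LocalRing.
Variables (A : comNzRingType) (m : idealr A).
Hypotheses (noethA : noetherian A) (localA : local_ring m).
Let nA : noeth A := (noetherianP A).1 noethA.
Local Notation mS := [set a | a \in m].

Lemma local_unit a : a \notin m -> exists b, a * b = 1.
Proof.
move=> am; apply: contrapT => h.
have [|| J [idJ J1 Ja] hmax] := @noeth_max _
    [set J : set A | [/\ is_ideal J, ~ J 1 & J a]] nA; first by move=> J [].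
  exists (seq_ideal [:: a]); split; first exact: seq_ideal_is.
    by move=> [_ -> [c e]]; apply: h; exists c; rewrite e add0r mulrC.
  by apply: addi_gen.
have [K hK] := idealr_of idJ J1.
suff /localA.2 /(_ a) e : maximal_ideal K by case/negP: am; rewrite -e; apply/hK.
move=> L KL b; apply/idP/idP => [hb|/KL //].
apply/hK; rewrite -(hmax [set a | a \in L]) //.
  split; [exact: idealr_is|by rewrite /= idealr1|by apply/KL/hK].
by move=> c /hK /KL.
Qed.

Lemma proper_sub_max (J : set A) : is_ideal J -> ~ J 1 -> J `<=` mS.
Proof.
move=> idJ J1 a Ja /=; apply: contrapT => /negP /local_unit[b ab]; apply: J1.
by rewrite -ab; apply: idlMr.
Qed.

Lemma max_prime : prime_set mS.
Proof.
split; [exact: idealr_is|by rewrite /= idealr1|move=> a b /= hab].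
apply: contrapT => /not_orP[/negP /local_unit[a' ha] /negP /local_unit[b' hb]].
have : (a * a') * (b * b') \in m.
  have -> : (a * a') * (b * b') = a' * b' * (a * b) by ring.
  exact: idealMr.
by rewrite ha hb mulr1 idealr1.
Qed.

Lemma len_le_max : len_le mS setT 1.
Proof.
move=> n [N [idN bN sN]]; rewrite leqNgt; apply/negP => n1.
have [h1 h2] := sN 0%N (ltnW n1); have [h3 h4] := sN 1%N n1.
apply: h4 => a _; apply: contrapT => N1a.
have N1m : N 1%N `<=` mS.
  by apply: proper_sub_max => // N1; apply: N1a; rewrite -[a]mulr1; apply: idlM.
by apply: h2 => b /N1m; have [h _] := bN 0%N (leq0n n); apply: h.
Qed.

(** A maximal counterexample [W] can be enlarged by some [z] with [m z] inside [W], which adds a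
    layer of length at most 1 and so bounds the colength of [W] after all. *)
Lemma finite_len (V : set A) : is_ideal V -> (forall a, a \in m -> exists n, V (a ^+ n)) ->
  exists b, len_le V setT b.
Proof.
move=> idV radV; apply: contrapT => nV.
have [|| W [idW radW nW] hmax] := @noeth_max _ [set V : set A | [/\ is_ideal V,
    forall a, a \in m -> exists n, V (a ^+ n) & ~ exists b, len_le V setT b]] nA.
- by move=> J [].
- by exists V.
have W1 : ~ W 1.
  move=> W1; apply: nW; exists 0%N; apply: len_le_mono (@len_le_refl _ setT) => // a _.
  by rewrite -[a]mulr1; apply: idlM.
(* With a maximal colon, multiplying [z] by an element that keeps it outside [W] does not change the
   colon. *)
have [|| C [z [zW CE]] Cmax] := @noeth_max _
    [set C : set A | exists z, ~ W z /\ C = colon W z] nA.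
- by move=> _ [z [_ ->]]; apply: colon_ideal.
- by exists (colon W 1), 1.
(* If [a * z] stayed outside [W], so would every [a ^+ n * z], while some power of [a] lies in
   [W]. *)
have mz a : a \in m -> W (a * z).
  move=> am; apply: contrapT => naz.
  have stab y : ~ W (y * z) -> colon W (y * z) = C.
    move=> nyz; apply: Cmax; first by exists (y * z).
    by rewrite CE => b; rewrite /colon /= mulrCA; apply: idlM.
  have pw n : ~ W (a ^+ n * z).
    elim: n => [|n IH]; first by rewrite expr0 mul1r.
    by rewrite exprS -mulrA => h; have : C a; [rewrite -(stab _ IH)|rewrite CE].
  by have [n hn] := radW a am; apply: (pw n); apply: idlMr.
have idWz := addi_ideal z idW.
apply: zW; rewrite -(hmax (addi W z)); [by apply: addi_gen; apply: idl0| |exact: addi_sub].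
split=> //; first by move=> a /radW[n hn]; exists n; apply: addi_sub.
move=> [b hb]; apply: nW; exists (1 + b)%N.
apply: (len_le_add (W := addi W z)) hb => //; first exact: addi_sub.
exact: len_le_cyclic len_le_max.
Qed.

Lemma ideal_genP (s : seq A) a : (a \in ideal_gen [set y | y \in s]) <-> seq_ideal s a.
Proof.
have idS := seq_ideal_is s.
split=> [/asboolP|].
  have [K hK] := ideal_of idS.
  move=> /(_ K) h; apply/hK; apply: h => y ys; apply/hK.
  by apply: addis_gen => //; apply: set0_ideal.
have idG := ideal_is (ideal_gen [set y | y \in s]).
apply: (addis_min idG) => [_ ->|g gs]; first exact: (idl0 idG).
exact: mem_ideal_gen.
Qed.

Definition prime_seq (n : nat) (P : nat -> set A) :=
  (forall k, (k <= n)%N -> prime_set (P k)) /\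
  forall k, (k < n)%N -> P k `<=` P k.+1 /\ ~ (P k.+1 `<=` P k).

Lemma prime_seq_le d n P : krull_dim A d -> prime_seq n P -> (n <= d)%N.
Proof.
move=> [_ h] [pP sP].
have /choice[Q hQ] : forall k, exists Q : prime_idealr A, forall a, a \in Q <-> P (minn k n) a.
  by move=> k; apply: prime_idealr_of; apply: pP; apply: geq_minr.
apply: (h n Q) => k kn; have [h1 h2] := sP k kn.
have Ek a : a \in Q k <-> P k a by rewrite -[in P k](minn_idPl (ltnW kn)).
have Ek1 a : a \in Q k.+1 <-> P k.+1 a by rewrite -[in P k.+1](minn_idPl kn).
by split=> [a /Ek/h1/Ek1|hs] //; apply: h2 => a /Ek1/hs/Ek.
Qed.

Lemma prime_seq_rcons n P Q : prime_set Q -> P n `<=` Q -> ~ (Q `<=` P n) ->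
  prime_seq n P -> prime_seq n.+1 (fun k => if (k <= n)%N then P k else Q).
Proof.
move=> pQ PQ QP [pP sP]; split=> k; first by case: ifP => [/pP|].
rewrite ltnS => kn; rewrite kn; case: ifP => [/sP//|/negbT].
by rewrite -ltnNge ltnS => nk; have -> : k = n by apply/eqP; rewrite eqn_leq kn.
Qed.

Section RegularSeq.
Variables (xs : seq A) (regxs : regular_seq m xs).

(* If s x^n lies in (x_1..x_k) with s outside P, regularity of x = x_(k+1) puts s in P;
   so some prime over (x_1..x_k) avoids all s x^n and is strictly smaller than P. *)
Lemma regular_prime_seq k P : (k <= size xs)%N -> prime_set P ->
  seq_ideal (take k xs) `<=` P -> exists2 Q, prime_seq k Q & Q k = P.
Proof.
elim: k P => [|k IH] P kn pP sP; first by exists (fun _ => P).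
have idk := seq_ideal_is (take k xs).
have idk1 := seq_ideal_is (take k.+1 xs).
have tkE : take k.+1 xs = rcons (take k xs) xs`_k by rewrite (take_nth 0).
have sk : seq_ideal (take k xs) `<=` P.
  apply: subset_trans sP; apply: addis_min => // [_ ->|g gs]; first exact: idl0.
  by apply: addis_gen; [exact: set0_ideal|rewrite tkE mem_rcons inE gs orbT].
have xP : P xs`_k.
  apply: sP; apply: addis_gen; [exact: set0_ideal|by rewrite tkE mem_rcons inE eqxx].
have [_ rg _] := regxs; have [idP P1 pPM] := pP.
pose T : set A := [set a | exists s n, ~ P s /\ a = s * xs`_k ^+ n].
have [|a Ta Ja|Q [pQ sQ TQ]] := prime_avoiding (T := T) nA idk.
- split; first by exists 1, 0%N; rewrite mulr1.
  move=> _ _ [s [n [Ps ->]]] [s' [n' [Ps' ->]]]; exists (s * s'), (n + n')%N.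
  by split=> [/pPM[]//|]; rewrite exprD; ring.
- have [s [n [Ps e]]] := Ta; rewrite {}e in Ja; apply/Ps/sk.
  elim: n Ja {Ta} => [|n IHn]; first by rewrite mulr1.
  rewrite exprS mulrCA => h; apply: IHn.
  by apply/ideal_genP; apply: rg => //; apply/ideal_genP.
have QP : Q `<=` P.
  move=> a Qa; apply: contrapT => nPa; apply: (TQ a) => //.
  by exists a, 0%N; rewrite mulr1.
have [Q' pQ' Qk] := IH Q (ltnW kn) pQ sQ.
exists (fun j => if (j <= k)%N then Q' j else P); last by rewrite ltnn.
apply: prime_seq_rcons => //; rewrite Qk // => PQ; apply: (TQ xs`_k); last exact/PQ/xP.
by exists 1, 1%N; rewrite mul1r.
Qed.

(** A prime over [xs] without powers of [a] would have a chain of length [size xs] ending in it and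
    [m] strictly above it, against the dimension. *)
Lemma regular_radical a : krull_dim A (size xs) -> a \in m -> exists n, seq_ideal xs (a ^+ n).
Proof.
move=> dimA am; apply: contrapT => h.
have [|_ [n _ <-] Ja|Q [pQ sQ TQ]] := prime_avoiding (T := range (fun n => a ^+ n)) nA (seq_ideal_is xs).
- split; first by exists 0%N.
  by move=> _ _ [n _ <-] [n' _ <-]; exists (n + n')%N; rewrite ?exprD.
- by apply: h; exists n.
have [|Q' pQ' QE] := @regular_prime_seq (size xs) Q (leqnn _) pQ.
  by rewrite take_size.
have [idQ Q1 _] := pQ.
have /(prime_seq_le dimA) : prime_seq (size xs).+1 (fun k => if (k <= size xs)%N then Q' k else mS).
  apply: prime_seq_rcons => //; rewrite ?QE; [exact: max_prime|exact: proper_sub_max|].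
  by move=> mQ; apply: (TQ a); [exists 1%N; rewrite ?expr1|apply: mQ].
by rewrite ltnn.
Qed.

Lemma regular_head a : (0 < size xs)%N -> xs`_0 * a = 0 -> a = 0.
Proof.
move=> xs0 e; have [_ rg _] := regxs.
have : a \in ideal_gen [set y | y \in take 0 xs].
  by apply: rg => //; apply/ideal_genP; rewrite take0 /seq_ideal /= e.
by move/ideal_genP; rewrite take0.
Qed.
End RegularSeq.

End LocalRing.

(** * Powers of an ideal *)

Section Powers.
Variable R : comNzRingType.
Implicit Types (K L : {pred R}) (W : set R).

Definition pw K n : set R := [set a | a \in ideal_pow K n].

Lemma pw_is K n : is_ideal (pw K n). Proof. exact: ideal_is. Qed.

Lemma pwM K i j a b : pw K i a -> pw K j b -> pw K (i + j) (a * b).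
Proof. exact: ideal_powM. Qed.

Lemma pw_min K n W : is_ideal W ->
  (forall f : 'I_n -> R, (forall k, f k \in K) -> W (\prod_(k < n) f k)) -> pw K n `<=` W.
Proof.
move=> idW h a /asboolP ha; have [J hJ] := ideal_of idW.
by apply/hJ; apply: ha => _ [f hf ->]; apply/hJ/h.
Qed.

Lemma pw_prod K n (f : 'I_n -> R) : (forall k, f k \in K) -> pw K n (\prod_(k < n) f k).
Proof. by move=> hf; apply: mem_ideal_gen; exists f. Qed.

Lemma pw1_gen K a : a \in K -> pw K 1 a.
Proof. by move=> ha; have := @pw_prod K 1 (fun _ => a) (fun _ => ha); rewrite big_ord1. Qed.

Lemma pw0 K : pw K 0 = setT.
Proof. by apply/seteqP; split=> // a _; apply: ideal_pow0. Qed.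

Lemma pw_add_min K i j W : is_ideal W ->
  (forall a b, pw K i a -> pw K j b -> W (a * b)) -> pw K (i + j) `<=` W.
Proof.
move=> idW h; apply: pw_min => // f hf; rewrite big_split_ord /=.
by apply: h; apply: pw_prod.
Qed.

Lemma pwS_min K n W : is_ideal W ->
  (forall a b, a \in K -> pw K n b -> W (a * b)) -> pw K n.+1 `<=` W.
Proof.
move=> idW h; apply: pw_min => // f hf; rewrite big_ord_recl.
by apply: h => //; apply: pw_prod.
Qed.

Lemma pwS K n a b : a \in K -> pw K n b -> pw K n.+1 (a * b).
Proof. by move=> ha hb; rewrite -add1n; apply: pwM => //; apply: pw1_gen. Qed.

Lemma pw_le K i j : (i <= j)%N -> pw K j `<=` pw K i.
Proof.
move=> /subnK <-; elim: (j - i)%N => // k IH; rewrite addSn.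
by apply: (pwS_min (pw_is _ _)) => a b _ /IH; apply: (idlM (pw_is _ _)).
Qed.

Lemma pw_mono K L n : {subset K <= L} -> pw K n `<=` pw L n.
Proof.
by move=> KL; apply: (pw_min (pw_is _ _)) => f hf; apply: pw_prod => k; apply: KL.
Qed.

Lemma pw_eq K L n : K =i L -> pw K n = pw L n.
Proof. by move=> KL; apply/seteqP; split; apply: pw_mono => a; rewrite KL. Qed.

Lemma pw_pow K n l : pw (ideal_pow K n) l = pw K (n * l).
Proof.
elim: l => [|l IH]; first by rewrite muln0 !pw0.
apply/seteqP; split.
  apply: (pwS_min (pw_is _ _)) => a b ha; rewrite IH => hb.
  by rewrite mulnS; apply: pwM.
rewrite mulnS; apply: (pw_add_min (pw_is _ _)) => a b ha hb.
by apply: pwS => //; rewrite IH.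
Qed.

Lemma pwX K a n : a \in K -> pw K n (a ^+ n).
Proof.
by move=> ha; have := @pw_prod K n (fun _ => a) (fun _ => ha); rewrite prodr_const card_ord.
Qed.

End Powers.

(** * The Rees algebra is noetherian *)

Section ReesNoeth.
Variables (A : comNzRingType) (I : idealr A).
Hypothesis nA : noeth A.

(** The value is 0 when a coefficient lies outside its power of [I]; [to_reesK] covers the
    meaningful case. *)
Definition to_rees (p : {poly A}) : rees I := insubd (0 : rees I) p.

Lemma to_reesK (p : {poly A}) : (forall n, pw I n p`_n) -> rees_val (to_rees p) = p.
Proof. by move=> hp; rewrite /to_rees -[LHS]/(val _) insubdK //; apply/asboolP. Qed.

Lemma rees_coef (p : rees I) n : pw I n (rees_val p)`_n.
Proof. by have /asboolP h := rees_valP p; apply: h. Qed.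

Lemma rees_valD (p q : rees I) : rees_val (p + q) = rees_val p + rees_val q. Proof. by []. Qed.
Lemma rees_valM (p q : rees I) : rees_val (p * q) = rees_val p * rees_val q. Proof. by []. Qed.

Lemma pw_mono_coef a n : pw I n a -> forall i, pw I i ((a *: 'X^n : {poly A})`_i).
Proof.
move=> ha i; rewrite coefZ coefXn; case: eqP => [->|_]; first by rewrite mulr1.
by rewrite mulr0; apply: idl0; apply: pw_is.
Qed.

Definition rees_const (a : A) : rees I := Rees (polyC_rees I a).
Fact rees_const_zmod : zmod_morphism rees_const.
Proof. by move=> a b; apply: val_inj; rewrite /= polyCB. Qed.
Fact rees_const_monoid : monoid_morphism rees_const.
Proof. by split=> [|a b]; apply: val_inj; rewrite //= polyCM. Qed.
HB.instance Definition _ := GRing.isZmodMorphism.Build A (rees I) rees_const rees_const_zmod.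
HB.instance Definition _ := GRing.isMonoidMorphism.Build A (rees I) rees_const rees_const_monoid.

Lemma idealr_fg : exists s : seq A, [set a | a \in I] = seq_ideal s.
Proof. by apply: noeth_fg => //; apply: idealr_is. Qed.

(** The [g *: 'X], for generators [g] of [I], generate over [A]: in each degree [n] the [a] for
    which [a *: 'X^n] is reached form an ideal, so products of elements of [I] suffice. *)
Lemma rees_noeth : noeth (rees I).
Proof.
have [s sE] := idealr_fg.
have sI g : g \in s -> g \in I.
  move=> gs; have : seq_ideal s g by apply: addis_gen => //; apply: set0_ideal.
  by rewrite -sE.
apply: (fg_algebra_noeth (f := rees_const) (x := [seq to_rees (g *: 'X) | g <- s])) => //.
move=> P Pc Px PD PM.
have P0 : P 0 by have := Pc 0; rewrite raddf0.
have rv0 : rees_val (0 : rees I) = 0 by [].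
have toD a b n : pw I n a -> pw I n b ->
    to_rees ((a + b) *: 'X^n) = to_rees (a *: 'X^n) + to_rees (b *: 'X^n).
  move=> ha hb; apply: val_inj; rewrite [LHS]to_reesK ?[RHS]rees_valD ?to_reesK ?scalerDl //.
  - exact: pw_mono_coef.
  - exact: pw_mono_coef.
  - by rewrite -scalerDl; apply: pw_mono_coef; apply: idlD => //; apply: pw_is.
have toM a b n k : pw I n a -> pw I k b ->
    to_rees ((a * b) *: 'X^(n + k)) = to_rees (a *: 'X^n) * to_rees (b *: 'X^k).
  move=> ha hb; apply: val_inj; rewrite [LHS]to_reesK ?[RHS]rees_valM ?to_reesK.
  - by rewrite exprD -scalerAl -scalerAr scalerA.
  - exact: pw_mono_coef.
  - exact: pw_mono_coef.
  - by apply: pw_mono_coef; apply: pwM.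
have to0 n : to_rees (0 *: 'X^n) = 0.
  by apply: val_inj; rewrite /= scale0r to_reesK // => i; rewrite coef0; apply: idl0; apply: pw_is.
have toC a : to_rees (a *: 'X^0) = rees_const a.
  apply: val_inj; rewrite [LHS]to_reesK; first by rewrite expr0 alg_polyC.
  by apply: pw_mono_coef; rewrite pw0.
have P1 a : a \in I -> P (to_rees (a *: 'X^1)).
  move=> ha; have : seq_ideal s a by rewrite -sE.
  suff H : seq_ideal s `<=` [set a | pw I 1 a /\ P (to_rees (a *: 'X^1))] by case/H.
  apply: addis_min => [|_ ->|g gs].
  - split=> [|b c [hb Pb] [hc Pc']|b c [hc Pc']].
    + by split; [apply: idl0; apply: pw_is|rewrite to0].
    + by split; [apply: idlD => //; apply: pw_is|rewrite toD //; apply: PD].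
    + split; first by apply: idlM => //; apply: pw_is.
      by rewrite -[1%N]add0n toM // ?pw0 // toC; apply: PM.
  - by split; [apply: idl0; apply: pw_is|rewrite to0].
  - split; first exact/pw1_gen/sI.
    by apply: Px; apply/mapP; exists g.
have Pn n : pw I n `<=` [set a | pw I n a /\ P (to_rees (a *: 'X^n))].
  elim: n => [|n IH]; first by move=> a _; rewrite /= pw0 toC; split.
  apply: pwS_min => [|a b ha /IH[hb Pb]].
    split=> [|b c [hb Pb] [hc Pc']|b c [hc Pc']].
    + by split; [apply: idl0; apply: pw_is|rewrite to0].
    + by split; [apply: idlD => //; apply: pw_is|rewrite toD //; apply: PD].
    + split; first by apply: idlM => //; apply: pw_is.
      by rewrite -[n.+1]add0n toM // ?pw0 // toC; apply: PM.
  split; first exact: pwS.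
  by rewrite -add1n toM //; [apply: PM => //; apply: P1|apply: pw1_gen].
move=> p; have -> : p = \sum_(k < size (rees_val p)) to_rees ((rees_val p)`_k *: 'X^k).
  apply: val_inj; rewrite /=.
  have -> n (F : 'I_n -> rees I) : rees_val (\sum_k F k) = \sum_k rees_val (F k).
    exact: (big_morph (@rees_val A I)).
  rewrite -[LHS]coefK poly_def; apply: eq_bigr => k _.
  by rewrite to_reesK //; apply: pw_mono_coef; apply: rees_coef.
apply: (big_ind P) => // k _.
by have [] := Pn k _ (rees_coef p k).
Qed.

HB.instance Definition _ := GRing.RMorphism.copy (@gr_pi A I)
  (\pi_{ideal_quot (@rees_ker A I)} : rees I -> gr I).

Lemma gr_pi_surj (b : gr I) : exists p, b = gr_pi p.
Proof. by exists (repr b); rewrite /gr_pi reprK. Qed.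

Lemma gr_noeth : noeth (gr I).
Proof. exact: (noeth_surj (f := @gr_pi A I)) gr_pi_surj rees_noeth. Qed.

(** Each [W k] is an ideal of the Rees algebra cut into degrees, which is why [k0] is uniform in
    [n]. This is the chain condition that [graded_pair] asks for. *)
Lemma rees_acc (W : nat -> nat -> set A) :
  (forall k n, is_ideal (W k n)) -> (forall k n, W k n `<=` pw I n) ->
  (forall k n a b, a \in I -> W k n b -> W k n.+1 (a * b)) ->
  (forall k n, W k n `<=` W k.+1 n) ->
  exists k0, forall k, (k0 <= k)%N -> forall n, W k n = W k0 n.
Proof.
move=> idW WI WM Wk.
have WMp k i j a b : pw I i a -> W k j b -> W k (i + j)%N (a * b).
  move=> ha hb; suff H : pw I i `<=` [set a | W k (i + j)%N (a * b)] by apply: H.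
  elim: i {a ha} => [|i IH]; first by move=> a _; apply: idlM.
  apply: pwS_min => [|a c ha /IH hc].
    split=> [|a c ha hc|a c hc] /=.
    - by rewrite mul0r; apply: idl0.
    - by rewrite mulrDl; apply: idlD.
    - by rewrite -mulrA; apply: idlM.
  by rewrite /= -mulrA addSn; apply: WM.
pose J k : set (rees I) := [set p | forall n, W k n (rees_val p)`_n].
have [k|k p hp n|k0 hk0] := rees_noeth (J := J).
- split=> [n|p q hp hq n|p q hq n].
  + by rewrite coef0; apply: idl0.
  + by rewrite rees_valD coefD; apply: idlD.
  + rewrite rees_valM coefM; apply: idl_sum => // i _.
    rewrite -[n in W k n](subnKC (ltn_ord i : (i <= n)%N)).
    by apply: WMp => //; apply: rees_coef.
- by apply: Wk.
exists k0 => k hk n.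
have inJ k' a : W k' n a -> J k' (to_rees (a *: 'X^n)).
  move=> ha i; rewrite to_reesK; last exact/pw_mono_coef/WI/ha.
  rewrite coefZ coefXn; case: eqP => [->|_]; first by rewrite mulr1.
  by rewrite mulr0; apply: idl0.
have outJ k' a : pw I n a -> J k' (to_rees (a *: 'X^n)) -> W k' n a.
  move=> ha /(_ n); rewrite to_reesK; last exact: pw_mono_coef.
  by rewrite coefZ coefXn eqxx mulr1.
by apply/seteqP; split=> a ha; apply: outJ (WI _ _ _ ha) _;
  [rewrite -(hk0 k hk)|rewrite (hk0 k hk)]; apply: inJ.
Qed.

End ReesNoeth.

(** * Hilbert polynomials *)

Section FiniteDifferences.
Implicit Types (H G : nat -> int).

Definition dif H n : int := H n.+1 - H n.

(* For large n, H agrees with a polynomial of degree < D. *)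
Fixpoint ev_poly D H : Prop :=
  if D is D'.+1 then ev_poly D' (dif H) else exists N, forall n, (N <= n)%N -> H n = 0.

Lemma ev_poly_ext D H G : (exists N, forall n, (N <= n)%N -> H n = G n) ->
  ev_poly D H -> ev_poly D G.
Proof.
elim: D H G => /= [|D IH] H G [N HG].
  move=> [M hM]; exists (maxn N M) => n; rewrite geq_max => /andP[h1 h2].
  by rewrite -HG // hM.
apply: IH; exists N => n Nn; rewrite /dif !HG //; exact: leq_trans Nn _.
Qed.

Lemma ev_polyB D H G : ev_poly D H -> ev_poly D G -> ev_poly D (fun n => H n - G n).
Proof.
elim: D H G => /= [|D IH] H G.
  move=> [M hM] [N hN]; exists (maxn N M) => n; rewrite geq_max => /andP[h1 h2].
  by rewrite hM // hN // subr0.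
move=> hH hG; apply: ev_poly_ext (IH _ _ hH hG); exists 0%N => n _.
by rewrite /dif; ring.
Qed.

Lemma ev_poly_shift D H : ev_poly D (fun n => H n.+1) <-> ev_poly D H.
Proof.
elim: D H => /= [|D IH] H; last exact: (IH (dif H)).
split=> [[N hN]|[N hN]].
  by exists N.+1 => -[|n] //; rewrite ltnS => /hN.
by exists N => n hn; apply: hN; apply: leqW.
Qed.

Lemma dif_bin i n : 'C(n.+1 + i.+1, i.+1)%:Z - 'C(n + i.+1, i.+1)%:Z = 'C(n.+1 + i, i)%:Z.
Proof.
rewrite addSn binS addnS PoszD addrAC subrr add0r; congr (Posz 'C(_, _)); lia.
Qed.

(** The difference is summed, the constant of summation being the new coefficient. In the binomial
    basis the coefficients are integers, as Hilbert coefficients have to be. *)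
Lemma ev_poly_bin D H : ev_poly D H -> exists a : nat -> int, exists N,
  forall n, (N <= n)%N -> H n = \sum_(i < D) a i * 'C(n + i, i)%:Z.
Proof.
elim: D H => /= [|D IH] H.
  by move=> [N hN]; exists (fun=> 0), N => n /hN ->; rewrite big_ord0.
(* The backward difference is chosen because it sends the binomial of index [i.+1] at [n] to that of
   index [i] at the same [n]. *)
move=> hH; have [|a [M ha]] := IH (fun n => H n - H n.-1); first exact/ev_poly_shift.
pose c n := H n - \sum_(i < D) a i * 'C(n + i.+1, i.+1)%:Z.
have cE n : (M <= n)%N -> c n = c M.
  move=> /subnK <-; elim: (n - M)%N => [|k IHk] //; rewrite -IHk addSn.
  apply/eqP; rewrite -subr_eq0; apply/eqP; set p := (k + M)%N.
  have e := ha p.+1 (leqW (leq_addl _ _)).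
  have -> : c p.+1 - c p = (H p.+1 - H p) - (\sum_(i < D) a i * 'C(p.+1 + i.+1, i.+1)%:Z
      - \sum_(i < D) a i * 'C(p + i.+1, i.+1)%:Z) by rewrite /c; ring.
  rewrite -[H p]/(H p.+1.-1) e -sumrB; apply/eqP; rewrite subr_eq0; apply/eqP.
  by apply: eq_bigr => i _; rewrite -mulrBr dif_bin.
exists (fun i => if i is i'.+1 then a i' else c M), M => n /cE e.
rewrite big_ord_recl /= bin0 mulr1 -e /c -[LHS](subrK (\sum_(i < D) a i * 'C(n + i.+1, i.+1)%:Z)).
by [].
Qed.

Lemma bin_ev_poly D (a : nat -> int) : ev_poly D (fun n => \sum_(i < D) a i * 'C(n + i, i)%:Z).
Proof.
elim: D a => [|D IH] a /=; first by exists 0%N => n _; rewrite big_ord0.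
apply: ev_poly_ext ((ev_poly_shift _ _).2 (IH (fun i => a i.+1))); exists 0%N => n _ /=.
rewrite /dif !big_ord_recl !bin0 opprD addrACA subrr add0r -sumrB.
by apply: eq_bigr => i _; rewrite -mulrBr /= dif_bin.
Qed.

Lemma ev_polyS D D' H : (D <= D')%N -> ev_poly D H -> ev_poly D' H.
Proof.
have step E G : ev_poly E G -> ev_poly E.+1 G.
  elim: E G => [|E IH] G /=; last exact: IH.
  by move=> [N hN]; exists N => n hn; rewrite /dif !hN ?subrr // leqW.
by move=> /subnK <-; elim: (D' - D)%N => [//|k IH] /IH; apply: step.
Qed.

Lemma bin_le_pow n i : ('C(n + i, i) <= n.+1 ^ i)%N.
Proof.
elim: i => [|i IH]; first by rewrite bin0.
rewrite -(leq_pmul2l (ltn0Sn i)) addnS -mul_bin_diag /= expnS mulnA.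
by apply: leq_mul IH; nia.
Qed.

Lemma pow_le_bin n i : (n.+1 ^ i <= i`! * 'C(n + i, i))%N.
Proof.
elim: i => [|i IH]; first by rewrite bin0.
rewrite factS addnS -mulnA mulnCA -mul_bin_diag /= mulnCA expnS.
by apply: leq_mul IH; lia.
Qed.

(** A top coefficient in degree above [d] is an integer, so it vanishes or has absolute value at
    least 1; in the second case [H] outgrows the bound. *)
Lemma ev_poly_bound D d H (c : nat) : ev_poly D H ->
  (forall n, `|H n| <= (c * n.+1 ^ d)%N%:Z) -> ev_poly d.+1 H.
Proof.
move=> hH hb; have [Dd|dD] := leqP D d.+1; first exact: ev_polyS hH.
elim: D hH dD => [//|e IH] hH; rewrite ltnS => de.
suff he : ev_poly e H by move: de; rewrite leq_eqVlt => /orP[/eqP->|/IH]; last apply.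
have [a [N ha]] := ev_poly_bin hH.
have [ae0|ae0] := eqVneq (a e) 0.
  apply: ev_poly_ext (bin_ev_poly e a); exists N => n /ha ->.
  by rewrite big_ord_recr /= ae0 mul0r addr0.
(* The estimates give n + 1 <= e! c', which this choice of [n] violates. *)
exfalso; pose c' := (c + \sum_(i < e) `|a i|)%N; pose n := (N + e`! * c')%N.
have le1 : ('C(n + e, e) <= c' * n.+1 ^ e.-1)%N.
  rewrite -lez_nat; apply: le_trans (_ : `|a e * 'C(n + e, e)%:Z| <= _).
    rewrite normrM [X in _ * X]ger0_norm // ler_peMl //.
    by rewrite -[`|_|]abszE lez_nat absz_gt0.
  have -> : a e * 'C(n + e, e)%:Z = H n - \sum_(i < e) a i * 'C(n + i, i)%:Z.
    by rewrite ha ?leq_addr // big_ord_recr /=; ring.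
  apply: le_trans (ler_normB _ _) _; rewrite /c' mulnDl PoszD lerD //.
    apply: le_trans (hb n) _; rewrite lez_nat leq_mul2l leq_pexp2l ?orbT //.
    by rewrite -ltnS; case: (e) de.
  apply: le_trans (ler_norm_sum _ _ _) _.
  rewrite big_distrl /= (big_morph Posz PoszD (erefl _)); apply: ler_sum => i _.
  rewrite normrM PoszM -abszE ler_wpM2l //.
  rewrite ger0_norm // lez_nat; apply: leq_trans (bin_le_pow _ _) _.
  by rewrite leq_pexp2l //; case: (e) i => [[]|e'] //= i; rewrite -ltnS.
have := leq_trans (pow_le_bin n e) (leq_mul (leqnn e`!) le1).
have -> : e = e.-1.+1 by case: (e) de.
rewrite [e.-1.+1.-1]/= expnS mulnA leq_pmul2r ?expn_gt0 // prednK; last by case: (e) de.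
by rewrite leqNgt ltnS leq_addl.
Qed.

End FiniteDifferences.

(** * The Hilbert-Serre theorem *)

Section HilbertSerre.
Variable A : comNzRingType.
Implicit Types (U V : nat -> set A) (gs : seq A).

(** Stands for the graded module with components [U n / V n] on which each element of [gs] acts with
    degree 1; [gpC] is its noetherianity. Kernels and cokernels of multiplication remain
    subquotients of [A], so abstract graded modules are avoided. *)
Record graded_pair gs U V : Prop := GradedPair {
  gpU : forall n, is_ideal (U n);
  gpV : forall n, is_ideal (V n);
  gpS : forall n, V n `<=` U n;
  gpMU : forall n g a, g \in gs -> U n a -> U n.+1 (g * a);
  gpMV : forall n g a, g \in gs -> V n a -> V n.+1 (g * a);
  gpL : forall n, exists l, len (V n) (U n) l;
  gpC : forall W : nat -> nat -> set A, (forall k n, is_ideal (W k n)) ->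
    (forall k n, V n `<=` W k n /\ W k n `<=` U n) ->
    (forall k n g a, g \in gs -> W k n a -> W k n.+1 (g * a)) ->
    (forall k n, W k n `<=` W k.+1 n) ->
    exists k0, forall k, (k0 <= k)%N -> forall n, W k n = W k0 n }.

Definition mulset g (N : set A) : set A := [set a | exists2 b, N b & a = g * b].

Lemma mulset_ideal g N : is_ideal N -> is_ideal (mulset g N).
Proof.
move=> idN; split.
- by exists 0; [exact: idl0|rewrite mulr0].
- by move=> _ _ [a ha ->] [b hb ->]; exists (a + b); [exact: idlD|rewrite mulrDr].
- by move=> c _ [a ha ->]; exists (c * a); [exact: idlM|rewrite mulrCA].
Qed.

(** Multiplication by [g] identifies the two quotients, so chains are transported both ways. *)
Lemma len_mulset g (U V : set A) l : is_ideal U -> is_ideal V ->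
  len (U `&` colon V g) U l -> len V (sumi V (mulset g U)) l.
Proof.
move=> idU idV [c h]; have cE a : colon V g a <-> V (g * a) by rewrite /colon /= mulrC.
split.
  apply: (chain_map (f := fun N => sumi V (mulset g N))) c => [N idN VN NU|N N' idN idN' NN|].
  - split; [exact/sumi_ideal/mulset_ideal|by apply: sumi_l; apply: idl0; apply: mulset_ideal|].
    by move=> _ [v Vv [_ [b hb ->] ->]]; exists v => //; exists (g * b) => //; exists b => //; apply: NU.
  - by move=> _ [v Vv [_ [b hb ->] ->]]; exists v => //; exists (g * b) => //; exists b => //; apply: NN.
  move=> N N' idN idN' VN NN NU hN x hx.
  have [|v Vv [_ [b hb ->] e]] := hN (g * x).
    by exists 0; [exact: idl0|exists (g * x); [exists x|rewrite add0r]].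
  rewrite -[x](subrK b); apply: idlD => //; apply: VN; split.
    by apply: idlB => //; [apply: NU|apply/NU/NN].
  by apply/cE; rewrite mulrBr e addrK.
move=> n ch; apply: h.
apply: (chain_map (f := fun N => U `&` colon N g)) ch => [N idN VN NU|N N' idN idN' NN|].
- split; [exact/setI_ideal/colon_ideal| |by move=> a []].
  by move=> a [Ua /cE hV]; split=> //; rewrite /colon /= mulrC; apply: VN.
- by move=> a [Ua hN]; split=> //; apply: NN.
move=> N N' idN idN' VN NN NU hN x hx; have [v Vv [_ [b hb ->] e]] := NU x hx.
have [|_ hb'] := hN b.
  split=> //; rewrite /colon /= mulrC -[g * b](addKr v) -e addrC.
  by apply: idlB => //; apply/NN/VN.
by rewrite e; apply: idlD => //; [apply: VN|rewrite mulrC].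
Qed.

(* Multiplication by the first operator g gives 0 -> K_n -> M_n -> M_(n+1) -> C_(n+1) -> 0,
   and K, C are noetherian over the remaining operators. *)
Lemma hilbert_serre gs U V (H : nat -> nat) : graded_pair gs U V ->
  (forall n, len (V n) (U n) (H n)) -> ev_poly (size gs) (fun n => (H n)%:Z).
Proof.
elim: gs U V H => [|g gs IH] U V H gp hH.
  (* Without operators every choice of components is a submodule; the one equal to [U] below degree
     [k] can stabilize only if [U] and [V] agree in large degrees. *)
  have [||||k0 hk0] := gpC gp (W := fun k n => if (n < k)%N then U n else V n).
  - by move=> k n; case: ifP => _; [apply: (gpU gp)|apply: (gpV gp)].
  - by move=> k n; case: ifP => _; split=> //; apply: (gpS gp).
  - by [].
  - move=> k n; case: ifP => [nk|_]; first by rewrite ltnW.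
    by case: ifP => _ //; apply: (gpS gp).
  exists k0 => n kn; have := hk0 n.+1 (leqW kn) n; rewrite ltnSn ltnNge kn /= => e.
  have := hH n; rewrite e => -[/(len_le_refl) + _]; rewrite leqn0.
  by move=> /eqP ->.
have [idU idV sVU MU MV L C] := gp.
(* The kernel is [K n / V n] and the cokernel [U n / V' n]; nothing new is divided out in degree
   0. *)
pose K n := U n `&` colon (V n.+1) g.
have idK n : is_ideal (K n) by apply: setI_ideal => //; apply: colon_ideal.
have sVK n : V n `<=` K n.
  move=> a Va; split; first exact: sVU.
  by rewrite /colon /= mulrC; apply: MV; rewrite ?inE ?eqxx.
pose V' n := if n is n'.+1 then sumi (V n) (mulset g (U n')) else V 0%N.
have idV' n : is_ideal (V' n).
  by case: n => [|n] /=; [exact: idV|apply: sumi_ideal; [|apply: mulset_ideal]].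
have sVV' n : V n `<=` V' n.
  by case: n => [|n] //; apply: sumi_l; apply: idl0; apply: mulset_ideal.
have sV'U n : V' n `<=` U n.
  case: n => [|n] //=; apply: sumi_min => // _ [b hb ->].
  by apply: MU; rewrite ?inE ?eqxx.
have inS h : h \in gs -> h \in g :: gs by rewrite inE orbC => ->.
have gpK : graded_pair gs K V.
  split=> // [n h a hs [Ua ca]|n h a hs|n|W idW bW MW sW].
  - split; first by apply: MU => //; apply: inS.
    by rewrite /colon /= -mulrA; apply: MV => //; apply: inS.
  - by apply: MV; apply: inS.
  - have [l hl] := L n.
    have [a [b [ha _ _]]] := len_split (idV n) (idK n) (idU n) (sVK n) (fun _ => @proj1 _ _) hl.
    by exists a.
  (* On the kernel [g] maps into [V], hence into every submodule, so closure under [g] is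
     automatic. *)
  apply: C => // [k n|k n h a].
    by have [h1 h2] := bW k n; split=> // a /h2[].
  rewrite inE => /orP[/eqP->|hs]; last exact: MW.
  by move=> Wa; have [h1 h2] := bW k n; have [_ ca] := h2 a Wa; apply: (bW _ _).1; rewrite mulrC.
have gpV' : graded_pair gs U V'.
  split=> // [n h a hs|n h a hs|n|W idW bW MW sW].
  - by apply: MU; apply: inS.
  - case: n => [|n] /= => [Va|[v Vv [_ [b Ub ->] ->]]].
      by apply: (sVV' 1%N); apply: MV => //; apply: inS.
    rewrite mulrDr; exists (h * v); first by apply: MV => //; apply: inS.
    exists (h * (g * b)) => //; exists (h * b); last by rewrite mulrCA.
    by apply: MU => //; apply: inS.
  - have [l hl] := L n.
    have [a [b [_ hb _]]] := len_split (idV n) (idV' n) (idU n) (sVV' n) (sV'U n) hl.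
    by exists b.
  apply: C => // [k n|k n h a].
    by have [h1 h2] := bW k n; split=> //; apply: subset_trans h1.
  rewrite inE => /orP[/eqP->|hs]; last exact: MW.
  move=> Wa; apply: (bW _ _).1; apply: sumi_r; first exact: idl0.
  by exists a => //; apply: (bW k n).2.
have [HK hHK] := choice (gpL gpK); have [HC hHC] := choice (gpL gpV').
have dE n : dif (fun n => (H n)%:Z) n = (HC n.+1)%:Z - (HK n)%:Z.
  have [a [b [ha hb e]]] := len_split (idV n) (idK n) (idU n) (sVK n) (fun _ => @proj1 _ _) (hH n).
  have [a' [b' [ha' hb' e']]] :=
    len_split (idV n.+1) (idV' n.+1) (idU n.+1) (sVV' n.+1) (sV'U n.+1) (hH n.+1).
  have bE : a' = b by apply: len_uniq ha' _; apply: len_mulset.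
  have aE : a = HK n by apply: len_uniq ha _.
  have b'E : b' = HC n.+1 by apply: len_uniq hb' _.
  by rewrite /dif e e' bE aE b'E !PoszD; ring.
have pK := IH _ _ _ gpK hHK; have pC := IH _ _ _ gpV' hHC.
apply: ev_poly_ext (ev_polyB ((ev_poly_shift _ _).2 pC) pK).
by exists 0%N => n _; rewrite dE.
Qed.

End HilbertSerre.

Lemma krull_dim_uniq (R : comNzRingType) d d' : krull_dim R d -> krull_dim R d' -> d = d'.
Proof.
move=> [[P cP] h] [[P' cP'] h']; apply/eqP.
by rewrite eqn_leq (h' _ _ cP) (h _ _ cP').
Qed.

(** * The Hilbert polynomial of an m-primary ideal *)

Section HilbertPolynomial.
Variables (A : comNzRingType) (m : idealr A) (d : nat).
Hypotheses (noethA : noetherian A) (localA : local_ring m) (dimA : krull_dim A d)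
  (cmA : cohen_macaulay m).
Let nA : noeth A := (noetherianP A).1 noethA.

Lemma parameters : exists xs, regular_seq m xs /\ size xs = d.
Proof.
have [d' dimA' [[xs rxs sxs] _]] := cmA; exists xs; split=> //.
by rewrite sxs; apply: krull_dim_uniq dimA' dimA.
Qed.

Section OneIdeal.
Variable K : {pred A}.
Hypotheses (idK : is_ideal [set a | a \in K]) (K1 : 1 \notin K)
  (radK : forall a, a \in m -> exists n, a ^+ n \in K).

Lemma pw_rad n a : a \in m -> exists k, pw K n (a ^+ k).
Proof. by move=> /radK[k hk]; exists (k * n)%N; rewrite exprM; apply: pwX. Qed.

Lemma pw_len n : exists l, len (pw K n) setT l.
Proof.
have [b hb] := finite_len noethA localA (pw_is K n) (@pw_rad n).
by have [l hl _] := len_ex (pw_is K n) (fun _ _ => I) hb; exists l.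
Qed.

(** If all [x ^+ N] lie in [K], for [x] in a regular sequence of length [d], then [K^(n+1)] contains
    the powers of exponent [N * n.+1], and their ideal has colength of order [d] in [n]. *)
Lemma pw_len_bound : exists c, forall n, len_le (pw K n.+1) setT (c * n.+1 ^ d).
Proof.
have [xs [rxs sxs]] := parameters.
have [b hb] : exists b, len_le (seq_ideal xs) setT b.
  apply: (finite_len noethA localA (seq_ideal_is xs)) => a.
  by apply: (regular_radical noethA localA rxs); rewrite sxs.
have [N hN] : exists N, forall x, x \in xs -> x ^+ N \in K.
  have [xm _ _] := rxs; elim: (xs) xm => [|x s IH] xm; first by exists 0%N.
  have [|N hN] := IH; first by move=> y ys; apply: xm; rewrite inE ys orbT.
  have [|k hk] := radK (a := x); first by apply: xm; rewrite inE eqxx.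
  exists (N + k)%N => y; rewrite inE exprD => /orP[/eqP->|/hN h]; first exact: idlM idK _ _ hk.
  exact: (idlMr idK).
exists (N ^ d * b)%N => n.
have := len_le_addis_pow (n := (N * n.+1)%N) (set0_ideal A) hb.
rewrite sxs expnMn mulnAC; apply: len_le_mono => //.
apply: addis_min; [exact: pw_is|by move=> _ ->; apply: idl0; apply: pw_is|].
by move=> _ /mapP[x /hN hx ->]; rewrite exprM; apply: pwX.
Qed.

Lemma hilbert_poly : exists e, hilbert_coeffs d K e.
Proof.
have [J hJ] := idealr_of idK (fun h : K 1 => negP K1 h).
have JK : J =i K by move=> a; apply/idP/idP => /hJ.
have [gs gsE] := idealr_fg J nA.
have gsJ g : g \in gs -> g \in K.
  move=> gg; rewrite -JK; suff : [set a | a \in J] g by [].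
  by rewrite gsE; apply: addis_gen => //; apply: set0_ideal.
have gsK : [set a | a \in K] = seq_ideal gs.
  by rewrite -gsE; apply/seteqP; split=> a; rewrite /= JK.
have [G hG] := choice pw_len.
have gp : graded_pair gs (pw K) (fun n => pw K n.+1).
  split=> [n|n|n|n g a hg|n g a hg|n|W idW bW MW sW]; rewrite ?[pw K]/pw.
  - exact: pw_is.
  - exact: pw_is.
  - exact: pw_le.
  - by apply: pwS; apply: gsJ.
  - by apply: pwS; apply: gsJ.
  - have [a [b [ha _ _]]] := len_split (pw_is K n.+1) (pw_is K n) (@setT_ideal A)
      (pw_le (leqnSn n)) (fun _ _ => I) (hG n.+1).
    by exists a.
  apply: (rees_acc (I := J)) => // [k n|k n a b ha hb].
    by rewrite (pw_eq n JK); have [] := bW k n.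
  suff H : [set a | a \in K] `<=` [set a | W k n.+1 (a * b)] by apply: H; rewrite /= -JK.
  rewrite gsK; apply: addis_min => [|_ ->|g hg].
  - split=> [|u v hu hv|u v hv] /=.
    + by rewrite mul0r; apply: idl0.
    + by rewrite mulrDl; apply: idlD.
    + by rewrite -mulrA; apply: idlM.
  - by rewrite /= mul0r; apply: idl0.
  - exact: MW.
have [H hH] := choice (gpL gp); have pH := hilbert_serre gp hH.
have pG : ev_poly (size gs).+1 (fun n => (G n.+1)%:Z).
  apply: ev_poly_ext ((ev_poly_shift _ _).2 pH); exists 0%N => n _.
  have e := len_add (pw_is K n.+2) (pw_is K n.+1) (pw_le (leqnSn _)) (fun _ _ => I)
    (@setT_ideal A) (hH n.+1) (hG n.+1).
  by rewrite /dif (len_uniq (hG n.+2) e) PoszD addrK.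
have [c hc] := pw_len_bound.
have [|a [N ha]] := ev_poly_bin (ev_poly_bound (c := c) (d := d) pG _).
  by move=> n; rewrite ger0_norm // lez_nat; apply: (hc n); apply: (hG n.+1).1.
(* Hilbert coefficients are numbered from the top degree downwards and carry alternating signs. *)
exists (fun i => (-1) ^+ i * a (d - i)%N), N => n Nn; exists (G n.+1).
  exact/has_lengthP/hG.
rewrite ha // (reindex_inj rev_ord_inj) /=; apply: eq_bigr => i _.
rewrite subSS mulrA -expr2 sqrr_sign mul1r addnBA //.
by rewrite -ltnS.
Qed.
End OneIdeal.

Lemma regular_elt : (0 < d)%N -> exists2 x, x \in m & forall a, x * a = 0 -> a = 0.
Proof.
move=> d0; have [xs [rxs sxs]] := parameters; have [xm _ _] := rxs.
exists xs`_0; first by apply: xm; rewrite mem_nth ?sxs.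
by move=> a; apply: (regular_head rxs); rewrite sxs.
Qed.

End HilbertPolynomial.

(** * Powers of the Ratliff-Rush closure *)

Section RatliffRushPowers.
Variables (A : comNzRingType) (K : ideal A).
Hypothesis nA : noeth A.
Let idK : is_ideal [set a | a \in K] := ideal_is K.

Lemma ratliff_rushP a : (a \in ratliff_rush K) <->
  exists2 n, (1 <= n)%N & forall b, pw K n b -> pw K n.+1 (a * b).
Proof. by split=> [/asboolP|h]; [|apply/asboolP]. Qed.

Section Reduction.
Variable J : {pred A}.
Hypotheses (idJ : is_ideal [set a | a \in J]) (KJ : {subset K <= J}).

(* K J^n *)
Definition kprod n : set A := [set a | forall W : set A, is_ideal W ->
  (forall c b, c \in K -> pw J n b -> W (c * b)) -> W a].

Lemma kprod_is n : is_ideal (kprod n).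
Proof.
split=> [W idW _|a b ha hb W idW hW|a b hb W idW hW]; first exact: idl0.
- by apply: idlD => //; [apply: ha|apply: hb].
- by apply: idlM => //; apply: hb.
Qed.

Lemma kprod_gen n c b : c \in K -> pw J n b -> kprod n (c * b).
Proof. by move=> hc hb W idW; apply. Qed.

Lemma kprodM n i a b : pw J i a -> kprod n b -> kprod (i + n) (a * b).
Proof.
move=> ha hb; have idc : is_ideal (colon (kprod (i + n)) a) := colon_ideal a (kprod_is _).
rewrite mulrC; apply: hb idc _ => c b' hc hb'; rewrite /colon /= -mulrA.
by apply: kprod_gen => //; rewrite mulrC; apply: pwM.
Qed.

Lemma pw_prod_seq (w : seq A) : {subset w <= J} -> pw J (size w) (\prod_(a <- w) a).
Proof.
elim: w => [|a w IH] h; first by rewrite big_nil pw0.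
rewrite big_cons; apply: pwS; first by apply: h; rewrite inE eqxx.
by apply: IH => b bw; apply: h; rewrite inE bw orbT.
Qed.

(** Every term of the expanded product other than the pure power of [a] has a factor in [K]. *)
Lemma prod_sub_kprod a (c : seq A) : a \in J -> {subset c <= K} -> c != [::] ->
  kprod (size c).-1 (\prod_(b <- c) (a - b) - a ^+ size c).
Proof.
move=> aJ; elim: c => // b c IH hc _.
have bK : b \in K by apply: hc; rewrite inE eqxx.
have cK : {subset c <= K} by move=> u uc; apply: hc; rewrite inE uc orbT.
rewrite big_cons /= exprS.
have -> : (a - b) * \prod_(j <- c) (a - j) - a * a ^+ size c =
  a * (\prod_(j <- c) (a - j) - a ^+ size c) - b * \prod_(j <- c) (a - j) by ring.
apply: (idlB (kprod_is _)).
  case: c cK IH {hc} => [|b' c] cK IH.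
    by rewrite big_nil subrr mulr0; apply: idl0; apply: kprod_is.
  have := kprodM (pw1_gen aJ) (IH cK isT).
  by rewrite add1n.
apply: kprod_gen => //; rewrite -(size_map (fun j => a - j)) -(big_map (fun j => a - j) predT id).
apply: pw_prod_seq => _ /mapP[j jc ->].
by apply: (idlB idJ aJ); apply: KJ; apply: cK.
Qed.

(** A permutation other than the identity meets an off-diagonal entry, which lies in [K]; the other
    [n] entries lie in [J]. *)
Lemma det_sub_kprod n (C : 'M[A]_n.+1) a : a \in J -> (forall i j, C i j \in K) ->
  kprod n (\det (a%:M - C) - a ^+ n.+1).
Proof.
move=> aJ CK; rewrite /determinant (bigD1 (1%g : 'S_n.+1)) //= odd_perm1 mul1r addrAC.
apply: (idlD (kprod_is _)).
  have := @prod_sub_kprod a [seq C i i | i <- enum 'I_n.+1] aJ.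
  rewrite size_map size_enum_ord big_map big_enum /=.
  rewrite (eq_bigr (fun i => (a%:M - C) i ((1%g : 'S_n.+1) i))); last first.
    by move=> i _; rewrite perm1 !mxE eqxx.
  apply; first by move=> _ /mapP[i _ ->].
  by rewrite -size_eq0 size_map size_enum_ord.
apply: (idl_sum (kprod_is _)).
move=> s s1; apply: (idlM (kprod_is _)).
have [i si] : exists i, s i != i.
  apply/existsP; apply: contraNT s1 => /existsPn h; apply/eqP/permP => i.
  by rewrite perm1; apply/eqP; have := h i; rewrite negbK.
rewrite (bigD1 i) //=; apply: kprod_gen.
  by rewrite !mxE eq_sym (negPf si) mulr0n sub0r; exact: (idlN idK (CK _ _)).
rewrite -big_filter -(big_map (fun j => (a%:M - C) j (s j)) predT id).
have szE : size [seq (a%:M - C) j (s j) | j <- [seq j <- index_enum 'I_n.+1 | j != i]] = n.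
  rewrite size_map size_filter -sum1_count.
  by have := sum1_card (predC1 i); rewrite cardC1 card_ord.
rewrite -[X in pw J X]szE.
apply: pw_prod_seq => _ /mapP[j _ ->]; rewrite !mxE.
apply: (idlB idJ); last exact/KJ/CK.
by rewrite mulrb; case: ifP => // _; apply: (idl0 idJ).
Qed.

End Reduction.

(** On generators of [K^n], multiplication by [a] has a matrix with entries in [K]; the determinant
    kills [K^n], hence [x], and so is 0. *)
Lemma det_trick n a x : (forall b, x * b = 0 -> b = 0) -> pw K n x ->
  (forall b, pw K n b -> pw K n.+1 (a * b)) ->
  exists k (C : 'M[A]_k.+1), (forall i j, C i j \in K) /\ \det (a%:M - C) = 0.
Proof.
move=> regx Kx h; have [gs gsE] := noeth_fg nA (pw_is K n).
(* The added generator 0 makes the matrix size a successor. *)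
pose g (i : 'I_(size gs).+1) := (0 :: gs)`_i.
have gK i : pw K n (g i).
  rewrite /g; case: i => [[|i] /= hi]; first by apply: idl0; apply: pw_is.
  by rewrite gsE; apply: addis_gen; [exact: set0_ideal|apply: mem_nth].
pose W : set A := [set b | exists2 c : 'I_(size gs).+1 -> A, (forall i, c i \in K) &
  b = \sum_i c i * g i].
have idW : is_ideal W.
  split=> [|_ _ [c hc ->] [c' hc' ->]|b _ [c hc ->]].
  - by exists (fun=> 0) => [i|]; [apply: (idl0 idK)|rewrite big1 // => i _; rewrite mul0r].
  - exists (fun i => c i + c' i) => [i|]; first exact: (idlD idK (hc i) (hc' i)).
    by rewrite -big_split; apply: eq_bigr => i _; rewrite mulrDl.
  - exists (fun i => b * c i) => [i|]; first exact: (idlM idK _ (hc i)).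
    by rewrite big_distrr /=; apply: eq_bigr => i _; rewrite mulrA.
have KW : pw K n.+1 `<=` W.
  apply: pwS_min => // b v hb; rewrite gsE => /seq_idealE[c ->].
  exists (fun i => b * (if unlift ord0 i is Some j then c j else 0)) => [i|].
    exact: (idlMr idK).
  rewrite big_ord_recl {1}/g /= mulr0 add0r big_distrr /=; apply: eq_bigr => i _.
  by rewrite liftK /g /= mulrA.
have /choice[C hC] : forall i, exists c : 'I_(size gs).+1 -> A,
    (forall j, c j \in K) /\ a * g i = \sum_j c j * g j.
  by move=> i; have [c hc e] := KW _ (h _ (gK i)); exists c.
pose M : 'M[A]_((size gs).+1) := a%:M - \matrix_(i, j) C i j.
exists (size gs), (\matrix_(i, j) C i j); split=> [i j|].
  by rewrite mxE; case: (hC i).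
have M0 : M *m (\col_i g i) = 0.
  apply/matrixP => i j; rewrite !mxE.
  under eq_bigr do rewrite !mxE mulrBl.
  rewrite sumrB -(hC i).2 (bigD1 i) //= eqxx mulr1n big1 ?addr0 ?subrr // => k ki.
  by rewrite eq_sym (negPf ki) mulr0n mul0r.
have detg i : \det M * g i = 0.
  have : (\adj M *m M *m (\col_i g i)) i ord0 = 0 by rewrite -mulmxA M0 mulmx0 mxE.
  by rewrite mul_adj_mx mul_scalar_mx !mxE.
apply: regx; rewrite mulrC.
suff : pw K n `<=` [set b | \det M * b = 0] by apply.
rewrite gsE; apply: addis_min => [|_ ->|u us].
- split=> [|b c hb hc|b c hc] /=; first by rewrite mulr0.
  + by rewrite mulrDr hb hc addr0.
  + by rewrite mulrCA hc mulr0.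
- by rewrite /= mulr0.
rewrite /= -(nth_index 0 us); have iu : (index u gs < size gs)%N by rewrite index_mem.
by have := detg (lift ord0 (Ordinal iu)).
Qed.

Lemma pw_gen_min (J : {pred A}) (S W : set A) N : is_ideal W ->
  (forall V, is_ideal V -> S `<=` V -> [set a | a \in J] `<=` V) ->
  (forall w : seq A, size w = N -> (forall a, a \in w -> S a) -> W (\prod_(a <- w) a)) ->
  pw J N `<=` W.
Proof.
move=> idW JS; elim: N W idW => [|N IH] W idW h.
  have := h [::] erefl; rewrite big_nil => W1 a _; rewrite -[a]mulr1.
  by apply: idlM => //; apply: W1.
apply: pwS_min => // a b ha; move: b; pose V : set A := [set a | forall b, pw J N b -> W (a * b)].
suff : V a by [].
apply: JS ha => [|c Sc].
  split=> [b _|u v hu hv b hb|u v hv b hb]; first by rewrite mul0r; apply: idl0.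
    by rewrite mulrDl; apply: idlD => //; [apply: hu|apply: hv].
  by rewrite -mulrA; apply: idlM => //; apply: hv.
move=> b hb; rewrite mulrC; suff : colon W c b by [].
apply: IH hb => [|w sw hw]; first exact: colon_ideal.
rewrite /colon /= mulrC.
have -> : c * \prod_(b <- w) b = \prod_(b <- c :: w) b by rewrite big_cons.
apply: h; first by rewrite /= sw.
by move=> u; rewrite inE => /orP[/eqP->//|/hw].
Qed.

Section Faithful.
Variable x : A.
Hypotheses (Kx : x \in K) (regx : forall b, x * b = 0 -> b = 0).

Lemma reg_pow n b : x ^+ n * b = 0 -> b = 0.
Proof. by elim: n => [|n IH]; rewrite ?mul1r // exprS -mulrA => /regx. Qed.


(** The vanishing determinant of [det_trick], expanded modulo [kprod J k], is an equation of
    integral dependence over [K]. *)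
Lemma ratliff_rush_integral (J : {pred A}) a : is_ideal [set a | a \in J] ->
  {subset K <= J} -> a \in J -> a \in ratliff_rush K -> exists k, kprod J k (a ^+ k.+1).
Proof.
move=> idJ KJ aJ /ratliff_rushP[n _ h].
have [k [C [CK d0]]] := det_trick (@reg_pow n) (pwX n Kx) h.
exists k; have := det_sub_kprod idJ KJ aJ CK; rewrite d0 sub0r.
by move/(idlN (kprod_is J k)); rewrite opprK.
Qed.

(** With the whole ring as [J] and 1 as the element, integral dependence puts 1 in [K]. *)
Lemma ratliff_rush_proper : 1 \notin K -> 1 \notin ratliff_rush K.
Proof.
move=> K1; apply/negP => h; case/negP: K1.
have idT : is_ideal [set a | a \in (predT : {pred A})] by [].
have [k] := ratliff_rush_integral idT (fun _ _ => isT) isT h.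
by rewrite expr1n => /(_ _ idK); apply=> c b cK _; apply: (idlMr idK).
Qed.

Lemma sub_ratliff_rush : {subset K <= ratliff_rush K}.
Proof. by move=> a aK; apply/ratliff_rushP; exists 1%N => // b; apply: pwS. Qed.

Let J : {pred A} := ratliff_rush K.
Let idJ : is_ideal [set a | a \in J] := ideal_is (ratliff_rush K).

(** By pigeonhole a long word in the generators of [J] repeats some generator [g] more than [v g]
    times, and [g ^+ (v g).+1] can be traded for an element of [kprod J (v g)]. *)
Lemma ratliff_rush_reduction : exists M0, forall M, (M0 <= M)%N -> pw J M.+1 `<=` kprod J M.
Proof.
have [gs gsE] := noeth_fg nA idJ.
have gsJ g : g \in gs -> g \in J.
  move=> gg; suff : [set a | a \in J] g by [].
  by rewrite gsE; apply: addis_gen => //; apply: set0_ideal.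
have /choice[v hv] : forall g, exists k, g \in gs -> kprod J k (g ^+ k.+1).
  move=> g; have [gg|] := boolP (g \in gs); last by exists 0%N.
  have [k hk] := ratliff_rush_integral idJ sub_ratliff_rush (gsJ _ gg) (gsJ _ gg).
  by exists k.
exists (\sum_(g <- undup gs) (v g).+1)%N => M hM.
apply: (pw_gen_min (S := [set a | a \in gs])) => [|V idV SV|w sw hw].
- exact: kprod_is.
- rewrite gsE; apply: addis_min => // _ ->; exact: idl0.
have [g gg hc] : exists2 g, g \in gs & (v g < count_mem g w)%N.
  apply: contrapT => hn.
  suff : (size w <= \sum_(g <- undup gs) (v g).+1)%N by rewrite sw leqNgt ltnS hM.
  apply: (@leq_trans (\sum_(g <- undup gs) count_mem g w)%N).
    have -> : size w = (\sum_(a <- w) \sum_(g <- undup gs) (a == g))%N.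
      rewrite -sum1_size; apply: eq_big_seq => a aw.
      rewrite (bigD1_seq a) ?undup_uniq ?mem_undup ?(hw a aw) //= eqxx big1 //.
      by move=> g /negPf; rewrite eq_sym => ->.
    rewrite exchange_big /=; apply: leq_sum => g _.
    by rewrite -sum1_count [X in (_ <= X)%N]big_mkcond; apply: eq_leq; apply: eq_bigr => i _ /=; case: (i == g).
  rewrite big_seq [X in (_ <= X)%N]big_seq; apply: leq_sum => g; rewrite mem_undup => gg.
  by rewrite leqNgt; apply/negP => hlt; apply: hn; exists g => //; apply: ltnW.
have -> : \prod_(a <- w) a = (\prod_(i <- [seq i <- w | i != g]) i) *
    (\prod_(i <- [seq i <- w | i == g]) i).
  by rewrite !big_filter mulrC (bigID (pred1 g)).
have -> : \prod_(i <- [seq i <- w | i == g]) i = g ^+ (v g).+1 * g ^+ (count_mem g w - (v g).+1).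
  rewrite -exprD subnKC // -size_filter.
  have : all (pred1 g) [seq i <- w | i == g] by apply: filter_all.
  by move/all_pred1P ->; rewrite big_nseq size_nseq -Monoid.iteropE.
rewrite [g ^+ _ * _]mulrC.
have e1 : kprod J (count_mem g w - (v g).+1 + v g) (g ^+ (count_mem g w - (v g).+1) * g ^+ (v g).+1).
  by apply: kprodM; [apply/pwX/gsJ|apply: hv].
have e2 : pw J (size [seq i <- w | i != g]) (\prod_(i <- [seq i <- w | i != g]) i).
  by apply: pw_prod_seq => u; rewrite mem_filter => /andP[_ /hw /gsJ].
have := kprodM e2 e1; congr (kprod J _ _).
have e3 : (count_mem g w + size [seq i <- w | i != g] = M.+1)%N.
  by rewrite size_filter -sw -(count_predC (pred1 g) w).
by move: e3 hc; lia.
Qed.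

(** The exponent in [ratliff_rush_pred] depends on the element; finitely many generators of [J]
    share one. *)
Lemma ratliff_rush_absorb : exists m0, forall k, (m0 <= k)%N ->
  forall a b, a \in J -> pw K k b -> pw K k.+1 (a * b).
Proof.
have [gs gsE] := noeth_fg nA idJ.
have idL k : is_ideal [set a | forall b, pw K k b -> pw K k.+1 (a * b)].
  have idp := pw_is K k.+1.
  split=> [b _|u v hu hv b hb|u v hv b hb]; first by rewrite mul0r; apply: idl0.
    by rewrite mulrDl; apply: idlD => //; [apply: hu|apply: hv].
  by rewrite -mulrA; apply: idlM => //; apply: hv.
suff [m0 hm] : exists m0, forall k, (m0 <= k)%N -> seq_ideal gs `<=`
    [set a | forall b, pw K k b -> pw K k.+1 (a * b)].
  by exists m0 => k hk a b aJ; apply: (hm k hk); rewrite -gsE.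
have : seq_ideal gs `<=` [set a | a \in J] by rewrite -gsE.
elim: (gs) => [|g s IH] sJ.
  by exists 0%N => k _ _ ->; exact: (idl0 (idL k)).
have [|m0 hm] := IH; first by apply: subset_trans sJ; apply: addi_sub.
have /ratliff_rushP[n _ hn] : g \in ratliff_rush K.
  by apply: sJ; apply: addi_gen; apply: idl0; apply: seq_ideal_is.
exists (maxn m0 n) => k; rewrite geq_max => /andP[h1 h2].
apply: addi_min; [exact: idL|exact: hm|].
by move=> b; apply: (ratliff_rushS hn).
Qed.

(** The reduction gives J^n = K^(n-M0) J^M0, and [m0] of the factors [K] absorb J^M0 into
    K^(m0+M0). *)
Lemma ratliff_rush_pow : exists N, forall n, (N <= n)%N -> pw J n = pw K n.
Proof.
have [M0 hM] := ratliff_rush_reduction; have [m0 hm] := ratliff_rush_absorb.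
have absM k b c : pw J k b -> pw K m0 c -> pw K (m0 + k) (b * c).
  elim: k b => [|k IH] b hb hc; first by rewrite addn0; apply: idlM => //; apply: pw_is.
  suff H : pw J k.+1 `<=` [set b | pw K (m0 + k.+1) (b * c)] by apply: H.
  apply: pwS_min => [|u v uJ hv]; first exact: colon_ideal (pw_is _ _).
  rewrite /= -mulrA addnS; apply: hm => //; first exact: leq_addr.
  exact: IH.
have step j : forall W, is_ideal W -> (forall c b, pw K j c -> pw J M0 b -> W (c * b)) ->
    pw J (j + M0) `<=` W.
  elim: j => [|j IH] W idW h.
    by move=> a ha; rewrite -[a]mul1r; apply: h => //; rewrite pw0.
  rewrite addSn => a /(hM _ (leq_addl _ _)); apply=> // c b cK.
  rewrite mulrC; suff H : pw J (j + M0) `<=` colon W c by apply: H.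
  apply: IH; first exact: colon_ideal.
  by move=> c' b' hc' hb'; rewrite /colon /= mulrC mulrA; apply: h => //; apply: pwS.
exists (m0 + M0)%N => n hn; apply/seteqP; split; last exact: pw_mono sub_ratliff_rush.
have -> : n = (n - M0 + M0)%N by lia.
apply: step; first exact: pw_is.
move=> c b; have {1 2}-> : (n - M0 = n - M0 - m0 + m0)%N by lia.
move=> hc hb; move: hc; rewrite -addnA.
suff H : pw K (n - M0 - m0 + m0) `<=` colon (pw K (n - M0 - m0 + (m0 + M0))) b by apply: H.
apply: pw_add_min => [|u v hu hv]; first exact: colon_ideal (pw_is _ _).
by rewrite /colon /= -mulrA; apply: pwM => //; rewrite mulrC; apply: absM.
Qed.

End Faithful.
End RatliffRushPowers.

(** * The associated graded ring *)

Section GradedRing.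
Variables (A : comNzRingType) (I : idealr A).
Implicit Types (a b : A) (p q : rees I) (f g h : gr I).
#[local] Hint Resolve rees_coef : core.

Lemma gr_pi_eq p q : gr_pi p = gr_pi q <-> forall n, pw I n.+1 ((rees_val p)`_n - (rees_val q)`_n).
Proof.
rewrite /gr_pi; split=> [/eqP|h].
  by rewrite -Quotient.idealrBE => /asboolP h n; have := h n; rewrite coefB.
apply/eqP; rewrite -Quotient.idealrBE; apply/asboolP => n.
by have := h n; rewrite -coefB.
Qed.

(* The class of a in I^n / I^(n+1); junk unless a lies in I^n. *)
Definition ini n a : gr I := gr_pi (to_rees I (a *: 'X^n)).

Lemma ini_val n a : pw I n a -> rees_val (to_rees I (a *: 'X^n)) = a *: 'X^n.
Proof. by move=> ha; rewrite to_reesK //; apply: pw_mono_coef. Qed.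

Lemma coef_mono a n k : (a *: 'X^n : {poly A})`_k = if k == n then a else 0.
Proof. by rewrite coefZ coefXn; case: eqP; rewrite ?mulr1 ?mulr0. Qed.

Lemma iniD n a b : pw I n a -> pw I n b -> ini n (a + b) = ini n a + ini n b.
Proof.
move=> ha hb; rewrite /ini -raddfD; congr gr_pi; apply: val_inj => /=.
by rewrite ?rees_valD !ini_val ?scalerDl //; apply: idlD => //; apply: pw_is.
Qed.

Lemma iniM n k a b : pw I n a -> pw I k b -> ini (n + k) (a * b) = ini n a * ini k b.
Proof.
move=> ha hb; rewrite /ini -rmorphM; congr gr_pi; apply: val_inj => /=.
by rewrite ?rees_valM !ini_val ?exprD -?scalerAl -?scalerAr ?scalerA //; apply: pwM.
Qed.

Lemma ini0 n a : pw I n a -> ini n a = 0 <-> pw I n.+1 a.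
Proof.
move=> ha; rewrite /ini -(raddf0 (@gr_pi A I)); split=> [/gr_pi_eq /(_ n)|h].
  by rewrite ini_val // coef_mono eqxx coef0 subr0.
apply/gr_pi_eq => k; rewrite ini_val // coef_mono coef0 subr0.
by case: eqP => [->//|_]; apply: idl0; apply: pw_is.
Qed.

Lemma iniN n a : pw I n a -> ini n (- a) = - ini n a.
Proof.
move=> ha; have hN : pw I n (- a) by apply: idlN => //; apply: pw_is.
apply/eqP; rewrite -addr_eq0 -iniD // addNr; apply/eqP/ini0; apply: idl0; apply: pw_is.
Qed.

Lemma ini_sum (T : Type) (r : seq T) (F : T -> A) n : (forall i, pw I n (F i)) ->
  ini n (\sum_(i <- r) F i) = \sum_(i <- r) ini n (F i).
Proof.
move=> hF; elim: r => [|i r IH]; rewrite ?big_nil ?big_cons.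
  by apply/ini0; apply: idl0; apply: pw_is.
by rewrite iniD ?IH //; apply: idl_sum => //; apply: pw_is.
Qed.

Lemma ini_constE a : gr_const I a = ini 0 a.
Proof.
by rewrite /gr_const /ini; congr gr_pi; apply: val_inj; rewrite /= ini_val ?pw0 // expr0 alg_polyC.
Qed.

Lemma ini1 : ini 0 1 = 1.
Proof.
rewrite -ini_constE /gr_const -(rmorph1 (@gr_pi A I)); congr gr_pi.
by apply: val_inj.
Qed.

Fact gr_const_zmod : zmod_morphism (gr_const I).
Proof.
move=> a b; rewrite !ini_constE iniD ?iniN ?pw0 //.
Qed.
Fact gr_const_monoid : monoid_morphism (gr_const I).
Proof.
split=> [|a b]; first by rewrite ini_constE ini1.
by rewrite !ini_constE -[0%N]addn0 iniM ?pw0.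
Qed.
HB.instance Definition _ := GRing.isZmodMorphism.Build A (gr I) (gr_const I) gr_const_zmod.
HB.instance Definition _ := GRing.isMonoidMorphism.Build A (gr I) (gr_const I) gr_const_monoid.

Lemma gr_const0 a : a \in I -> gr_const I a = 0.
Proof.
move=> aI; rewrite ini_constE; apply/ini0; first by rewrite pw0.
exact: pw1_gen.
Qed.

(* The component of degree n; independent of the representative by gpr_pi. *)
Definition gpr n g : gr I := ini n (rees_val (repr g))`_n.

Lemma gpr_pi n p : gpr n (gr_pi p) = ini n (rees_val p)`_n.
Proof.
have /gr_pi_eq h : gr_pi (repr (gr_pi p)) = gr_pi p by rewrite /gr_pi reprK.
apply/eqP; rewrite /gpr -subr_eq0 -iniN // -iniD //; last first.
  by apply: idlN; [apply: pw_is|apply: rees_coef].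
apply/eqP/ini0; first by apply: idlB; [apply: pw_is|apply: rees_coef|apply: rees_coef].
exact: h.
Qed.

Lemma gprD n : {morph gpr n : f g / f + g}.
Proof.
move=> f g; have [p ->] := gr_pi_surj f; have [q ->] := gr_pi_surj g.
by rewrite -raddfD !gpr_pi rees_valD coefD iniD //; apply: rees_coef.
Qed.

Lemma gpr0 n : gpr n 0 = 0.
Proof. by have := gprD n 0 0; rewrite addr0 -{1}[gpr n 0]addr0 => /addrI. Qed.

Lemma gprN n g : gpr n (- g) = - gpr n g.
Proof. by apply/eqP; rewrite -addr_eq0 -gprD addNr gpr0. Qed.

Lemma gprB n f g : gpr n (f - g) = gpr n f - gpr n g.
Proof. by rewrite gprD gprN. Qed.

Lemma gpr_sum (T : Type) (r : seq T) (P : pred T) (F : T -> gr I) n :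
  gpr n (\sum_(i <- r | P i) F i) = \sum_(i <- r | P i) gpr n (F i).
Proof. exact: (big_morph (gpr n) (gprD n) (gpr0 n)). Qed.

Lemma gpr_ex n g : exists2 a, pw I n a & gpr n g = ini n a.
Proof. by exists (rees_val (repr g))`_n => //; apply: rees_coef. Qed.

Lemma gpr_ini n k a : pw I k a -> gpr n (ini k a) = if n == k then ini k a else 0.
Proof.
move=> ha; rewrite gpr_pi ini_val // coef_mono; case: eqP => [->//|_].
by apply/ini0; apply: idl0; apply: pw_is.
Qed.

Lemma gr_decomp g : exists N, forall N', (N <= N')%N -> g = \sum_(n < N') gpr n g.
Proof.
have [p ->] := gr_pi_surj g; exists (size (rees_val p)) => N' hN.
under eq_bigr do rewrite gpr_pi.
rewrite /ini -raddf_sum; congr gr_pi; apply: val_inj => /=.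
rewrite (big_morph (@rees_val A I) (id1 := 0) (op1 := +%R)) //.
apply/polyP => k; rewrite coef_sum.
under eq_bigr => i _ do rewrite ini_val // coef_mono.
have [kN|kN] := ltnP k N'.
  by rewrite (bigD1 (Ordinal kN)) //= eqxx big1 ?addr0 // => i; rewrite -val_eqE eq_sym => /negPf /= ->.
rewrite nth_default ?big1 //; last exact: leq_trans kN.
by move=> i _; case: eqP => // e; move: kN; rewrite e leqNgt ltn_ord.
Qed.

Lemma gprM n k a g : pw I k a ->
  gpr n (ini k a * g) = if (k <= n)%N then ini k a * gpr (n - k) g else 0.
Proof.
move=> ha; have [p ->] := gr_pi_surj g.
rewrite {1}/ini -rmorphM !gpr_pi rees_valM ini_val // -scalerAl coefZ.
rewrite coefXnM; case: ltnP => kn.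
  by rewrite mulr0; apply/ini0; apply: idl0; apply: pw_is.
by rewrite -[n in ini n _](subnKC kn) iniM.
Qed.

Lemma gprMn n f g : gpr n (f * g) = \sum_(i < n.+1) gpr i f * gpr (n - i) g.
Proof.
have [p ->] := gr_pi_surj f; have [q ->] := gr_pi_surj g.
rewrite -rmorphM gpr_pi rees_valM coefM ini_sum => [|i].
  apply: eq_bigr => i _; rewrite !gpr_pi -iniM //.
  by rewrite (subnKC (ltn_ord i : (i <= n)%N)).
rewrite -[n in pw _ n](subnKC (ltn_ord i : (i <= n)%N)).
by apply: pwM; apply: rees_coef.
Qed.

Lemma gr_pieceP (n : nat) g : g \in gr_piece I n%:Z <-> g = gpr n g.
Proof.
split=> [/asboolP[p hp ->]|->].
  rewrite gpr_pi /ini; congr gr_pi; apply: val_inj; rewrite /= ini_val //.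
  apply/polyP => k; rewrite coef_mono; case: eqP => [->//|/eqP kn].
  by rewrite hp ?eqz_nat.
apply/asboolP; exists (to_rees I ((rees_val (repr g))`_n *: 'X^n)) => // k.
by rewrite ini_val // coef_mono eqz_nat => /negPf ->.
Qed.

Lemma gr_piece0 k : 0 \in gr_piece I k.
Proof. by apply/asboolP; exists 0 => [n|]; rewrite ?coef0 ?raddf0. Qed.

Lemma gr_pieceD k f g : f \in gr_piece I k -> g \in gr_piece I k -> f + g \in gr_piece I k.
Proof.
move=> /asboolP[p hp ->] /asboolP[q hq ->]; apply/asboolP; exists (p + q) => [n hn|].
  by rewrite rees_valD coefD hp ?hq ?addr0.
by rewrite raddfD.
Qed.

Lemma gr_pieceN k g : g \in gr_piece I k -> - g \in gr_piece I k.
Proof.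
move=> /asboolP[p hp ->]; apply/asboolP; exists (- p) => [n hn|]; last by rewrite raddfN.
by rewrite coefN hp ?oppr0.
Qed.

Lemma gr_piece_sum k (T : Type) (r : seq T) (P : pred T) (F : T -> gr I) :
  (forall i, P i -> F i \in gr_piece I k) -> \sum_(i <- r | P i) F i \in gr_piece I k.
Proof.
move=> hF; apply: (big_ind (fun g => g \in gr_piece I k)) => //; first exact: gr_piece0.
exact: gr_pieceD.
Qed.

Lemma gr_piece_pr n k g : g \in gr_piece I k -> n%:Z != k -> gpr n g = 0.
Proof.
move=> /asboolP[p hp ->] hn; rewrite gpr_pi hp //.
by apply/ini0; apply: idl0; apply: pw_is.
Qed.

Lemma gpr_piece n g : gpr n g \in gr_piece I n%:Z.
Proof.
have [a ha ->] := gpr_ex n g; apply/gr_pieceP; by rewrite gpr_ini // eqxx.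
Qed.

Lemma ini_piece n a : pw I n a -> ini n a \in gr_piece I n%:Z.
Proof. by move=> ha; apply/gr_pieceP; rewrite gpr_ini // eqxx. Qed.

Lemma gr_piece_ini n g : g \in gr_piece I n%:Z -> exists2 a, pw I n a & g = ini n a.
Proof. by move=> /gr_pieceP ->; apply: gpr_ex. Qed.

Lemma gr_pieceX k g n : g \in gr_piece I k -> g ^+ n \in gr_piece I (k * n%:Z).
Proof.
move=> hg; elim: n => [|n IH]; first by rewrite mulr0 expr0 -ini1; apply: ini_piece; rewrite pw0.
by rewrite exprS intS mulrDr mulr1; apply: gr_pieceM.
Qed.

Lemma gr_const_piece a : gr_const I a \in gr_piece I 0.
Proof. by rewrite ini_constE; apply: ini_piece; rewrite pw0. Qed.

Lemma gr_irrelevantP g : g \in gr_irrelevant I <-> gpr 0 g = 0.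
Proof.
split=> [/asboolP[p hp ->]|].
  by rewrite gpr_pi hp; apply/ini0; apply: idl0; apply: pw_is.
have [p ->] := gr_pi_surj g; rewrite gpr_pi => /(ini0 (rees_coef p 0)) h.
have vB : rees_val (p - to_rees I ((rees_val p)`_0 *: 'X^0)) =
    rees_val p - (rees_val p)`_0 *: 'X^0 by rewrite -[in RHS](ini_val (rees_coef p 0)).
apply/asboolP; exists (p - to_rees I ((rees_val p)`_0 *: 'X^0)).
  by rewrite vB coefB coef_mono eqxx subrr.
apply/gr_pi_eq => n; rewrite vB coefB coef_mono opprB addrCA subrr addr0.
by case: eqP => [->//|_]; apply: idl0; apply: pw_is.
Qed.

End GradedRing.

(** * Noether normalization *)

Section PolynomialNonvanishing.
Variable k : fieldType.
Hypothesis infk : forall n, exists s : seq k, uniq s /\ size s = n.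

Lemma poly_nonroot (p : {poly k}) : p != 0 -> exists c, p.[c] != 0.
Proof.
move=> p0; apply: contrapT => h; have [s [us ss]] := infk (size p).
have : (size s < size p)%N.
  apply: max_poly_roots us => //; apply/allP => c _; apply/rootP/eqP.
  by apply: contraT => hc; case: h; exists c.
by rewrite ss ltnn.
Qed.

(** Splitting off the exponent of the last variable is injective on monomials, so the leading
    monomial cannot cancel. *)
Lemma muni_neq0 n (p : {mpoly k[n.+1]}) : p != 0 -> muni p != 0.
Proof.
move=> p0; have hm := mlead_supp p0; set m0 := mlead p in hm.
pose w (m : 'X_{1..n.+1}) : 'X_{1..n} := [multinom (m (widen_ord (leqnSn n) i)) | i < n].
have inj m m' : w m = w m' -> m ord_max = m' ord_max -> m = m'.
  move=> /mnmP e1 e2; apply/mnmP => i; have [ilt|ige] := ltnP i n.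
    have := e1 (Ordinal ilt); rewrite !mnmE.
    by have -> : widen_ord (leqnSn n) (Ordinal ilt) = i by apply: val_inj.
  have -> // : i = ord_max by apply: val_inj => /=; apply/eqP; rewrite eqn_leq ige -ltnS ltn_ord.
have e : ((muni p)`_(m0 ord_max))@_(w m0) = p@_m0.
  rewrite muniE coef_sum raddf_sum (bigD1_seq m0) ?msupp_uniq //= big1 ?addr0 => [|m mm0].
    by rewrite coefZ coefXn eqxx mulr1 mcoeffZ mcoeffX eqxx mulr1.
  rewrite coefZ coefXn; case: eqP => [e2|_]; last by rewrite mulr0 mcoeff0.
  rewrite mulr1 mcoeffZ mcoeffX; case: eqP => [e1|_]; last by rewrite mulr0.
  by case/eqP: mm0; apply: inj.
apply/eqP => p'; move: hm; rewrite mcoeff_msupp -e p' coef0 mcoeff0 eqxx.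
by [].
Qed.

Lemma mpoly_nonroot n (p : {mpoly k[n]}) : p != 0 -> exists v, p.@[v] != 0.
Proof.
elim: n p => [|n IH] p p0.
  exists (fun _ => 0); have hm := mlead_supp p0.
  have all0 (m : 'X_{1..0}) : m = 0%MM by apply/mnmP => -[].
  have -> : p = (p@_0)%:MP.
    by apply/mpolyP => m; rewrite (all0 m) mcoeffC eqxx mulr1.
  by rewrite mevalC -mcoeff_msupp -(all0 (mlead p)).
have /muni_neq0 mp0 := p0.
have [|v' hv'] := IH (lead_coef (muni p)); first by rewrite lead_coef_eq0.
have [|c hc] := @poly_nonroot (map_poly (meval v') (muni p)).
  apply: contraNneq hv' => e.
  by rewrite lead_coefE -(coef_map (meval v')) e coef0.
exists (fun i => if insub (val i) is Some j then v' j else c).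
apply: contraNneq hc => e; apply/eqP; rewrite -e.
rewrite muniE mevalE raddf_sum horner_sum; apply: eq_bigr => m _.
rewrite /= map_polyZ /= map_polyXn hornerZ hornerXn mevalZ mevalX -mulrA big_ord_recr /=.
rewrite insubF ?ltnn //. congr (_ * (_ * _)); apply: eq_bigr => i _.
by rewrite mnmE; have -> : insub (i : nat) = Some i by apply: (valK i).
Qed.
End PolynomialNonvanishing.

(** * Ideals generated by powers of variables *)

Section MonomialIdeals.
Variables (k : fieldType) (t : nat).
Local Notation D := {mpoly k[t]}.
Implicit Types (F : D) (P : pred 'I_t).

Definition in_pow_ideal N P F := forall m, m \in msupp F -> exists2 i, P i & (N <= m i)%N.

Lemma in_pow_idealP N P F :
  in_pow_ideal N P F <-> exists q : 'I_t -> D, F = \sum_(i | P i) 'X_i ^+ N * q i.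
Proof.
split=> [h|[q ->] m]; last first.
  rewrite mcoeff_msupp raddf_sum /= => hm; apply: contrapT => hn.
  case/eqP: hm; apply: big1 => i Pi; rewrite mpolyXn mulrC.
  apply/eqP; rewrite -[_ == 0]negbK -mcoeff_msupp (perm_mem (msuppMX _ _)).
  apply/negP => /mapP[m' _ e]; apply: hn; exists i => //.
  by rewrite e mnmDE mulmnE mnm1E eqxx mul1n leq_addr.
have /choice[c hc] : forall m, exists o : option 'I_t, m \in msupp F ->
    if o is Some i then P i && (N <= m i)%N else false.
  move=> m; have [hm|] := boolP (m \in msupp F); last by exists None.
  by have [i Pi hi] := h m hm; exists (Some i); rewrite Pi hi.
exists (fun i => \sum_(m <- msupp F | c m == Some i) F@_m *: 'X_[(m - U_(i) *+ N)%MM]).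
rewrite {1}[F]mpolyE.
under [RHS]eq_bigr => i _ do rewrite big_distrr /= big_mkcond /=.
rewrite exchange_big /= [LHS]big_seq [RHS]big_seq; apply: eq_bigr => m hm.
have := hc m hm; case: (c m) => // i /andP[Pi hi].
rewrite (bigD1 i) //= eqxx big1 ?addr0 => [|j /andP[_ ji]]; last first.
  by case: eqP => // -[e]; case/eqP: ji.
rewrite mpolyXn -scalerAr -mpolyXD; congr (_ *: 'X_[_]); apply/mnmP => j.
rewrite mnmDE mnmBE mulmnE mnm1E; case: eqP => [<-|_]; last by rewrite mul0n subn0 add0n.
by rewrite mul1n subnKC.
Qed.

(** Multiplication by ['X_a] leaves the exponents of the variables in [P] unchanged. *)
Lemma in_pow_ideal_reg N P a F : ~~ P a -> in_pow_ideal N P ('X_a ^+ N * F) -> in_pow_ideal N P F.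
Proof.
move=> Pa h m hm; have [|i Pi] := h (m + U_(a) *+ N)%MM.
  by rewrite mpolyXn mulrC (perm_mem (msuppMX _ _)) addmC; apply/mapP; exists m.
rewrite mnmDE mulmnE mnm1E; case: eqP => [e|_]; last by rewrite mul0n addn0; exists i.
by case/negP: Pa; rewrite e.
Qed.

(** No exponent of the leading monomial reaches its degree plus 1. This is the nonvanishing of a top
    local cohomology class of the polynomial ring. *)
Lemma in_pow_ideal_final F : F != 0 -> exists K, forall l,
  ~ in_pow_ideal (K + l) predT ((\prod_i 'X_i) ^+ l * F).
Proof.
move=> F0; exists (mdeg (mlead F)).+1 => l h.
have e : (\prod_i 'X_i) ^+ l = 'X_[[multinom l | i < t]] :> D.
  rewrite -prodrXl mpolyXE_id; apply: eq_bigr => i _; by rewrite mnmE.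
have [|i _] := h (mlead F + [multinom l | i < t])%MM.
  by rewrite e mulrC (perm_mem (msuppMX _ _)) addmC; apply/mapP; exists (mlead F) => //; apply: mlead_supp.
rewrite mnmDE mnmE leq_add2r mdegE (bigD1 i) //=; lia.
Qed.

End MonomialIdeals.

(** * Domains finite over a polynomial ring *)

Section FiniteOverPolynomials.
Variables (k : fieldType) (B : comNzRingType) (kap : {rmorphism k -> B}) (t : nat) (y : 'I_t -> B).
Local Notation D := {mpoly k[t]}.
Definition ev (F : D) : B := mmap kap y F.
HB.instance Definition _ := GRing.RMorphism.copy ev (mmap kap y).

Lemma evX i : ev 'X_i = y i.
Proof. by rewrite /ev mmapX mmap1U. Qed.

Lemma evXM i N F : ev ('X_i ^+ N * F) = y i ^+ N * ev F.
Proof. by rewrite rmorphM rmorphXn /= evX. Qed.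

Hypothesis domB : forall a b : B, a * b = 0 -> a = 0 \/ b = 0.
Hypothesis ev_inj : forall F, ev F = 0 -> F = 0.
Variables (v : nat) (g : 'I_v -> B).
Hypothesis gen : forall b, exists F : 'I_v -> D, b = \sum_i ev (F i) * g i.

(** Cayley-Hamilton for the matrix of multiplication by [b]: the determinant kills the generators
    [g], and 1 is a combination of them. *)
Lemma integral b : exists2 q : {poly D}, q \is monic & (map_poly ev q).[b] = 0.
Proof.
have /choice[M hM] : forall i, exists F : 'I_v -> D, b * g i = \sum_j ev (F j) * g j.
  by move=> i; apply: gen.
pose MD : 'M[D]_v := \matrix_(i, j) M i j.
exists (char_poly MD); first exact: char_poly_monic.
pose N : 'M[B]_v := b%:M - map_mx ev MD.
have -> : (map_poly ev (char_poly MD)).[b] = \det N.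
  rewrite map_char_poly -[LHS]/(horner_eval b _) /char_poly -det_map_mx; congr (\det _).
  apply/matrixP => i j; rewrite !mxE [LHS]/= horner_evalE hornerD hornerN hornerMn hornerX hornerC.
  by [].
have N0 : N *m (\col_i g i) = 0.
  apply/matrixP => i j; rewrite !mxE.
  under eq_bigr do rewrite !mxE mulrBl.
  rewrite sumrB -hM (bigD1 i) //= eqxx mulr1n big1 ?addr0 ?subrr // => l li.
  by rewrite eq_sym (negPf li) mulr0n mul0r.
have detg i : \det N * g i = 0.
  have : (\adj N *m N *m (\col_i g i)) i ord0 = 0 by rewrite -mulmxA N0 mulmx0 mxE.
  by rewrite mul_adj_mx mul_scalar_mx !mxE.
have [F e] := gen 1.
by rewrite -[LHS]mulr1 e big_distrr big1 // => i _; rewrite /= mulrCA detg mulr0.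
Qed.

(** Powers of [b] are cancelled from an equation of [b] until its constant term is nonzero; that
    term is then a multiple of [b]. *)
Lemma multiple_in_ev b : b <> 0 -> exists F b', F <> 0 /\ b * b' = ev F.
Proof.
move=> b0; have [q mq] := integral b; have := monic_neq0 mq.
elim/poly_ind: q {mq} => [|p c IH]; first by rewrite eqxx.
rewrite rmorphD rmorphM /= map_polyX map_polyC hornerD hornerM hornerX hornerC /= => pc e.
have [c0|c0] := eqVneq c 0; last first.
  exists c, (- (map_poly ev p).[b]); split; first exact/eqP.
  by apply/eqP; rewrite mulrN eq_sym -addr_eq0 addrC mulrC e.
apply: IH; first by apply: contraNneq pc => ->; rewrite mul0r c0 add0r.
by move: e; rewrite c0 raddf0 addr0 => /domB[].
Qed.

Definition indep (J : {set 'I_v}) := forall F : 'I_v -> D,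
  \sum_(j in J) ev (F j) * g j = 0 -> forall j, j \in J -> F j = 0.

Definition evspan (J : {set 'I_v}) : set B := [set b | exists F, b = \sum_(j in J) ev (F j) * g j].

Lemma evspanD J b c : evspan J b -> evspan J c -> evspan J (b + c).
Proof.
move=> [F ->] [G ->]; exists (fun j => F j + G j); rewrite -big_split.
by apply: eq_bigr => j _; rewrite rmorphD mulrDl.
Qed.

Lemma evspanM J F b : evspan J b -> evspan J (ev F * b).
Proof.
move=> [G ->]; exists (fun j => F * G j); rewrite big_distrr /=.
by apply: eq_bigr => j _; rewrite rmorphM mulrA.
Qed.

Lemma evspan_sum J (T : Type) (r : seq T) (f : T -> B) :
  (forall i, evspan J (f i)) -> evspan J (\sum_(i <- r) f i).
Proof.
move=> h; apply: (big_ind (evspan J)) => //; last exact: evspanD.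
by exists (fun=> 0); rewrite big1 // => j _; rewrite rmorph0 mul0r.
Qed.

Lemma evspan_gen (J : {set 'I_v}) j : j \in J -> evspan J (g j).
Proof.
move=> jJ; exists (fun i => if i == j then 1 else 0); rewrite (bigD1 j) //= eqxx.
rewrite rmorph1 mul1r big1 ?addr0 // => i /andP[_ /negPf ->].
by rewrite rmorph0 mul0r.
Qed.

(** Over an independent subset of largest cardinality every generator has a nonzero multiple in the
    span; the product of the multipliers serves all of them. *)
Lemma almost_basis : exists J s, [/\ indep J, s <> 0 & forall b, evspan J (ev s * b)].
Proof.
have i0 : `[< indep finset.set0 >] by apply/asboolP => F _ j; rewrite inE.
have [J /asboolP indJ maxJ] := @arg_maxnP _ finset.set0 (fun J => `[< indep J >]) (fun J => #|J|) i0.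
have /choice[s hs] : forall i, exists s, s <> 0 /\ evspan J (ev s * g i).
  move=> i; have [iJ|iJ] := boolP (i \in J).
    exists 1; split; first exact/eqP/oner_neq0.
    by apply: evspanM; apply: evspan_gen.
  have /asboolP : ~~ `[< indep (i |: J)%SET >].
    by apply/negP => /maxJ; rewrite cardsU1 iJ add1n /= ltnn.
  move=> /existsNP[F /not_implyP[e /existsNP[j /not_implyP[jJ Fj]]]].
  have e' : ev (F i) * g i + \sum_(j in J) ev (F j) * g j = 0 by rewrite -big_setU1.
  exists (F i); split=> [Fi0|].
    case: Fj; move: jJ; rewrite !inE => /orP[/eqP-> //|]; apply: indJ.
    by rewrite -[RHS]e' Fi0 rmorph0 mul0r add0r.
  exists (fun j => - F j); apply/eqP.
  under eq_bigr do rewrite rmorphN mulNr.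
  by rewrite sumrN -addr_eq0 e'.
exists J, (\prod_i s i); split=> // [|b].
  by apply/eqP/prodf_neq0 => i _; apply/eqP; case: (hs i).
have [F ->] := gen b; rewrite big_distrr /=; apply: evspan_sum => i.
rewrite mulrCA; apply: evspanM; rewrite (bigD1 i) //= mulrC rmorphM mulrA [g i * _]mulrC mulrC.
by apply: evspanM; case: (hs i).
Qed.

Lemma indep_eq J F G : indep J ->
  \sum_(j in J) ev (F j) * g j = \sum_(j in J) ev (G j) * g j -> forall j, j \in J -> F j = G j.
Proof.
move=> hJ /eqP; rewrite -subr_eq0 -sumrB => /eqP e j jJ.
apply/eqP; rewrite -subr_eq0; apply/eqP; apply: (hJ (fun j => F j - G j)) jJ.
by rewrite -[RHS]e; apply: eq_bigr => i _; rewrite rmorphB mulrBl.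
Qed.

(* Colons by y_a^N are almost trivial: B contains a free k[Y]-module over which they are. *)
Lemma almost_regular : exists2 s, s <> 0 & forall N (P : pred 'I_t) a c q, ~~ P a ->
  y a ^+ N * c = \sum_(b | P b) y b ^+ N * q b ->
  exists q', ev s * c = \sum_(b | P b) y b ^+ N * q' b.
Proof.
have [J [s [indJ s0 hs]]] := almost_basis; exists s => // N P a c q Pa e.
have /choice[Q hQ] : forall b, exists F, ev s * q b = \sum_(j in J) ev (F j) * g j.
  by move=> b; apply: hs.
have [p hp] := hs c.
have hj j : j \in J -> exists q' : 'I_t -> D, p j = \sum_(b | P b) 'X_b ^+ N * q' b.
  move=> jJ; apply/in_pow_idealP/(in_pow_ideal_reg Pa)/in_pow_idealP; exists (fun b => Q b j).
  apply: (indep_eq (F := fun j => 'X_a ^+ N * p j)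
    (G := fun j => \sum_(b | P b) 'X_b ^+ N * Q b j) indJ) jJ.
  transitivity (ev s * (y a ^+ N * c)).
    rewrite mulrCA hp big_distrr; apply: eq_bigr => i _.
    by rewrite /= evXM ?mulrA.
  rewrite e big_distrr /=.
  under eq_bigr => b _ do rewrite mulrCA hQ big_distrr /=.
  rewrite exchange_big; apply: eq_bigr => i _; rewrite rmorph_sum big_distrl; apply: eq_bigr => b _.
  by rewrite /= evXM ?mulrA.
have /choice[q' hq'] : forall j, exists q' : 'I_t -> D, j \in J -> p j = \sum_(b | P b) 'X_b ^+ N * q' b.
  move=> j; have [/hj[q' hq']|_] := boolP (j \in J); first by exists q'.
  by exists (fun=> 0).
exists (fun b => \sum_(j in J) ev (q' j b) * g j).
under [RHS]eq_bigr do rewrite big_distrr.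
rewrite exchange_big hp; apply: eq_bigr => j jJ; rewrite hq' // rmorph_sum big_distrl.
by apply: eq_bigr => b _; rewrite /= evXM ?mulrA.
Qed.

(** A relation multiplied by [s1] passes to coordinates in the almost basis; at a nonzero coordinate
    of [ev s1] it contradicts [in_pow_ideal_final]. *)
Lemma top_class_nonzero s : s <> 0 -> exists K, forall l q,
  ev s * (\prod_i y i) ^+ l <> \sum_b y b ^+ (K + l) * q b.
Proof.
move=> s0; have [J [s1 [indJ s10 hs]]] := almost_basis.
have [p hp] := hs 1; rewrite mulr1 in hp.
have [j0 j0J pj0] : exists2 j, j \in J & p j <> 0.
  apply: contrapT => h; apply: s10; apply: ev_inj; rewrite hp big1 // => j jJ.
  have -> : p j = 0 by apply: contrapT => hj; apply: h; exists j.
  by rewrite rmorph0 mul0r.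
have F0 : s * p j0 != 0 by rewrite mulf_neq0 //; apply/eqP.
have [K hK] := in_pow_ideal_final F0; exists K => l q e; apply: (hK l).
have /choice[Q hQ] : forall b, exists F, ev s1 * q b = \sum_(j in J) ev (F j) * g j.
  by move=> b; apply: hs.
apply/in_pow_idealP; exists (fun b => Q b j0).
apply: (indep_eq (F := fun j => (\prod_i 'X_i) ^+ l * (s * p j))
  (G := fun j => \sum_(b | predT b) 'X_b ^+ (K + l) * Q b j) indJ) j0J.
transitivity (ev s1 * (ev s * (\prod_i y i) ^+ l)).
  rewrite hp big_distrl; apply: eq_bigr => j _; rewrite /= !rmorphM rmorphXn rmorph_prod /=.
  under eq_bigr do rewrite evX.
  by ring.
rewrite e big_distrr /=.
under eq_bigr => b _ do rewrite mulrCA hQ big_distrr /=.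
rewrite exchange_big; apply: eq_bigr => j _; rewrite rmorph_sum big_distrl; apply: eq_bigr => b _.
by rewrite /= evXM ?mulrA.
Qed.

(** * A chain of primes of length t *)

Section PrimeChain.
Hypothesis nB : noeth B.

(** Reduction modulo the first [j] variables. The [j]-th prime of the chain is required to meet the
    polynomials only inside the kernel. *)
Definition kill j (F : D) : D := mmap (@mpolyC t k) (fun i : 'I_t => if (i < j)%N then 0 else 'X_i) F.
HB.instance Definition _ j := GRing.RMorphism.copy (kill j)
  (mmap (@mpolyC t k) (fun i : 'I_t => if (i < j)%N then 0 else 'X_i)).

Lemma killX j i : kill j 'X_i = if (i < j)%N then 0 else 'X_i.
Proof. by rewrite /kill mmapX mmap1U. Qed.

Lemma killC j c : kill j c%:MP = c%:MP.
Proof. by rewrite /kill mmapC. Qed.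

Lemma mpoly_rmorph_eq (S : comNzRingType) (f1 f2 : {rmorphism D -> S}) :
  (forall c, f1 c%:MP = f2 c%:MP) -> (forall i, f1 'X_i = f2 'X_i) -> f1 =1 f2.
Proof.
move=> hC hX F; rewrite [F]mpolyE !rmorph_sum; apply: eq_bigr => m _.
rewrite -mul_mpolyC !rmorphM hC mpolyXE_id !rmorph_prod; congr (_ * _).
by apply: eq_bigr => i _; rewrite !rmorphXn hX.
Qed.

Lemma kill0 F : kill 0 F = F.
Proof.
apply: (mpoly_rmorph_eq (f1 := kill 0) (f2 := idfun)) => [c|i] /=; by rewrite ?killC ?killX.
Qed.

Lemma kill_comp j F : kill j.+1 (kill j F) = kill j.+1 F.
Proof.
apply: (mpoly_rmorph_eq (f1 := kill j.+1 \o kill j) (f2 := kill j.+1)) => [c|i] /=.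
  by rewrite !killC.
rewrite !killX; case: ifP => ij; last by rewrite killX.
by rewrite rmorph0 ltnS (ltnW ij).
Qed.

(** Lying over: a prime containing [P] and [y j'] is found that avoids all polynomials surviving
    [kill j.+1], which is possible by integrality. *)
Lemma prime_step j (jt : (j < t)%N) (P : set B) : prime_set P ->
  (forall F, P (ev F) -> kill j F = 0) ->
  exists P', [/\ prime_set P', P `<=` P', ~ (P' `<=` P) & forall F, P' (ev F) -> kill j.+1 F = 0].
Proof.
move=> pP hP; have [idP P1 PM] := pP; pose j' := Ordinal jt.
pose T : set B := [set b | exists F, kill j.+1 F <> 0 /\ b = ev F].
have multT : mult_set T.
  split; first by exists 1; rewrite !rmorph1; split=> //; apply/eqP/oner_neq0.
  move=> _ _ [F [hF ->]] [G [hG ->]]; exists (F * G); rewrite !rmorphM; split=> //.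
  by apply/eqP; rewrite mulf_neq0 //; apply/eqP.
have disj b : T b -> ~ addi P (y j') b.
  move=> [q [hq ->]] [p Pp [c e]]; apply: hq.
  have [Q mQ Q0] := integral c.
  pose n := (size Q).-1.
  have sQ : size Q = n.+1 by rewrite prednK // lt0n size_poly_eq0 monic_neq0.
  (* The equation [Q] of [c], homogenized: as [ev q] is congruent to [c * y j'] modulo [P], the
     value of [F] is congruent to [y j' ^+ n] times [Q] at [c], that is to 0. Killing ['X_j'] leaves
     the power of [q]. *)
  pose F := \sum_(i < n.+1) Q`_i * 'X_j' ^+ (n - i) * q ^+ i.
  have PF : P (ev F).
    have congq i : P (ev q ^+ i - (c * y j') ^+ i).
      rewrite subrXX; apply: idlMr => //; rewrite e addrK.
      by [].
    have -> : ev F = \sum_(i < n.+1) ev Q`_i * y j' ^+ (n - i) * (ev q ^+ i - (c * y j') ^+ i)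
        + y j' ^+ n * (map_poly ev Q).[c].
      rewrite (horner_coef_wide (n := n.+1)); last by rewrite -sQ; apply: size_poly.
      rewrite big_distrr -big_split rmorph_sum; apply: eq_bigr => i _ /=.
      rewrite !rmorphM !rmorphXn /= evX coef_map /= mulrBr exprMn.
      rewrite -[in y j' ^+ n](subnK (ltn_ord i : (i <= n)%N)) exprD; ring.
    rewrite Q0 mulr0 addr0; apply: idl_sum => // i _.
    exact: (idlM idP).
  have : kill j.+1 F = 0 by rewrite -kill_comp hP // rmorph0.
  rewrite /F rmorph_sum big_ord_recr /= big1 ?add0r => [|i _]; last first.
    rewrite !rmorphM !rmorphXn /= killX ltnSn /= expr0n subn_eq0 leqNgt ltn_ord /=.
    by rewrite mulr0 mul0r.
  have -> : Q`_n = 1 by apply/eqP.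
  rewrite subnn expr0 !mul1r rmorphXn => /eqP; rewrite expf_eq0 => /andP[_ /eqP].
  by [].
have [P' [pP' sP' TP']] := prime_avoiding nB (addi_ideal (y j') idP) multT disj.
exists P'; split=> // [a Pa|h|F hF].
- by apply: sP'; apply: addi_sub.
- have /h Py : P' (y j') by apply: sP'; apply: addi_gen; apply: idl0.
  have := hP 'X_j'; rewrite evX killX ltnn => /(_ Py) /(congr1 (mcoeff U_(j'))) /eqP.
  by rewrite mcoeffX eqxx mcoeff0 oner_eq0.
- by apply: contrapT => nF; apply: (TP' (ev F)) => //; exists F.
Qed.

Lemma prime_chain_ev : exists2 P : nat -> set B, prime_seq t P & P 0%N = [set 0].
Proof.
suff H j : (j <= t)%N -> exists P : nat -> set B, [/\ prime_seq j P, P 0%N = [set 0] &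
    forall F, P j (ev F) -> kill j F = 0].
  by have [P [h1 h2 _]] := H t (leqnn t); exists P.
elim: j => [|j IH] jt.
  exists (fun _ => [set 0]); split=> // [|F /ev_inj ->]; last by rewrite kill0.
  split=> // l _; split; [exact: set0_ideal|by apply/eqP; rewrite oner_eq0|exact: domB].
have [P [pP P0 hP]] := IH (ltnW jt).
have [P' [pP' sP' nP' hP']] := prime_step jt (pP.1 j (leqnn j)) hP.
exists (fun i => if (i <= j)%N then P i else P'); split=> //; first exact: prime_seq_rcons.
by rewrite ltnn.
Qed.

End PrimeChain.
End FiniteOverPolynomials.

(** * Quotient rings and the residue field *)

Section Quotients.

Lemma quotient_ring (R : comNzRingType) (P : set R) : is_ideal P -> ~ P 1 ->
  exists (B : comNzRingType) (p : {rmorphism R -> B}),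
    (forall b, exists a, b = p a) /\ forall a, p a = 0 <-> P a.
Proof.
move=> idP P1; have [J hJ] := idealr_of idP P1.
exists ({ideal_quot J} : comNzRingType), (\pi_{ideal_quot J} : {rmorphism R -> {ideal_quot J}}).
split=> [b|a]; first by exists (repr (b : Quotient.quot J)); rewrite /= reprK.
have e : (a \in J) = (\pi_{ideal_quot J} a == 0 :> {ideal_quot J}).
  by rewrite -{1}[a]subr0 Quotient.idealrBE raddf0.
split=> [h|/hJ h]; last by apply/eqP; rewrite -[_ == _]e.
by apply/hJ; rewrite e; apply/eqP.
Qed.

Lemma factor_rmorphism (R S T : comNzRingType) (f : {rmorphism R -> S}) (h : {rmorphism R -> T}) :
  (forall b, exists a, b = f a) -> (forall a, f a = 0 -> h a = 0) ->
  exists h' : {rmorphism S -> T}, forall a, h' (f a) = h a.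
Proof.
move=> sf kf; have [r hr] := choice sf.
have hE a b : f a = f b -> h a = h b.
  move=> e; apply/eqP; rewrite -subr_eq0 -rmorphB; apply/eqP/kf.
  by rewrite rmorphB e subrr.
pose q b := h (r b).
have qE a : q (f a) = h a by apply: hE; rewrite -hr.
have qB : zmod_morphism q.
  by move=> a b; rewrite {2 3}/q (hr a) (hr b) -rmorphB qE rmorphB -!hr.
have qM : monoid_morphism q.
  split=> [|a b]; first by rewrite -(rmorph1 f) qE rmorph1.
  by rewrite {2 3}/q (hr a) (hr b) -rmorphM qE rmorphM -!hr.
pose qb := GRing.isZmodMorphism.Build S T q qB.
pose qm := GRing.isMonoidMorphism.Build S T q qM.
pose q' : {rmorphism S -> T} := HB.pack q qb qm.
by exists q'.
Qed.

Lemma residue_field (A : comNzRingType) (m : idealr A) :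
  noetherian A -> local_ring m -> infinite_set [set: {ideal_quot m}] ->
  exists (K : fieldType) (p : {rmorphism A -> K}),
    [/\ forall b, exists a, b = p a, forall a, p a = 0 <-> a \in m
      & forall n, exists s : seq K, uniq s /\ size s = n].
Proof.
move=> nA lA infA; pose Q : comNzRingType := {ideal_quot m}.
pose pi : A -> Q := \pi_{ideal_quot m}.
have pi0 a : (a \in m) = (pi a == 0).
  by rewrite -{1}[a]subr0 Quotient.idealrBE raddf0.
have invex (b : Q) : exists c : Q, (b != 0 -> c * b = 1) /\ (b = 0 -> c = 0).
  have [->|b0] := eqVneq b 0; first by exists 0.
  have bE : b = pi (repr b) by rewrite /pi reprK.
  have [|c hc] := local_unit nA lA (a := repr b); first by rewrite pi0 -bE.
  exists (pi c); split=> [_|e]; last by rewrite e eqxx in b0.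
  by rewrite bE /pi -rmorphM mulrC hc rmorph1.
have [inv hinv] := choice invex.
pose fm := GRing.ComNzRing_isField.Build Q (fun b b0 => (hinv b).1 b0) ((hinv 0).2 erefl).
pose K : fieldType := HB.pack {ideal_quot m} fm.
exists K, (\pi_{ideal_quot m} : {rmorphism A -> Q}); split=> [b|a|n].
- by exists (repr (b : Quotient.quot m)); rewrite /= reprK.
- by rewrite pi0; split=> [h|/eqP //]; apply/eqP.
elim: n => [|n [s [us ss]]]; first by exists [::].
have [c cs] : exists c : K, c \notin s.
  apply: contrapT => h; apply: infA; apply/finite_seqP; exists s.
  by apply/seteqP; split=> c //= _; apply: contrapT => /negP hc; apply: h; exists c.
by exists (c :: s); rewrite /= cs us ss.
Qed.
End Quotients.

(** * Ideals enlarged by a family, and congruences *)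

Section FamilyIdeal.
Variable R : comNzRingType.
Implicit Types (V : set R) (a b c : R).

Definition fam_ideal (V : set R) t (Y : 'I_t -> R) : set R :=
  [set g | exists q : 'I_t -> R, V (g - \sum_i Y i * q i)].

Lemma fam_ideal_is V t (Y : 'I_t -> R) : is_ideal V -> is_ideal (fam_ideal V Y).
Proof.
move=> idV; split.
- exists (fun=> 0); rewrite big1 ?subr0; first exact: idl0.
  by move=> i _; rewrite mulr0.
- move=> a b [q hq] [q' hq']; exists (fun i => q i + q' i).
  under eq_bigr do rewrite mulrDr.
  by rewrite big_split opprD addrACA; apply: idlD.
move=> a b [q hq]; exists (fun i => a * q i).
under eq_bigr do rewrite mulrCA.
by rewrite -big_distrr -mulrBr; apply: idlM.
Qed.

Lemma fam_ideal_sub V t (Y : 'I_t -> R) : V `<=` fam_ideal V Y.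
Proof.
by move=> a Va; exists (fun=> 0); rewrite big1 ?subr0 // => i _; rewrite mulr0.
Qed.

Lemma fam_ideal_gen V t (Y : 'I_t -> R) i : V 0 -> fam_ideal V Y (Y i).
Proof.
move=> V0; exists (fun j => if j == i then 1 else 0).
rewrite (bigD1 i) //= eqxx mulr1 big1 ?addr0 ?subrr // => j /negPf ->.
by rewrite mulr0.
Qed.

Lemma fam_ideal_comb V t (Y q : 'I_t -> R) : V 0 -> fam_ideal V Y (\sum_i Y i * q i).
Proof. by move=> V0; exists q; rewrite subrr. Qed.

Lemma cong_exp V a b n : is_ideal V -> V (a - b) -> V (a ^+ n - b ^+ n).
Proof. by move=> idV h; rewrite subrXX; apply: idlMr. Qed.

Lemma cong_mul V a b a' b' : is_ideal V -> V (a - b) -> V (a' - b') -> V (a * a' - b * b').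
Proof.
move=> idV h h'; have -> : a * a' - b * b' = a' * (a - b) + b * (a' - b') by ring.
by apply: idlD => //; apply: idlM.
Qed.

Lemma cong_prod V (T : Type) (r : seq T) (u v : T -> R) : is_ideal V ->
  (forall i, V (u i - v i)) -> V (\prod_(i <- r) u i - \prod_(i <- r) v i).
Proof.
move=> idV h; elim: r => [|i r IH]; first by rewrite !big_nil subrr; apply: idl0.
by rewrite !big_cons; apply: cong_mul.
Qed.

Lemma cong_sum V (T : Type) (r : seq T) (P : pred T) (u v : T -> R) : is_ideal V ->
  (forall i, V (u i - v i)) -> V (\sum_(i <- r | P i) u i - \sum_(i <- r | P i) v i).
Proof. by move=> idV h; rewrite -sumrB; apply: idl_sum. Qed.

Lemma cong_trans V a b c : is_ideal V -> V (a - b) -> V (b - c) -> V (a - c).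
Proof. by move=> idV h h'; rewrite -[a](subrK b) -addrA; apply: idlD. Qed.
End FamilyIdeal.

(** * Homogeneous normalization of G / P *)

Section Normalization.
Variables (A : comNzRingType) (I : idealr A) (nA : noeth A).
Variables (K : fieldType) (pK : {rmorphism A -> K}).
Hypotheses (sK : forall b, exists a, b = pK a)
  (infK : forall n, exists s : seq K, uniq s /\ size s = n).
Variable P : set (gr I).
Hypotheses (pP : prime_set P) (homP : forall g n, P g -> P (gpr n g)).
Variables (B : comNzRingType) (pB : {rmorphism gr I -> B}).
Hypotheses (sB : forall b, exists a, b = pB a) (kB : forall a, pB a = 0 <-> P a).
Variable kap : {rmorphism K -> B}.
Hypothesis kapE : forall a, kap (pK a) = pB (gr_const I a).

Let idP : is_ideal P. Proof. by case: pP. Qed.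

Definition degree_one t (Y : 'I_t -> gr I) := forall i, Y i \in gr_piece I 1.
(** [Y] generates the irrelevant ideal of [G / P] up to radical, expressed by degrees instead of
    powers. *)
Definition radical_of t (Y : 'I_t -> gr I) :=
  exists N, forall n g, (N <= n)%N -> g \in gr_piece I n%:Z -> fam_ideal P Y g.

Lemma gprM1 n f g : f \in gr_piece I 1 -> gpr n.+1 (f * g) = f * gpr n g.
Proof. by move=> /gr_piece_ini[a ha ->]; rewrite gprM // subn1. Qed.

Lemma gr_id n g : g \in gr_piece I n%:Z -> gpr n g = g.
Proof. by move=> /gr_pieceP. Qed.

(** Since [P] is homogeneous, the component of degree [n.+1] of a relation is again a relation. *)
Lemma fam_ideal_hom t (Y : 'I_t -> gr I) n g : degree_one Y -> g \in gr_piece I n.+1%:Z ->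
  fam_ideal P Y g ->
  exists q : 'I_t -> gr I, (forall i, q i \in gr_piece I n%:Z) /\ P (g - \sum_i Y i * q i).
Proof.
move=> dY hg [q /(homP n.+1)]; rewrite gprB gr_id // gpr_sum => h.
exists (fun i => gpr n (q i)); split=> [i|]; first exact: gpr_piece.
by under eq_bigr do rewrite -gprM1 //.
Qed.

Section Generators.
Variables (s : nat) (x : 'I_s -> gr I).
Hypothesis x_gen : ideal_gen (range x) =i gr_irrelevant I.

Lemma irrelevant_comb g : gpr 0 g = 0 -> exists q, g = \sum_i x i * q i.
Proof.
move=> /gr_irrelevantP; rewrite -x_gen => /asboolP h.
have idF := fam_ideal_is x (set0_ideal (gr I)).
have [L hL] := ideal_of idF.
have /hL[q /eqP] : g \in L.
  by apply: h => _ [i _ <-]; apply/hL; apply: fam_ideal_gen.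
by rewrite subr_eq0 => /eqP e; exists q.
Qed.

Lemma radical_gen : radical_of x.
Proof.
exists 1%N => -[//|n] g _ hg; have [|q ->] := irrelevant_comb (g := g).
  by apply: gr_piece_pr hg _.
by apply: fam_ideal_comb; apply: idl0.
Qed.
End Generators.

Definition mono t (Y : 'I_t -> gr I) (u : 'X_{1..t}) := \prod_i Y i ^+ u i.

Lemma mono_piece t (Y : 'I_t -> gr I) u : degree_one Y -> mono Y u \in gr_piece I (mdeg u)%:Z.
Proof.
move=> dY; rewrite mdegE /mono; elim: (index_enum _) => [|i r IH].
  by rewrite !big_nil -ini1; apply: ini_piece; rewrite pw0.
rewrite !big_cons PoszD; apply: gr_pieceM => //.
by have := gr_pieceX (u i) (dY i); rewrite mul1r.
Qed.

Lemma mono_ev t (Y : 'I_t -> gr I) u : pB (mono Y u) = mmap1 (pB \o Y) u.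
Proof. by rewrite rmorph_prod; apply: eq_bigr => i _; rewrite rmorphXn. Qed.

Lemma unit_const a : pK a != 0 -> exists b, P (gr_const I (b * a) - 1).
Proof.
move=> a0; have [b hb] := sK (pK a)^-1; exists b; apply/kB.
by rewrite rmorphB rmorph1 -kapE rmorphM -hb mulVf // rmorph1 subrr.
Qed.

(** The component of [F] in the degree of its leading monomial is nonzero and again a relation, [P]
    being homogeneous; its coefficients are lifted to [A]. *)
Lemma homogeneous_relation t (Y : 'I_t -> gr I) (F : {mpoly K[t]}) : degree_one Y -> F != 0 ->
  ev kap (pB \o Y) F = 0 ->
  exists d (r : seq 'X_{1..t}) (c : 'X_{1..t} -> A),
    [/\ forall u, u \in r -> mdeg u = d, P (\sum_(u <- r) gr_const I (c u) * mono Y u)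
      & \sum_(u <- r) pK (c u) *: 'X_[u] != 0 :> {mpoly K[t]}].
Proof.
move=> dY F0 e; have [al hal] := choice sK.
pose d := mdeg (mlead F).
exists d, [seq u <- msupp F | mdeg u == d], (fun u => al F@_u); split.
- by move=> u; rewrite mem_filter => /andP[/eqP].
- have PF : P (\sum_(u <- msupp F) gr_const I (al F@_u) * mono Y u).
    apply/kB; rewrite rmorph_sum -[RHS]e; apply: eq_bigr => u _.
    by rewrite rmorphM mono_ev -kapE -hal.
  have := homP d PF; rewrite gpr_sum big_filter [X in _ -> P X]big_mkcond.
  congr (P _); apply: eq_bigr => u _.
  have hu : gr_const I (al F@_u) * mono Y u \in gr_piece I (mdeg u)%:Z.
    by rewrite -[X in gr_piece I X]add0r; apply: gr_pieceM (gr_const_piece _ _) (mono_piece u dY).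
  case: eqP => [ud|/eqP ud]; first by rewrite gr_id // -ud.
  by apply: gr_piece_pr hu _; rewrite eq_sym eqz_nat.
apply/eqP => /(congr1 (mcoeff (mlead F))); rewrite mcoeff0 raddf_sum /= (bigD1_seq (mlead F)) /=.
- rewrite big1 ?addr0 => [|u ul]; last by rewrite mcoeffZ mcoeffX (negPf ul) mulr0.
  rewrite mcoeffZ mcoeffX eqxx mulr1 -hal => /eqP; rewrite mleadc_eq0; exact/negP.
- by rewrite mem_filter eqxx mlead_supp.
- by rewrite filter_uniq // msupp_uniq.
Qed.

Definition small_radical t := exists Y : 'I_t -> gr I, degree_one Y /\ radical_of Y.

(* A relation F(Y) = 0 with F(v) <> 0 and v_0 <> 0 makes a power of Y_0 a combination
   of the Y_j - (v_j / v_0) Y_0. *)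
Lemma dependent_reduce t (Y : 'I_t.+1 -> gr I) (F : {mpoly K[t.+1]}) : degree_one Y -> radical_of Y ->
  F != 0 -> ev kap (pB \o Y) F = 0 -> small_radical t.
Proof.
move=> dY [N radY] F0 e; have [d [r [c [rd Pr nz]]]] := homogeneous_relation dY F0 e.
set G := \sum_(u <- r) _ in nz.
(* The extra variable makes the zeroth coordinate of [v] nonzero as well. *)
have [v] : exists v, (G * 'X_ord0).@[v] != 0.
  apply: (mpoly_nonroot infK); apply: mulf_neq0 => //.
  by apply/eqP => /(congr1 (mcoeff U_(ord0))) /eqP; rewrite mcoeffX eqxx mcoeff0 oner_eq0.
rewrite mevalM mevalXU mulf_eq0 negb_or => /andP[Gv v0].
have [al hal] := choice sK.
pose a j := al (v j / v ord0).
pose Y' j := Y (lift ord0 j) - gr_const I (a (lift ord0 j)) * Y ord0.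
have dY' : degree_one Y'.
  move=> j; apply: gr_pieceD; first exact: dY.
  apply: gr_pieceN; rewrite -[X in gr_piece I X]add0r.
  exact: gr_pieceM (gr_const_piece _ _) (dY _).
pose fa := fam_ideal P Y'; have idfa : is_ideal fa := fam_ideal_is Y' idP.
have Pfa : P `<=` fa by apply: fam_ideal_sub.
have congY j : fa (Y j - gr_const I (a j) * Y ord0).
  have [j' ->|->] := unliftP ord0 j; first by apply: fam_ideal_gen; apply: idl0.
  apply: Pfa; rewrite -{1}[Y ord0]mul1r -mulrBl; apply: idlMr => //; apply/kB.
  by rewrite rmorphB rmorph1 -kapE -hal divff // rmorph1 subrr.
(* Modulo [Y'] every [Y i] is [a i] times [Y ord0], so the relation becomes [be] times a power of
   [Y ord0]; over [K], [be] is the value of [G] at [v] divided by a power of [v ord0]. *)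
pose be := \sum_(u <- r) c u * \prod_i a i ^+ u i.
have congm : fa (\sum_(u <- r) gr_const I (c u) * mono Y u - gr_const I be * Y ord0 ^+ d).
  rewrite /be rmorph_sum big_distrl /= -sumrB big_seq; apply: (idl_sum idfa) => u ur.
  rewrite rmorphM -mulrA -mulrBr; apply: (idlM idfa).
  have -> : gr_const I (\prod_i a i ^+ u i) * Y ord0 ^+ d =
      \prod_i (gr_const I (a i) * Y ord0) ^+ u i.
    under [RHS]eq_bigr do rewrite exprMn.
    rewrite big_split /= rmorph_prod -(rd u ur) mdegE expr_sum; congr (_ * _).
    by apply: eq_bigr => i _; rewrite rmorphXn.
  by apply: (cong_prod _ idfa) => i; apply: (cong_exp _ idfa).
have pbe : pK be != 0.
  have -> : pK be = G.@[v] / v ord0 ^+ d.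
    rewrite /be rmorph_sum /G raddf_sum big_distrl /= big_seq [RHS]big_seq.
    apply: eq_bigr => u ur; rewrite rmorphM rmorph_prod mevalZ mevalX -mulrA; congr (_ * _).
    rewrite -(rd u ur) mdegE expr_sum -prodfV -big_split /=; apply: eq_bigr => i _.
    by rewrite rmorphXn -hal expr_div_n.
  by rewrite mulf_neq0 // invr_eq0 expf_neq0.
have Y0d : fa (Y ord0 ^+ d).
  have h1 : fa (gr_const I be * Y ord0 ^+ d) by apply: (idlBl idfa congm); apply: Pfa.
  have [b /Pfa hb] := unit_const pbe.
  have -> : Y ord0 ^+ d = gr_const I b * (gr_const I be * Y ord0 ^+ d) -
      Y ord0 ^+ d * (gr_const I (b * be) - 1) by rewrite rmorphM; ring.
  by apply: (idlB idfa); apply: (idlM idfa).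
(* As long as [radY] applies, each degree of [g] yields a factor [Y ord0] modulo [fa]; taking out
   [d] of them finishes. *)
have red n g ee : g \in gr_piece I (n + ee)%N%:Z -> (N <= n.+1)%N -> (0 < ee)%N || (N <= n)%N ->
    exists u, u \in gr_piece I n%:Z /\ fa (g - Y ord0 ^+ ee * u).
  elim: ee n => [|ee IH] n hg Nn _.
    by exists g; rewrite addn0 in hg; rewrite expr0 mul1r subrr; split=> //; apply: idl0.
  have h1 : g \in gr_piece I (n.+1 + ee)%N%:Z by rewrite addSnnS.
  have h2 : (0 < ee)%N || (N <= n.+1)%N by rewrite Nn orbT.
  have [u [hu cu]] := IH n.+1 h1 (leqW Nn) h2.
  have [q [hq Pq]] := fam_ideal_hom dY hu (radY _ _ Nn hu).
  exists (\sum_i gr_const I (a i) * q i); split.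
    apply: gr_piece_sum => i _; rewrite -[X in gr_piece I X]add0r.
    exact: gr_pieceM (gr_const_piece _ _) (hq i).
  apply: (cong_trans idfa cu); rewrite exprSr -mulrA -mulrBr; apply: (idlM idfa).
  apply: (cong_trans idfa (Pfa _ Pq)); rewrite big_distrr /=.
  apply: (cong_sum _ _ idfa) => i; rewrite mulrA [Y ord0 * _]mulrC.
  by rewrite -mulrBl; apply: (idlMr idfa).
exists Y'; split=> //; exists (N + d)%N => n g Nn hg.
have [|||u [_ cu]] := red (n - d)%N g d.
- by rewrite subnK //; apply: leq_trans Nn; apply: leq_addl.
- by apply: leqW; rewrite leq_subRL ?(leq_trans _ Nn) ?leq_addl // addnC.
- by apply/orP; right; rewrite leq_subRL ?(leq_trans _ Nn) ?leq_addl // addnC.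
by apply: (idlBr idfa cu); apply: (idlMr idfa).
Qed.

Variables (s : nat) (x : 'I_s -> gr I).
Hypotheses (x_deg1 : degree_one x) (x_gen : ideal_gen (range x) =i gr_irrelevant I).
Hypothesis P_plus : forall N, exists n g, [/\ (N <= n)%N, g \in gr_piece I n%:Z & ~ P g].

(** A shortest family is independent, since a relation would shorten it; it is not empty because [P]
    misses elements of arbitrarily high degree. *)
Lemma normalization : exists t (Y : 'I_t -> gr I), [/\ (0 < t)%N, degree_one Y, radical_of Y
  & forall F, ev kap (pB \o Y) F = 0 -> F = 0].
Proof.
have ex : exists t, `[< small_radical t >] by exists s; apply/asboolP; exists x; split=> //; apply: radical_gen.
case: (ex_minnP ex) => t /asboolP[Y [dY radY]] tmin; exists t, Y; split=> //.
  case: t Y dY radY {tmin} => // Y dY [N radY].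
  have [n [g [Nn hg nP]]] := P_plus N; case: nP; have [q] := radY n g Nn hg.
  by rewrite big_ord0 subr0.
move=> F e; apply/eqP; apply: contraT => F0; case: t Y dY radY tmin F e F0 => [|t] Y dY radY tmin F e F0.
  have [d [r [c [rd Pr nz]]]] := homogeneous_relation dY F0 e.
  have all0 (u u' : 'X_{1..0}) : u = u' by apply/mnmP => -[].
  have hm := mlead_supp F0; have F1 : F = (F@_0)%:MP.
    by apply/mpolyP => u; rewrite (all0 u 0%MM) mcoeffC eqxx mulr1.
  move: e; rewrite F1 /ev mmapC => /eqP; rewrite fmorph_eq0 => /eqP c0.
  by move: F0; rewrite F1 c0 raddf0 eqxx.
by have /tmin := asboolT (dependent_reduce dY radY F0 e); rewrite ltnn.
Qed.

(** From degree [N] on, elements are combinations of the [Y i] with coefficients of one degree less,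
    so the forms of degree below [N] generate. *)
Lemma module_finite t (Y : 'I_t -> gr I) : degree_one Y -> radical_of Y ->
  exists v (g : 'I_v -> B), forall b, exists F : 'I_v -> {mpoly K[t]},
    b = \sum_i ev kap (pB \o Y) (F i) * g i.
Proof.
(* A positive [N] puts degree 0 among the generating degrees. *)
move=> dY [N0 radY0]; pose N := N0.+1.
have radY n f : (N <= n)%N -> f \in gr_piece I n%:Z -> fam_ideal P Y f by move=> /ltnW; apply: radY0.
have /choice[gs hgs] : forall n, exists L : seq A, pw I n = seq_ideal L.
  by move=> n; apply: noeth_fg => //; apply: pw_is.
pose L := flatten [seq [seq ini I n a | a <- gs n] | n <- iota 0 N].
pose g (i : 'I_(size L)) := pB L`_i; exists (size L), g.
pose V : set (gr I) := [set f | exists F : 'I_(size L) -> {mpoly K[t]},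
  pB f = \sum_i ev kap (pB \o Y) (F i) * g i].
have V0 f : P f -> V f.
  move=> /kB e; exists (fun=> 0); rewrite e big1 // => i _.
  by rewrite rmorph0 mul0r.
have VD f f' : V f -> V f' -> V (f + f').
  move=> [F e] [F' e']; exists (fun i => F i + F' i); rewrite rmorphD e e' -big_split.
  by apply: eq_bigr => i _; rewrite rmorphD mulrDl.
have VM H h f : pB h = ev kap (pB \o Y) H -> V f -> V (h * f).
  move=> eh [F e]; exists (fun i => H * F i); rewrite rmorphM eh e big_distrr.
  by apply: eq_bigr => i _; rewrite /= rmorphM mulrA.
have VS (T : Type) (r : seq T) (f : T -> gr I) : (forall i, V (f i)) -> V (\sum_(i <- r) f i).
  move=> hf; apply: (big_ind V) => //; apply: V0; exact: idl0.
have VL f : f \in L -> V f.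
  move=> fL; have hi : (index f L < size L)%N by rewrite index_mem.
  exists (fun i => if i == Ordinal hi then 1 else 0); rewrite (bigD1 (Ordinal hi)) //= eqxx.
  rewrite rmorph1 mul1r /g /= nth_index // big1 ?addr0 // => j /negPf ->.
  by rewrite rmorph0 mul0r.
have small n f : (n < N)%N -> f \in gr_piece I n%:Z -> V f.
  move=> nN /gr_piece_ini[a ha ->]; move: ha; suff : pw I n `<=` [set a | pw I n a /\ V (ini I n a)].
    by move=> h /h[].
  rewrite {1}hgs; apply: addis_min => [|_ ->|a' ha'].
  - split=> [|b c [hb Vb] [hc Vc]|b c [hc Vc]].
    + split; first by apply: idl0; apply: pw_is.
      by apply: V0; rewrite (ini0 (idl0 (pw_is _ _))).2; [apply: idl0|apply: idl0; apply: pw_is].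
    + by split; [apply: idlD => //; apply: pw_is|rewrite iniD //; apply: VD].
    + split; first by apply: idlM => //; apply: pw_is.
      rewrite -[n]add0n iniM ?pw0 // -ini_constE; apply: (VM (pK b)%:MP) => //.
      by rewrite /ev mmapC; apply: esym; apply: kapE.
  - split; first by apply: idl0; apply: pw_is.
    by apply: V0; rewrite (ini0 (idl0 (pw_is _ _))).2; [apply: idl0|apply: idl0; apply: pw_is].
  split; first by rewrite hgs; apply: addis_gen => //; apply: set0_ideal.
  apply: VL; apply/flatten_mapP; exists n; first by rewrite mem_iota.
  by apply/mapP; exists a'.
have Vn n f : f \in gr_piece I n%:Z -> V f.
  elim: n f => [|n IH] f hf; first exact: small hf.
  have [Nn|nN] := leqP N n.+1; last exact: small hf.
  have [q [hq Pq]] := fam_ideal_hom dY hf (radY _ _ Nn hf).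
  rewrite -[f](subrK (\sum_i Y i * q i)); apply: VD; first exact: V0.
  by apply: VS => i; apply: (VM 'X_i); [rewrite evX|apply: IH].
move=> b; have [f ->] := sB b; have [N' /(_ N' (leqnn _)) e] := gr_decomp f.
have [F hF] : V f by rewrite e; apply: VS => n; apply: Vn (gpr_piece _ _).
by exists F.
Qed.
End Normalization.

(** * Top local cohomology at a prime *)

Section TopClass.
Variables (G : comNzRingType) (nG : noeth G) (P : set G) (h : G).
Hypotheses (pP : prime_set P) (annh : forall a, a * h = 0 <-> P a).
Variables (K : fieldType) (B : comNzRingType) (pB : {rmorphism G -> B}) (kap : {rmorphism K -> B}).
Hypotheses (sB : forall b, exists a, b = pB a) (kB : forall a, pB a = 0 <-> P a).
Variables (t : nat) (y : 'I_t -> G).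
Local Notation D := {mpoly K[t]}.
Local Notation evB := (ev kap (pB \o y)).
Hypothesis ev_inj : forall F, evB F = 0 -> F = 0.
Variables (v : nat) (g : 'I_v -> B).
Hypothesis gen : forall b, exists F : 'I_v -> D, b = \sum_i evB (F i) * g i.

Lemma quot_domain (a b : B) : a * b = 0 -> a = 0 \/ b = 0.
Proof.
have [a' ->] := sB a; have [b' ->] := sB b; rewrite -rmorphM => /kB.
by case: pP => _ _ pM /pM[/kB|/kB]; [left|right].
Qed.

Let T : set G := [set f | exists F : D, F <> 0 /\ pB f = evB F].

Lemma T_mult : mult_set T.
Proof.
split; first by exists 1; rewrite !rmorph1; split=> //; apply/eqP/oner_neq0.
move=> f f' [F [F0 e]] [F' [F0' e']]; exists (F * F'); split; last by rewrite !rmorphM e e'.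
by apply/eqP; rewrite mulf_neq0 //; apply/eqP.
Qed.

(** Take [b] maximal with zero trace on the multiples of [h]. If [p ^+ n] is not in [b], some
    nonzero [c * h] equals w + a p^n with [w] in [b]; multiplying by [p] kills [c * h], so a p^(n+1)
    lies in [b], and once the colons by powers of [p] have stabilized so does a p^n. *)
Lemma disjoint_ideal : exists b : set G, [/\ is_ideal b, forall c, b (c * h) -> c * h = 0
  & forall p, P p -> exists n, b (p ^+ n)].
Proof.
have [||b [idb bh] bmax] := @noeth_max _
  [set b : set G | is_ideal b /\ forall c, b (c * h) -> c * h = 0] nG; first by move=> J [].
  by exists [set 0]; split; [exact: set0_ideal|].
exists b; split=> // p Pp.
have [n|n a|n hn] := nG (J := fun n => colon b (p ^+ n)).
- exact: colon_ideal.
- by rewrite /colon /= exprS mulrCA; apply: idlM.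
exists n; apply: contrapT => nb.
have [c [[w bw [a e]] ch]] : exists c, addi b (p ^+ n) (c * h) /\ c * h <> 0.
  apply: contrapT => hc; apply: nb; rewrite -(bmax (addi b (p ^+ n))).
  - by apply: addi_gen; apply: idl0.
  - split; first exact: addi_ideal.
    by move=> c hc'; apply: contrapT => c0; apply: hc; exists c.
  - exact: addi_sub.
apply: ch; apply: bh; rewrite e; apply: idlD => //.
have : colon b (p ^+ n.+1) a.
  have e2 : a * p ^+ n.+1 = c * (p * h) - p * w.
    by rewrite exprS mulrCA [c * _]mulrCA e; ring.
  rewrite /colon /= e2 (annh p).2 // mulr0 sub0r; apply: idlN => //; exact: idlM.
by rewrite (hn n.+1).
Qed.

Lemma span_lift (Q : pred 'I_t) N a : (exists q', pB a = \sum_(b | Q b) pB (y b) ^+ N * q' b) ->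
  exists q, P (a - \sum_(b | Q b) y b ^+ N * q b).
Proof.
move=> [q' e]; have [r hr] := choice sB; exists (fun b => r (q' b)); apply/kB.
rewrite rmorphB e rmorph_sum; apply/eqP; rewrite subr_eq0; apply/eqP.
by apply: eq_bigr => b _; rewrite rmorphM rmorphXn -hr.
Qed.

Lemma top_class : exists K0, forall l q, h * (\prod_i y i) ^+ l <> \sum_b y b ^+ (K0 + l) * q b.
Proof.
have [idP P1 PM] := pP; have [bb [idbb bbh nilP]] := disjoint_ideal.
(* If the class of [f * h] dies with coefficients in [L], then a fixed nonzero polynomial multiple
   of the class of [f] dies already in [B]. *)
pose Phi (L : set G) := exists2 sg : D, sg <> 0 & forall N f q, (forall b, L (q b)) ->
  f * h = \sum_b y b ^+ N * q b ->
  exists q', evB sg * pB f = \sum_b pB (y b) ^+ N * q' b.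
have [||L [idL sL PhiL] Lmax] := @noeth_max _
  [set L | [/\ is_ideal L, addi bb h `<=` L & Phi L]] nG; first by move=> J [].
  (* Modulo [bb] this ideal is a copy of [B], and the relation is read off from the multiples of
     [h]. *)
  exists (addi bb h); split=> //; first exact: addi_ideal.
  exists 1; first exact/eqP/oner_neq0.
  move=> N f q hq e.
  have /choice[c hc] : forall b, exists c, bb (q b - c * h).
    by move=> b; have [w bw [c ->]] := hq b; exists c; rewrite addrK.
  exists (fun b => pB (c b)); rewrite rmorph1 mul1r.
  apply/eqP; rewrite -subr_eq0.
  have -> : \sum_b pB (y b) ^+ N * pB (c b) = pB (\sum_b y b ^+ N * c b).
    by rewrite rmorph_sum; apply: eq_bigr => b _; rewrite rmorphM rmorphXn.
  rewrite -rmorphB; apply/eqP/kB/annh; apply: bbh.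
  rewrite mulrBl e big_distrl -sumrB; apply: idl_sum => // b _ /=.
  by rewrite -mulrA -mulrBr; apply: idlM.
have Lh : L h by apply: sL; apply: addi_gen; apply: idl0.
have bbL : bb `<=` L by apply: subset_trans sL; apply: addi_sub.
(* If [L] missed [T], it could be enlarged by some [z] for which the colon of [L] is exactly [P],
   that is by a copy of [B]. *)
have [f [Tf Lf]] : exists f, T f /\ L f.
  apply: contrapT => noT.
  have T1 := T_mult.1; have TM := T_mult.2.
  pose av z := forall f, T f -> ~ L (f * z).
  have [||C [z [avz CE]] Cmax] := @noeth_max _
    [set C : set G | exists z, av z /\ C = colon L z] nG.
  - by move=> _ [z [_ ->]]; apply: colon_ideal.
  - exists (colon L 1), 1; split=> // f Tf; rewrite mulr1 => Lf.
    by apply: noT; exists f.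
  have colmax w : av (w * z) -> colon L (w * z) = C.
    move=> hw; apply: Cmax; first by exists (w * z).
    by rewrite CE => a; rewrite /colon /= mulrCA; apply: idlM.
  (* Multiples of [z] satisfying [av] have the same colon as [z]. If [p * z] were outside [L], all
     [p ^+ n * z] would satisfy [av], although [P] is nilpotent modulo [bb]. *)
  have PC p : P p -> L (p * z).
    move=> Pp; have [[f [Tf Lf]]|nof] := pselect (exists f, T f /\ L (f * (p * z))).
      have /colmax e : av (f * z) by move=> f' Tf'; rewrite mulrA; apply: avz; apply: TM.
      suff : C p by rewrite CE.
      by rewrite -e /colon /= mulrCA.
    have avn n : av (p ^+ n * z).
      elim: n => [|n IH]; first by rewrite expr0 mul1r.
      move=> f Tf Lf; apply: nof; exists f; split=> //.
      suff : colon L z (f * p) by rewrite /colon /= mulrA.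
      by rewrite -CE -(colmax _ IH) /colon /= -mulrA [p * _]mulrA -exprS.
    have [n /bbL hn] := nilP p Pp.
    by case: (avn n 1 T1); rewrite mul1r; apply: idlMr.
  (* An element outside [P] has a multiple in [T], and no element of [T] carries [z] into [L]. *)
  have CP a : L (a * z) -> P a.
    move=> La; apply: contrapT => nPa.
    have pa0 : pB a <> 0 by move/kB.
    have [F [b' [F0 e]]] := multiple_in_ev quot_domain gen pa0.
    have [b hb] := sB b'; apply: (avz (a * b)); last by rewrite mulrAC; apply: idlMr.
    by exists F; rewrite rmorphM -hb.
  have zL : ~ L z by move=> Lz; apply: (avz 1 T1); rewrite mul1r.
  apply: zL; rewrite -(Lmax (addi L z)); [by apply: addi_gen; apply: idl0| |exact: addi_sub].
  split; [exact: addi_ideal|by apply: subset_trans sL _; apply: addi_sub|].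
  have [s1 s10 reg] := almost_regular gen.
  have [sg sg0 hsg] := PhiL; have [s1' hs1'] := sB (evB s1).
  exists (sg * s1 ^+ t); first by apply/eqP; rewrite mulf_neq0 ?expf_neq0 //; apply/eqP.
  move=> N f q hq e.
  have /choice[c hc] : forall b, exists c, L (q b - c * z).
    by move=> b; have [w Lw [c ->]] := hq b; exists c; rewrite addrK.
  (* Relations between the [y b ^+ N] modulo [P] are resolved from the last index down, as for a
     regular sequence. Each use of [almost_regular] costs a factor [s1], and the errors in [P] carry
     [z] into [L]. *)
  have step j : (j <= t)%N -> forall c, P (\sum_(b : 'I_t | (b < j)%N) y b ^+ N * c b) ->
      exists q, (forall b, L (q b)) /\
        s1' ^+ j * (\sum_(b : 'I_t | (b < j)%N) y b ^+ N * c b) * z = \sum_b y b ^+ N * q b.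
    elim: j => [|j IH] jt c' Pc.
      exists (fun=> 0); split=> [b|]; first exact: idl0.
      by rewrite big_pred0 // mulr0 mul0r big1 // => b _; rewrite mulr0.
    pose j' := Ordinal jt.
    have spl (u : 'I_t -> G) : \sum_(b : 'I_t | (b < j.+1)%N) u b =
        u j' + \sum_(b : 'I_t | (b < j)%N) u b.
      rewrite (bigD1 j') //=; congr (_ + _); apply: eq_bigl => b.
      by rewrite ltnS -val_eqE /= ltn_neqAle andbC.
    have [] := reg N (fun b : 'I_t => (b < j)%N) j' (pB (c' j')) (fun b => - pB (c' b)).
    - by rewrite /= ltnn.
    - have /kB := Pc; rewrite spl rmorphD rmorphM rmorphXn /= => /eqP.
      rewrite addr_eq0 => /eqP ->; rewrite rmorph_sum -sumrN; apply: eq_bigr => b _.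
      by rewrite rmorphM rmorphXn mulrN.
    rewrite hs1' -rmorphM => q0 eq0.
    have [kp Pkp] := span_lift (ex_intro _ q0 eq0).
    set p := s1' * c' j' - _ in Pkp.
    pose c2 b := s1' * c' b + y j' ^+ N * kp b.
    have e2 : s1' * (\sum_(b : 'I_t | (b < j.+1)%N) y b ^+ N * c' b) =
        \sum_(b : 'I_t | (b < j)%N) y b ^+ N * c2 b + y j' ^+ N * p.
      rewrite spl /p /c2.
      under [X in _ = X + _]eq_bigr do rewrite mulrDr mulrCA [X in _ + X]mulrCA.
      by rewrite big_split /= -!big_distrr /=; ring.
    have [|q2 [Lq2 eq2]] := IH (ltnW jt) c2.
      apply: (idlBr idP (b := s1' * (\sum_(b : 'I_t | (b < j.+1)%N) y b ^+ N * c' b))).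
        by rewrite e2 opprD addrA subrr sub0r; apply: (idlN idP); apply: (idlM idP).
      exact: (idlM idP).
    exists (fun b => q2 b + (if b == j' then s1' ^+ j * p * z else 0)); split=> [b|].
      apply: idlD => //; case: ifP => _; last exact: idl0.
      by rewrite -mulrA; apply: idlM => //; apply: PC.
    rewrite exprSr -!mulrA [s1' * (_ * _)]mulrA e2 mulrDl mulrDr mulrA eq2.
    under [RHS]eq_bigr do rewrite mulrDr.
    rewrite big_split /=; congr (_ + _).
    rewrite (bigD1 j') //= eqxx big1 ?addr0 => [|b /negPf ->]; last by rewrite mulr0.
    by ring.
  pose S := \sum_b y b ^+ N * c b.
  have eS : f * h = \sum_b y b ^+ N * (q b - c b * z) + S * z.
    rewrite e big_distrl -big_split; apply: eq_bigr => b _ /=; by ring.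
  have PS : P S.
    apply: CP; have -> : S * z = f * h - \sum_b y b ^+ N * (q b - c b * z) by rewrite eS addrC addKr.
    apply: idlB => //; first exact: idlM.
    by apply: idl_sum => // b _; apply: idlM.
  have ltS : \sum_(b : 'I_t | (b < t)%N) y b ^+ N * c b = S.
    by apply: eq_bigl => b; rewrite ltn_ord.
  have [|qq [Lqq eqq]] := step t (leqnn t) c; first by rewrite ltS.
  rewrite ltS in eqq.
  have [||q' eq'] := hsg N (s1' ^+ t * f) (fun b => s1' ^+ t * (q b - c b * z) + qq b).
  - by move=> b; apply: idlD => //; apply: idlM.
  - rewrite -mulrA eS mulrDr mulrA eqq big_distrr -big_split; apply: eq_bigr => b _ /=; by ring.
  by exists q'; rewrite -eq' !rmorphM !rmorphXn /= hs1' mulrA.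
(* Multiplication by [f] moves the coefficients of any relation into [L], so the nonzero class of
   [sg * F] in [B] would have to vanish. *)
have [F [F0 eF]] := Tf; have [sg sg0 hsg] := PhiL.
have sF0 : sg * F <> 0 by apply/eqP; rewrite mulf_neq0 //; apply/eqP.
have [K0 hK0] := top_class_nonzero ev_inj gen sF0; exists K0 => l q e.
have [||q' eq'] := hsg (K0 + l)%N (f * (\prod_i y i) ^+ l) (fun b => f * q b).
- by move=> b; apply: idlMr.
- rewrite -mulrA [_ * h]mulrC e big_distrr; apply: eq_bigr => b _; by rewrite /= mulrCA.
apply: (hK0 l q'); rewrite -eq' rmorphM eF mulrA -rmorphM; congr (_ * _).
by rewrite rmorphXn rmorph_prod.
Qed.

End TopClass.

(** * Contractions of Koszul cocycles *)

Section Koszul.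
Variables (R : comNzRingType) (s : nat).
Local Notation cochain := ({set 'I_s} -> R).
Implicit Types (a x y : 'I_s -> R) (c : cochain) (S : {set 'I_s}).
Local Open Scope set_scope.

Definition ksign (j : 'I_s) (S : {set 'I_s}) : R := (-1) ^+ #|[set k in S | (k < j)%N]|.
Definition dotp a x : R := \sum_j a j * x j.

Lemma ksign_sq j S : ksign j S * ksign j S = 1.
Proof. by rewrite /ksign -expr2 sqrr_sign. Qed.

Lemma ksignU1 j k S : k \notin S -> ksign j (k |: S) = (if (k < j)%N then -1 else 1) * ksign j S.
Proof.
move=> kS; rewrite /ksign; case: ifP => kj; rewrite ?mul1r.
  have -> : [set i in k |: S | (i < j)%N] = k |: [set i in S | (i < j)%N].
    by apply/finset.setP => i; rewrite !inE; case: eqP => [->|_] //=; rewrite kj.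
  by rewrite cardsU1 inE (negPf kS) /= exprS.
congr (_ ^+ #|pred_of_set _|); apply/finset.setP => i; rewrite !inE.
by case: eqP => [->|_] //=; rewrite kj andbF.
Qed.

Lemma ksignD1 j k S : k \in S -> ksign j S = (if (k < j)%N then -1 else 1) * ksign j (S :\ k).
Proof. by move=> kS; rewrite -{1}(finset.setD1K kS) ksignU1 // !inE eqxx. Qed.

Lemma ksignD1_self j S : ksign j (S :\ j) = ksign j S.
Proof.
have [jS|jS] := boolP (j \in S); first by rewrite (ksignD1 _ jS) ltnn mul1r.
congr (_ ^+ #|pred_of_set _|); apply/finset.setP => i; rewrite !inE.
by case: eqP => [->|_] //=; rewrite (negPf jS).
Qed.

(* A cochain lists the coordinates of an element of the exterior algebra in the basis e_S;
   kd x is the product with x on the left, and iota_op a the contraction with the linear form a. *)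
Definition iota_op a c : cochain := fun S => \sum_(j | j \notin S) ksign j S * (a j * c (j |: S)).
Definition kd x c : cochain := fun S => \sum_(j in S) ksign j S * (x j * c (S :\ j)).

(** The terms that insert and remove the same index add up to [dotp a x]; those that insert [j] and
    remove [i] cancel in pairs. *)
Lemma iota_kd a x c S : iota_op a (kd x c) S + kd x (iota_op a c) S = dotp a x * c S.
Proof.
have e1 : iota_op a (kd x c) S = \sum_(j | j \notin S) (a j * x j * c S +
    \sum_(i in S) ksign j S * ksign i (j |: S) * (a j * x i * c (j |: (S :\ i)))).
  apply: eq_bigr => j jS; rewrite /kd big_setU1 //= mulrDr mulrDr; congr (_ + _).
    rewrite finset.setU1K // ksignU1 // ltnn mul1r.
    have -> : ksign j S * (a j * (ksign j S * (x j * c S))) =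
      ksign j S * ksign j S * (a j * x j * c S) by ring.
    by rewrite ksign_sq mul1r.
  rewrite !big_distrr /=; apply: eq_bigr => i iS.
  have -> : (j |: S) :\ i = j |: (S :\ i).
    apply/finset.setP => k; rewrite !inE; have [->|_] //= := eqVneq k j.
    by rewrite andbT; apply: contraNneq jS => ->.
  by ring.
have e2 : kd x (iota_op a c) S = \sum_(i in S) (a i * x i * c S +
    \sum_(j | j \notin S) ksign i S * ksign j (S :\ i) * (a j * x i * c (j |: (S :\ i)))).
  apply: eq_bigr => i iS; rewrite /iota_op (bigD1 i) /=; last by rewrite !inE eqxx.
  rewrite !mulrDr; congr (_ + _).
    rewrite finset.setD1K // ksignD1_self.
    have -> : ksign i S * (x i * (ksign i S * (a i * c S))) =
      ksign i S * ksign i S * (a i * x i * c S) by ring.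
    by rewrite ksign_sq mul1r.
  rewrite !big_distrr /=; apply: eq_big => [j|j _]; last by ring.
  by rewrite !inE negb_and negbK; have [->|_] := eqVneq j i; rewrite ?iS ?andbT /= ?andbF.
rewrite e1 e2 !big_split /= [X in _ + X + _]exchange_big /=.
rewrite addrACA -big_split /= [X in _ + X]big1 ?addr0; last first.
  move=> i iS; rewrite -big_split big1 //= => j jS.
  rewrite -mulrDl ksignU1 // (ksignD1 j iS).
  have ij : i != j by apply: contraNneq jS => <-.
  by case: (ltngtP (val i) (val j)) => [_|_|/val_inj e]; [ring|ring|rewrite e eqxx in ij].
rewrite /dotp big_distrl /= addrC [RHS](bigID (mem S)) /=.
by [].
Qed.

Lemma kd_iota a x c S : iota_op a (kd x c) S = dotp a x * c S - kd x (iota_op a c) S.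
Proof. by rewrite -(iota_kd a x c S) addrK. Qed.

Lemma kd_kd_expand x y c S : kd x (kd y c) S =
  \sum_(i in S) \sum_(j in S | j != i) ksign i S * ksign j (S :\ i) * (x i * y j * c (S :\ i :\ j)).
Proof.
apply: eq_bigr => i iS; rewrite /kd !big_distrr /=.
apply: eq_big => [j|j _]; first by rewrite !inE andbC.
by ring.
Qed.

Lemma ksign_anti i j S : i \in S -> j \in S -> i != j ->
  ksign i S * ksign j (S :\ i) = - (ksign j S * ksign i (S :\ j)).
Proof.
move=> iS jS ij; rewrite (ksignD1 i jS) (ksignD1 j iS).
by case: (ltngtP (val i) (val j)) => [_|_|/val_inj e]; [ring|ring|rewrite e eqxx in ij].
Qed.

Lemma kd_anti x y c S : kd x (kd y c) S = - kd y (kd x c) S.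
Proof.
rewrite !kd_kd_expand -sumrN (exchange_big_dep (mem S)) /=; last by move=> i j _ /andP[].
apply: eq_bigr => j jS; rewrite -sumrN; apply: eq_big => [i|i /andP[iS /andP[_ ij]]].
  by rewrite jS eq_sym.
have ij' : i != j by rewrite eq_sym.
rewrite (ksign_anti iS jS ij') mulNr; congr (- (_ * (_ * c _))); first exact: mulrC.
by apply/finset.setP => k; rewrite !inE andbCA.
Qed.

(** Since 2 may be a zero divisor, opposite pairs are matched through an order and the diagonal is
    required to vanish. *)
Lemma antisym_sum0 (J : finType) (f : J -> J -> R) (lt : rel J) :
  (forall i j, i != j -> lt i j = ~~ lt j i) -> (forall i j, f i j = - f j i) ->
  (forall i, f i i = 0) -> \sum_i \sum_j f i j = 0.
Proof.
move=> ltP fa f0.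
have e : \sum_i \sum_(j | (j != i) && ~~ lt i j) f i j = - \sum_i \sum_(j | (j != i) && lt i j) f i j.
  rewrite (exchange_big_dep xpredT) //= -sumrN; apply: eq_bigr => j _; rewrite -sumrN.
  apply: eq_big => [i|i _]; last exact: fa.
  by rewrite eq_sym; case: eqP => //= /eqP ij; rewrite -ltP // eq_sym.
transitivity (\sum_i (\sum_(j | (j != i) && lt i j) f i j + \sum_(j | (j != i) && ~~ lt i j) f i j)).
  apply: eq_bigr => i _; rewrite (bigD1 i) //= f0 add0r (bigID (lt i)) /=.
  by [].
by rewrite big_split /= e subrr.
Qed.

Lemma kd_sq x c S : kd x (kd x c) S = 0.
Proof.
rewrite kd_kd_expand big_mkcond /=.
pose f i j := if [&& i \in S, j \in S & j != i] then
  ksign i S * ksign j (S :\ i) * (x i * x j * c (S :\ i :\ j)) else 0.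
transitivity (\sum_i \sum_j f i j).
  apply: eq_bigr => i _; rewrite /f; case: ifP => iS; last by rewrite big1.
  by rewrite big_mkcond.
apply: (antisym_sum0 (lt := fun i j : 'I_s => (i < j)%N)) => [i j ij|i j|i].
- by rewrite -leqNgt ltn_neqAle ij.
- rewrite /f; case: (boolP (i \in S)) => iS; case: (boolP (j \in S)) => jS /=; rewrite ?oppr0 //.
  rewrite eq_sym; case: ifP => [ij|_]; rewrite ?oppr0 //.
  rewrite (ksign_anti iS jS) // mulNr; congr (- (_ * (_ * c _))); first exact: mulrC.
  by apply/finset.setP => k; rewrite !inE andbCA.
- by rewrite /f eqxx !andbF.
Qed.

Lemma kd_ext x c c' S : (forall U, c U = c' U) -> kd x c S = kd x c' S.
Proof. by move=> h; apply: eq_bigr => j _; rewrite h. Qed.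
Lemma kd_lin x u c c' S : kd x (fun U => u * c U + c' U) S = u * kd x c S + kd x c' S.
Proof.
rewrite /kd big_distrr -big_split; apply: eq_bigr => j _ /=; by ring.
Qed.
Lemma iota_lin a u c c' S : iota_op a (fun U => u * c U + c' U) S = u * iota_op a c S + iota_op a c' S.
Proof.
rewrite /iota_op big_distrr -big_split; apply: eq_bigr => j _ /=; by ring.
Qed.

Lemma kd_sum (T : Type) (r : seq T) x (u : T -> R) (c : T -> cochain) S :
  kd x (fun U => \sum_(i <- r) u i * c i U) S = \sum_(i <- r) u i * kd x (c i) S.
Proof.
elim: r => [|i r IH]; first by rewrite big_nil /kd big1 // => j _; rewrite big_nil !mulr0.
rewrite big_cons -IH -kd_lin; apply: kd_ext => U; by rewrite big_cons.
Qed.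

Lemma kd_comb (T : Type) (r : seq T) (x : 'I_s -> R) (u : T -> R) (ga : T -> 'I_s -> R) c S :
  (forall j, x j * c (S :\ j) = \sum_(i <- r) u i * ga i j * c (S :\ j)) ->
  kd x c S = \sum_(i <- r) u i * kd (ga i) c S.
Proof.
move=> h; rewrite /kd.
under [RHS]eq_bigr do rewrite big_distrr /=.
rewrite exchange_big /=; apply: eq_bigr => j _; rewrite h big_distrr /=.
by apply: eq_bigr => i _; ring.
Qed.

Lemma kd_set0 x c : kd x c finset.set0 = 0.
Proof. by rewrite /kd big1 // => j; rewrite inE. Qed.

Lemma kd_set1 x c j : kd x c [set j] = x j * c finset.set0.
Proof.
rewrite /kd big_set1; have -> : [set j] :\ j = finset.set0 by apply/finset.setP => i; rewrite !inE andNb.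
rewrite /ksign; have -> : [set k in [set j] | (k < j)%N] = finset.set0.
  by apply/finset.setP => i; rewrite !inE; case: eqP => // ->; rewrite ltnn.
by rewrite cards0 mul1r.
Qed.

(** On a cochain of degree [n], the value at the empty set is its pairing with the product of the
    rows. *)
Fixpoint contr n : ('I_n -> 'I_s -> R) -> cochain -> cochain :=
  if n is n'.+1 then fun Q c => contr (fun i => Q (lift ord0 i)) (iota_op (Q ord0) c)
  else fun _ c => c.

Lemma contr_ext n (Q Q' : 'I_n -> 'I_s -> R) c c' S : (forall i j, Q i j = Q' i j) ->
  (forall U, c U = c' U) -> contr Q c S = contr Q' c' S.
Proof.
elim: n Q Q' c c' => [|n IH] Q Q' c c' hQ hc //=; apply: IH => [i j|U]; first exact: hQ.
by apply: eq_bigr => j _; rewrite hQ hc.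
Qed.

Lemma contr_lin n (Q : 'I_n -> 'I_s -> R) u c c' S :
  contr Q (fun U => u * c U + c' U) S = u * contr Q c S + contr Q c' S.
Proof.
elim: n Q c c' => [|n IH] Q c c' //=; rewrite -IH; apply: contr_ext => // U.
exact: iota_lin.
Qed.

Lemma contr_scale n (Q : 'I_n -> 'I_s -> R) u c S : contr Q (fun U => u * c U) S = u * contr Q c S.
Proof.
elim: n Q c => [|n IH] Q c //=; rewrite -IH; apply: contr_ext => // U.
by rewrite /iota_op big_distrr; apply: eq_bigr => j _ /=; ring.
Qed.

Lemma contr_sum (T : Type) (r : seq T) n (Q : 'I_n -> 'I_s -> R) (u : T -> R) (c : T -> cochain) S :
  contr Q (fun U => \sum_(i <- r) u i * c i U) S = \sum_(i <- r) u i * contr Q (c i) S.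
Proof.
elim: r => [|i r IH].
  rewrite big_nil -[RHS](mul0r (contr Q (fun=> 0) S)) -contr_scale.
  by apply: contr_ext => // U; rewrite big_nil mul0r.
by rewrite big_cons -IH -contr_lin; apply: contr_ext => // U; rewrite big_cons.
Qed.

Lemma contr_row n (Q Q1 Q2 : 'I_n -> 'I_s -> R) r c S :
  (forall i, i != r -> forall j, Q i j = Q1 i j /\ Q i j = Q2 i j) ->
  (forall j, Q r j = Q1 r j - Q2 r j) -> contr Q c S = contr Q1 c S - contr Q2 c S.
Proof.
elim: n Q Q1 Q2 r c => [|n IH] Q Q1 Q2 r c; first by case: r.
move=> h hr /=; have [r'|] := unliftP ord0 r => er; last first.
  have h1 i j : Q (lift ord0 i) j = Q1 (lift ord0 i) j.
    by have [] := h (lift ord0 i) _ j; rewrite // er.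
  have h2 i j : Q (lift ord0 i) j = Q2 (lift ord0 i) j.
    by have [] := h (lift ord0 i) _ j; rewrite // er.
  rewrite -[X in X - _](contr_ext (c := iota_op (Q1 ord0) c) _ h1) //.
  rewrite -[X in _ - X](contr_ext (c := iota_op (Q2 ord0) c) _ h2) //.
  rewrite -mulN1r addrC -contr_lin; apply: contr_ext => // U.
  rewrite /iota_op big_distrr -big_split; apply: eq_bigr => j _ /=.
  by rewrite -er hr; ring.
have h0 j : Q ord0 j = Q1 ord0 j /\ Q ord0 j = Q2 ord0 j by apply: h; rewrite er.
rewrite -[X in X - _](contr_ext (c := iota_op (Q ord0) c) _ (fun _ _ => erefl)); last first.
  by move=> U; apply: eq_bigr => j _; rewrite (h0 j).1.
rewrite -[X in _ - X](contr_ext (c := iota_op (Q ord0) c) _ (fun _ _ => erefl)); last first.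
  by move=> U; apply: eq_bigr => j _; rewrite (h0 j).2.
apply: (IH _ _ _ r') => [i ir j|j]; last by rewrite -er.
by apply: h; rewrite er; apply: contraNneq ir => /lift_inj ->.
Qed.

(** Raising the level of numerators multiplies them by such powers; the factor can be carried by the
    rows instead. *)
Lemma contr_pow n (Q : 'I_n -> 'I_s -> R) (u : 'I_s -> R) l c S :
  contr Q (fun U => (\prod_(j in U) u j) ^+ l * c U) S =
  (\prod_(j in S) u j) ^+ l * contr (fun i j => Q i j * u j ^+ l) c S.
Proof.
elim: n Q c => [|n IH] Q c //=; rewrite -IH; apply: contr_ext => // U.
rewrite /iota_op big_distrr; apply: eq_bigr => j jU /=.
by rewrite big_setU1 //= exprMn; ring.
Qed.

(** By [kd_iota] each contraction anticommutes with [kd x] up to a multiple of [dotp (Q i) x], which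
    is in [J]. *)
Lemma contr_kd (J : set R) n (Q : 'I_n -> 'I_s -> R) x c S : is_ideal J ->
  (forall i, J (dotp (Q i) x)) -> J (contr Q (kd x c) S - (-1) ^+ n * kd x (contr Q c) S).
Proof.
move=> idJ; elim: n Q c => [|n IH] Q c hQ; first by rewrite mul1r subrr; apply: idl0.
rewrite /= exprS mulN1r mulNr opprK.
have -> : contr (fun i => Q (lift ord0 i)) (iota_op (Q ord0) (kd x c)) S =
    dotp (Q ord0) x * contr (fun i => Q (lift ord0 i)) c S -
    contr (fun i => Q (lift ord0 i)) (kd x (iota_op (Q ord0) c)) S.
  rewrite -contr_scale -[X in _ - X]mul1r -mulNr addrC -contr_lin.
  by apply: contr_ext => // U; rewrite kd_iota mulN1r addrC.
rewrite -addrA; apply: idlD => //; first exact: idlMr.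
rewrite addrC -opprB; apply: idlN => //.
by apply: (IH (fun i => Q (lift ord0 i)) (iota_op (Q ord0) c)) => i; apply: hQ.
Qed.

Lemma contr_coboundary (J : set R) n (Q : 'I_n -> 'I_s -> R) x b : is_ideal J ->
  (forall i, J (dotp (Q i) x)) -> J (contr Q (kd x b) finset.set0).
Proof.
by move=> idJ /(contr_kd b finset.set0 idJ); rewrite kd_set0 mulr0 subr0.
Qed.

(** This is [contr_kd] at a one-element set, where [kd x] is multiplication by [x j]. *)
Lemma contr_cocycle (J : set R) n (Q : 'I_n -> 'I_s -> R) x c j : is_ideal J ->
  (forall i, J (dotp (Q i) x)) -> (forall S, kd x c S = 0) -> J (x j * contr Q c finset.set0).
Proof.
move=> idJ hQ hc; have := contr_kd c [set j] idJ hQ.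
have -> : contr Q (kd x c) [set j] = 0.
  rewrite -[RHS](mul0r (contr Q (fun=> 0) [set j])) -contr_scale.
  by apply: contr_ext => // U; rewrite hc mul0r.
rewrite kd_set1 sub0r => /(idlN idJ); rewrite opprK => /(idlM idJ ((-1) ^+ n)).
by rewrite mulrA -expr2 sqrr_sign mul1r.
Qed.

Definition kdelta (z : R) : cochain := fun S => if S == finset.set0 then z else 0.

Fixpoint wedge n : ('I_n -> 'I_s -> R) -> R -> cochain :=
  if n is n'.+1 then fun ga z => kd (ga ord0) (wedge (fun i => ga (lift ord0 i)) z)
  else fun _ z => kdelta z.

Lemma wedge_ext n (ga ga' : 'I_n -> 'I_s -> R) z S : (forall i j, ga i j = ga' i j) ->
  wedge ga z S = wedge ga' z S.
Proof.
elim: n ga ga' S => [|n IH] ga ga' S h //=.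
rewrite /kd; apply: eq_bigr => j _; rewrite h; congr (_ * (_ * _)).
by apply: IH => i k; apply: h.
Qed.

Lemma wedge_scale n (ga : 'I_n -> 'I_s -> R) u z S : wedge ga (u * z) S = u * wedge ga z S.
Proof.
elim: n ga S => [|n IH] ga S /=; first by rewrite /kdelta; case: ifP; rewrite ?mulr0.
by rewrite /kd big_distrr; apply: eq_bigr => j _; rewrite IH /=; ring.
Qed.

Lemma wedge_supp n (ga : 'I_n -> 'I_s -> R) z S : #|S| != n -> wedge ga z S = 0.
Proof.
elim: n ga S => [|n IH] ga S /=; first by rewrite /kdelta cards_eq0 => /negPf ->.
move=> hS; rewrite /kd big1 // => j jS; rewrite IH ?mulr0 //.
by move: hS; rewrite (cardsD1 j S) jS add1n eqSS.
Qed.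

Lemma iota_delta a z S : iota_op a (kdelta z) S = 0.
Proof.
rewrite /iota_op big1 // => j jS; rewrite /kdelta; case: eqP => [e|_]; last by rewrite !mulr0.
by have := finset.setU11 j S; rewrite e inE.
Qed.

Lemma iota_wedge n a (ga : 'I_n.+1 -> 'I_s -> R) z S : iota_op a (wedge ga z) S =
  \sum_(i < n.+1) (-1) ^+ i * dotp a (ga i) * wedge (fun j => ga (lift i j)) z S.
Proof.
elim: n ga S => [|n IH] ga S.
  rewrite big_ord1 /= kd_iota (@kd_ext _ _ (fun=> 0)) => [|U]; last exact: iota_delta.
  by rewrite /kd big1 ?subr0 ?mul1r // => j _; rewrite !mulr0.
rewrite [LHS]kd_iota big_ord_recl mul1r; congr (_ + _).
transitivity (- kd (ga ord0) (fun U => \sum_(i < n.+1) (-1) ^+ i *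
    dotp a (ga (lift ord0 i)) * wedge (fun j => ga (lift ord0 (lift i j))) z U) S).
  by congr (- _); apply: kd_ext => U; apply: (IH (fun i => ga (lift ord0 i))).
rewrite kd_sum -sumrN; apply: eq_bigr => i _.
rewrite lift0 exprS mulN1r !mulNr; congr (- (_ * _)); congr (kd _ _ _).
  by congr ga; apply: val_inj.
apply/funext => U; apply: wedge_ext => j l; congr (ga _ _); apply: val_inj => /=.
by rewrite /bump /= ltnS; case: leqP.
Qed.

(** The expansion in [iota_wedge] is the Laplace expansion along the first row. *)
Lemma contr_wedge n (Q ga : 'I_n -> 'I_s -> R) z :
  contr Q (wedge ga z) finset.set0 = \det (\matrix_(i, j) dotp (Q i) (ga j)) * z.
Proof.
elim: n Q ga => [|n IH] Q ga.
  by rewrite det_mx00 mul1r /= /kdelta eqxx.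
rewrite [LHS](contr_ext (Q' := fun i => Q (lift ord0 i)) _ _ (iota_wedge _ _ _)) //.
rewrite contr_sum (expand_det_row _ ord0) big_distrl /=; apply: eq_bigr => i _.
rewrite IH !mxE /cofactor add0n mulrA [_ * dotp _ _]mulrC -!mulrA; congr (_ * (_ * (\det _ * _))).
by apply/matrixP => j l; rewrite !mxE.
Qed.

Lemma kd_wedge_self n (ga : 'I_n -> 'I_s -> R) z i S : kd (ga i) (wedge ga z) S = 0.
Proof.
elim: n ga i S => [|n IH] ga i S; first by case: i.
case: (unliftP ord0 i) => [i' ->|->] /=; last exact: kd_sq.
rewrite kd_anti (@kd_ext _ _ (fun=> 0)) => [|U]; last exact: (IH (fun i => ga (lift ord0 i))).
by rewrite /kd big1 ?oppr0 // => j _; rewrite !mulr0.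
Qed.

End Koszul.

(** * Numerators of polynomials in 1 / u *)

Section Numerators.
Variable R : comNzRingType.
Implicit Types (p q : {poly R}) (u a : R).

(* u ^+ k times the value of p at 1 / u. *)
Definition numer k p u : R := \sum_(j < k.+1) p`_j * u ^+ (k - j).

Lemma numer_mono k j a u : (j <= k)%N -> numer k (a *: 'X^j) u = a * u ^+ (k - j).
Proof.
move=> jk; rewrite /numer (bigD1 (Ordinal (jk : (j < k.+1)%N))) //= coefZ coefXn eqxx mulr1.
rewrite [X in _ + X = _]big1 ?addr0 // => i; rewrite -val_eqE /= => /negPf ij.
by rewrite coefZ coefXn ij mulr0 mul0r.
Qed.

Lemma numerD k p q u : numer k (p + q) u = numer k p u + numer k q u.
Proof. by rewrite /numer -big_split; apply: eq_bigr => j _; rewrite coefD mulrDl. Qed.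

Lemma numerZ k a p u : numer k (a *: p) u = a * numer k p u.
Proof. by rewrite /numer big_distrr; apply: eq_bigr => j _ /=; rewrite coefZ mulrA. Qed.

Lemma numer0 k u : numer k 0 u = 0.
Proof. by rewrite -(scale0r 0) numerZ mul0r. Qed.

Lemma numerN k p u : numer k (- p) u = - numer k p u.
Proof. by rewrite -scaleN1r numerZ mulN1r. Qed.

Lemma numer_up k l p u : (size p <= k.+1)%N -> numer (k + l) p u = u ^+ l * numer k p u.
Proof.
move=> sp; rewrite /numer (big_ord_widen_cond (k + l).+1 xpredT (fun j => p`_j * u ^+ (k - j))) ?leq_addr //.
rewrite big_distrr (bigID (fun j : 'I__ => (j < k.+1)%N)) /= [X in _ + X]big1 ?addr0 => [|j].
  apply: eq_bigr => j jk; rewrite mulrCA -exprD; congr (_ * _ ^+ _).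
  by move: jk; move: (nat_of_ord j) => i; lia.
by rewrite -leqNgt => kj; rewrite nth_default ?mul0r // (leq_trans sp).
Qed.

(** The sum telescopes, and its last term vanishes because [q] has no coefficient at [k]. *)
Lemma numer_null k q u : (size q <= k)%N -> numer k (q * (u *: 'X - 1)) u = 0.
Proof.
move=> sq; have e j : (q * (u *: 'X - 1))`_j = (if j is j'.+1 then u * q`_j' else 0) - q`_j.
  by rewrite mulrBr mulr1 -scalerAr coefB coefZ coefMX; case: j => [|j] /=; rewrite ?mulr0.
have {e} : forall n, (n <= k)%N -> \sum_(j < n.+1) (q * (u *: 'X - 1))`_j * u ^+ (k - j) = - (q`_n * u ^+ (k - n)).
  elim=> [_|n IH nk]; first by rewrite big_ord1 e sub0r mulNr.
  rewrite big_ord_recr IH ?(ltnW nk) //= e mulrBl; have -> : (k - n)%N = (k - n.+1).+1 by lia.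
  by rewrite exprS; ring.
by move=> /(_ k (leqnn k)); rewrite nth_default // mul0r oppr0.
Qed.

(** The effect on numerators of the restriction map between localizations in the Cech complex. *)
Lemma numer_comp k p u a : numer k (p \Po (a *: 'X)) (a * u) = a ^+ k * numer k p u.
Proof.
have e j : (p \Po (a *: 'X))`_j = a ^+ j * p`_j.
  rewrite comp_polyE coef_sum (eq_bigr (fun i : 'I_(size p) => if i == j :> nat then a ^+ j * p`_j else 0)).
    rewrite -big_mkcond; have [sp|sp] := leqP (size p) j.
      by rewrite nth_default // mulr0 big1.
    by rewrite (big_pred1 (Ordinal sp)) // => i; rewrite -val_eqE.
  move=> i _; rewrite exprZn !coefZ coefXn [j == _]eq_sym; case: eqP => [->|_].
    by rewrite mulr1 mulrC.
  by rewrite !mulr0.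
rewrite /numer big_distrr; apply: eq_bigr => j _ /=; rewrite e exprMn mulrACA -exprD subnKC.
  by [].
by rewrite -ltnS.
Qed.

End Numerators.

(** * Restriction of scalars *)

Section RestrictScalars.
Variables (R S : pzRingType) (k : {rmorphism R -> S}) (M : lmodType S).

Definition restrict_scalars of phant (R -> S) : Type := M.
Local Notation Mk := (restrict_scalars (Phant (R -> S))).
HB.instance Definition _ := GRing.Zmodule.copy Mk M.

Definition restrict_scale (a : R) (u : Mk) : Mk := k a *: (u : M).

Fact restrict_scaleA a b u : restrict_scale a (restrict_scale b u) = restrict_scale (a * b) u.
Proof. by rewrite /restrict_scale scalerA rmorphM. Qed.
Fact restrict_scale1 : left_id 1 restrict_scale.
Proof. by move=> u; rewrite /restrict_scale rmorph1 scale1r. Qed.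
Fact restrict_scaleDr : right_distributive restrict_scale +%R.
Proof. by move=> a u w; rewrite /restrict_scale scalerDr. Qed.
Fact restrict_scaleDl u : {morph restrict_scale^~ u : a b / a + b}.
Proof. by move=> a b; rewrite /restrict_scale rmorphD scalerDl. Qed.
End RestrictScalars.

(** * A functional on the fractions h / (Y_1 ... Y_t)^k *)

Section Functional.
Variables (A : comNzRingType) (m I : idealr A).
Hypotheses (noethA : noetherian A) (localA : local_ring m) (Im : {subset I <= m}).
Variables (E : lmodType {ideal_quot I}).
Hypothesis hullE : injective_hull (residue_module I m) E.
Local Notation A0 := {ideal_quot I}.

Lemma max_imageP a : (\pi_A0 a \in @max_image A I m) <-> a \in m.
Proof.
split=> [/asboolP[b bm /eqP]|am]; last by apply/asboolP; exists a.
rewrite -Quotient.idealrBE => /Im h; have := rpredD h bm; by rewrite subrK.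
Qed.

(** As [m] kills [q0], its multiples form a copy of the residue field; injectivity extends the
    embedding of the latter in [E]. *)
Lemma hull_functional (Q : lmodType A0) (q0 : Q) : q0 <> 0 ->
  (forall a, a \in m -> \pi_A0 a *: q0 = 0) -> exists F : {linear Q -> E}, F q0 <> 0.
Proof.
move=> q00 mq0; have [injE [j injj _]] := hullE.
pose RM := residue_module I m; pose pi := @quotmod_pi A0 A0^o (@max_image A I m).
have /choice[r hr] : forall u : RM, exists b : A0, u = pi b by exact: quotmod_pi_repr.
have pi00 : pi 0 = 0 by apply: raddf0.
have piB (b c : A0) : pi (b - c) = pi b - pi c by apply: raddfB.
have b0 (b : A0) : b \in @max_image A I m -> b *: q0 = 0.
  by move=> /asboolP[a am ->]; apply: mq0.
have rE b : r (pi b) *: q0 = b *: q0.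
  apply/eqP; rewrite -subr_eq0 -scalerBl; apply/eqP/b0.
  by apply/(@quotmod_piE A0 A0^o); rewrite -[RHS]/(pi b) [RHS]hr.
pose j0 (u : RM) : Q := r u *: q0.
have j0B : zmod_morphism j0.
  move=> u w; rewrite /j0 -scalerBl -[RHS]rE; congr (r _ *: _).
  by rewrite piB -!hr.
have j0Z : scalable j0.
  move=> b u; rewrite /j0 scalerA -[RHS]rE; congr (r _ *: _).
  rewrite {1}(hr u); exact: (@quotmod_piZ A0 A0^o (@max_image A I m) b (r u)).
pose l1 := GRing.isZmodMorphism.Build RM Q j0 j0B.
pose l2 := GRing.isScalable.Build A0 RM Q *:%R j0 j0Z.
pose j0l : {linear RM -> Q} := HB.pack j0 l1 l2.
have inj0 : injective j0l.
  apply: raddf_inj => u e0; have e : r u *: q0 = 0 by exact: e0.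
  rewrite (hr u) -[RHS]pi00; apply/(@quotmod_piE A0 A0^o); rewrite subr0.
  have ra : r u = \pi_A0 (repr (r u)) by rewrite reprK.
  rewrite ra; apply/max_imageP; apply: contrapT => /negP /(local_unit noethA localA)[b ab].
  apply: q00; rewrite -[q0]scale1r -[1 : A0](rmorph1 (\pi_A0 : {rmorphism A -> A0})) -ab mulrC.
  by rewrite rmorphM -scalerA /= -ra e scaler0.
have [F hF] := injE RM Q j0l j inj0; exists F => Fq.
have : j (pi 1) = 0.
  by rewrite -hF -[j0l _]/(j0 _) /j0 rE scale1r.
rewrite -(raddf0 j) => /injj; rewrite -pi00 => /(@quotmod_piE A0 A0^o).
rewrite subr0 -[1 : A0](rmorph1 (\pi_A0 : {rmorphism A -> A0})) => /max_imageP.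
by rewrite idealr1.
Qed.

Variables (t : nat) (Y : 'I_t -> gr I) (h : gr I) (c0 K0 : nat).
Hypotheses (t0 : (0 < t)%N) (degY : forall i, Y i \in gr_piece I 1)
  (degh : h \in gr_piece I c0%:Z) (mh : forall a, a \in m -> gr_const I a * h = 0).
Hypothesis top : forall l q, h * (\prod_i Y i) ^+ l <> \sum_b Y b ^+ (K0 + l) * q b.
Local Notation y := (\prod_i Y i).

Lemma K0_gt0 : (0 < K0)%N.
Proof.
rewrite lt0n; apply/eqP => K00; have j := Ordinal t0.
apply: (top (l := 0) (q := fun b => if b == j then h else 0)).
rewrite K00 expr0 mulr1 (bigD1 j) //= eqxx expr0 mul1r big1 ?addr0 // => b /negPf ->.
by rewrite mulr0.
Qed.

(* Multi-degree alpha inverse systems: f alpha u is the value on u / Y^(alpha + 1). *)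
Lemma raw_functional : exists f : ('I_t -> nat) -> gr I -> E,
  [/\ forall al u w, f al (u + w) = f al u + f al w,
      forall al a u, f al (gr_const I a * u) = \pi_A0 a *: f al u,
      forall al i u, f al (Y i * u) =
        if al i is 0 then 0 else f (fun j => al j - (j == i))%N u
    & f (fun=> K0.-1) h <> 0].
Proof.
have [kc kcE] : exists k : {rmorphism A0 -> gr I}, forall a, k (\pi_A0 a) = gr_const I a.
  apply: (factor_rmorphism (f := \pi_A0 : {rmorphism A -> A0}) (h := gr_const I)) => [b|a /eqP].
    by exists (repr b); rewrite /= reprK.
  rewrite -(raddf0 (\pi_A0 : {rmorphism A -> A0})) -Quotient.idealrBE subr0; exact: gr_const0.
pose V0 := {poly gr I}.
pose Vl := GRing.Zmodule_isLmodule.Build A0 (restrict_scalars V0 (Phant (A0 -> gr I)))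
  (restrict_scaleA kc (M := V0)) (restrict_scale1 kc (M := V0))
  (restrict_scaleDr kc (M := V0)) (restrict_scaleDl kc (M := V0)).
pose V : lmodType A0 := HB.pack (restrict_scalars V0 (Phant (A0 -> gr I))) Vl.
pose sc (b : A0) (p : V0) : V0 := kc b *: p.
(* Polynomials in 1 / y whose numerators eventually lie in the ideal of the [Y b ^+ n]; the quotient
   by them is H^t_Y(G). *)
pose N : {pred V} := fun p => `[< exists n0, forall n, (n0 <= n)%N ->
  exists q, numer n (p : V0) y = \sum_b Y b ^+ n * q b >].
have clN : submod_closed N.
  split=> [|b p p' /asboolP[n0 h0] /asboolP[n1 h1]]; apply/asboolP.
    exists 0%N => n _; exists (fun=> 0); rewrite [LHS]numer0 big1 // => b _; by rewrite mulr0.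
  exists (maxn n0 n1) => n; rewrite geq_max => /andP[/h0[q hq] /h1[q' hq']].
  exists (fun i => kc b * q i + q' i); rewrite numerD -[b *: p]/(sc b p) numerZ hq hq'.
  by rewrite big_distrr -big_split; apply: eq_bigr => i _ /=; ring.
pose Ni := GRing.isSubmodClosed.Build A0 V N clN.
pose Ns : submodClosed V := HB.pack N Ni.
pose Q : lmodType A0 := quotmod Ns.
pose cls k (u : gr I) : Q := quotmod_pi Ns (u *: 'X^k : V0).
have clsD k u w : cls k (u + w) = cls k u + cls k w.
  rewrite /cls -quotmod_piD; congr quotmod_pi; exact: (scalerDl ('X^k : V0) u w).
have clsZ k a u : cls k (gr_const I a * u) = \pi_A0 a *: cls k u.
  have eZ b (p : V) : b *: (quotmod_pi Ns p : Q) = quotmod_pi Ns (b *: p) := @quotmod_piZ A0 V Ns b p.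
  rewrite /cls eZ; congr quotmod_pi; rewrite -[RHS]/(kc (\pi_A0 a) *: (u *: 'X^k : V0)).
  by rewrite scalerA kcE.
have clsE k u k' u' : (exists n0, forall n, (n0 <= n)%N ->
    exists q, numer n (u *: 'X^k) y - numer n (u' *: 'X^k') y = \sum_b Y b ^+ n * q b) ->
    cls k u = cls k' u'.
  move=> [n0 hn]; apply/quotmod_piE/asboolP; exists n0 => n /hn[q hq]; exists q.
  by rewrite -hq [LHS]numerD; congr (_ + _); apply: numerN.
have cls0 k : cls k 0 = 0 by have := clsD k 0 0; rewrite addr0 -{1}[cls k 0]addr0 => /addrI.
have clsS k u : cls k u = cls k.+1 (u * y).
  apply: clsE; exists k.+1 => n kn; exists (fun=> 0); rewrite numer_mono ?(ltnW kn) // numer_mono //.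
  by rewrite -mulrA -exprS -subSn // subSS subrr [RHS]big1 // => b _; rewrite mulr0.
have clsY k i u : cls k (Y i ^+ k * u) = 0.
  rewrite -(cls0 0); apply: clsE; exists k => n kn.
  exists (fun b => if b == i then u * (\prod_(j | j != i) Y j) ^+ (n - k) else 0).
  rewrite scale0r numer0 subr0.
  rewrite numer_mono // [RHS](bigD1 i) //= eqxx [X in _ = _ + X]big1 ?addr0 => [|b /negPf ->]; last by rewrite mulr0.
  have -> : Y i ^+ n = Y i ^+ k * Y i ^+ (n - k) by rewrite -exprD subnKC.
  by rewrite (bigD1 i) //= exprMn; ring.
have [||F hF] := @hull_functional Q (cls K0 h).
- move=> e; have /quotmod_piE/asboolP[n0 hn] : cls K0 h = quotmod_pi Ns 0.
    by rewrite e raddf0.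
  have [q] := hn (K0 + n0)%N (leq_addl _ _).
  rewrite subr0 numer_mono ?leq_addr // addKn => e'; exact: (top e').
- by move=> a am; rewrite -clsZ mh // cls0.
pose M (al : 'I_t -> nat) := (\sum_i al i)%N.
have leM al i : (al i <= M al)%N by rewrite /M (bigD1 i) //= leq_addr.
(* The class of u / Y^(al+1) over the denominator y^(k+1). It does not depend on [k] once [k] bounds
   all [al i], and [M al] is such a bound. *)
pose g al k u := cls k.+1 (u * \prod_i Y i ^+ (k - al i)).
have gS al k u : (forall i, (al i <= k)%N) -> g al k u = g al k.+1 u.
  move=> hk; rewrite /g clsS -mulrA -big_split; congr (cls _ (_ * _)).
  by apply: eq_bigr => i _; rewrite /= -exprSr subSn.
have gM al k u : (M al <= k)%N -> g al k u = g al (M al) u.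
  move=> /subnK <-; elim: (k - M al)%N => [//|d IH]; rewrite addSn -gS // => i.
  by apply: leq_trans (leM al i) _; apply: leq_addl.
exists (fun al u => F (g al (M al) u)); split.
- by move=> al u w; rewrite /g mulrDl clsD raddfD.
- by move=> al a u; rewrite /g -mulrA clsZ linearZ.
- move=> al i u; case ai: (al i) => [|a].
    rewrite /g (bigD1 i) //= ai subn0.
    have -> : Y i * u * (Y i ^+ M al * \prod_(j | j != i) Y j ^+ (M al - al j)) =
      Y i ^+ (M al).+1 * (u * \prod_(j | j != i) Y j ^+ (M al - al j)) by rewrite exprS; ring.
    by rewrite clsY raddf0.
  set al' := fun j => _; congr (F _).
  have leM' : (M al' <= M al)%N by apply: leq_sum => j _; apply: leq_subr.
  rewrite -(gM _ _ _ leM') /g; congr (cls _ _).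
  rewrite (bigD1 i) //= [in RHS](bigD1 i) //= [Y i * u]mulrC -!mulrA; congr (u * _).
  rewrite mulrA -exprS -subSn // /al' eqxx; congr (_ * _).
    by congr (_ ^+ _); have := leM al i; rewrite ai; lia.
  by apply: eq_bigr => j /negPf ->; rewrite subn0.
rewrite -(gM _ (K0.-1 * t)%N); last by rewrite /M sum_nat_const card_ord mulnC.
have e k u : (K0.-1 <= k)%N -> g (fun=> K0.-1) k u = g (fun=> K0.-1) K0.-1 u.
  by move=> /subnK <-; elim: (k - K0.-1)%N => [//|d IH]; rewrite addSn -gS // => i; apply: leq_addl.
rewrite e; last by rewrite leq_pmulr.
rewrite /g prednK ?K0_gt0 // subnn big1 ?mulr1 //.
Qed.

Definition gprz (z : int) (u : gr I) : gr I := if z is Posz n then gpr n u else 0.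

Lemma gprzD z : {morph gprz z : u w / u + w}.
Proof. by case: z => n u w /=; rewrite ?gprD ?addr0. Qed.

Lemma gprz_const z a u : gprz z (gr_const I a * u) = gr_const I a * gprz z u.
Proof.
case: z => n /=; last by rewrite mulr0.
by rewrite ini_constE gprM ?pw0 // subn0.
Qed.

Lemma gprz_deg1 z f u : f \in gr_piece I 1 -> gprz (z + 1) (f * u) = f * gprz z u.
Proof.
move=> hf; case: z => [n|[|n]].
- have -> : Posz n + 1 = Posz n.+1 by lia.
  by rewrite /= gprM1.
- by rewrite [RHS]mulr0 /=; have [a ha ->] := gr_piece_ini hf; rewrite gprM.
have -> : Negz n.+1 + 1 = Negz n by lia.
by rewrite /= mulr0.
Qed.

(** Members of the graded dual live in finitely many degrees, so each [f al] is cut to one degree;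
    [e] is chosen to make it the degree of [h] at the constant index [K0.-1]. *)
Lemma graded_functional : exists (f : ('I_t -> nat) -> gr I -> E) (e : int),
  [/\ forall al u w, f al (u + w) = f al u + f al w,
      forall al a u, f al (gr_const I a * u) = \pi_A0 a *: f al u,
      forall al i u, f al (Y i * u) =
        if al i is 0 then 0 else f (fun j => al j - (j == i))%N u,
      f (fun=> K0.-1) h <> 0
    & forall al k u, u \in gr_piece I k -> k != (\sum_i al i)%N%:Z + e -> f al u = 0].
Proof.
have [f [fD fZ fY fh]] := raw_functional.
have f0 al : f al 0 = 0 by have := fD al 0 0; rewrite addr0 -{1}[f al 0]addr0 => /addrI.
pose e : int := c0%:Z - (\sum_(i < t) K0.-1)%N%:Z.
exists (fun al u => f al (gprz ((\sum_i al i)%N%:Z + e) u)), e; split.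
- by move=> al u w; rewrite gprzD fD.
- by move=> al a u; rewrite gprz_const fZ.
- move=> al i u; case ai: (al i) => [|a].
    set z := (_ + e); have -> : z = (z - 1) + 1 by rewrite subrK.
    by rewrite gprz_deg1 // fY ai.
  have -> : (\sum_j al j)%N%:Z + e = (\sum_j (al j - (j == i)))%N%:Z + e + 1.
    rewrite (bigD1 i) //= [in RHS](bigD1 i) //= eqxx ai.
    have -> : (\sum_(j | j != i) (al j - (j == i)))%N = (\sum_(j | j != i) al j)%N.
      by apply: eq_bigr => j /negPf ->; rewrite subn0.
    by rewrite subSS subn0 addSn intS; ring.
  by rewrite gprz_deg1 // fY ai.
- have -> : (\sum_(i < t) K0.-1)%N%:Z + e = c0%:Z by rewrite /e addrC subrK.
  by rewrite /= gr_id.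
move=> al k u hu; case: ((_ + e)) => n kn /=; last by rewrite f0.
by rewrite (gr_piece_pr hu) ?f0 // eq_sym.
Qed.

End Functional.

(** A monomial of degree s k + 1 in [s] terms has some exponent at least [k]. *)
Lemma comb_pow (R : comNzRingType) s (q b : 'I_s -> R) g k : g = \sum_j b j * q j ->
  exists q', g ^+ (s * k).+1 = \sum_j b j ^+ k * q' j.
Proof.
elim: s q b g => [|s IH] q b g.
  by rewrite big_ord0 => ->; exists (fun=> 0); rewrite expr0n big_ord0.
rewrite big_ord_recl /=; set u := b ord0 * q ord0; set w := \sum_(i < s) _ => e.
have [q1 hq1] := IH _ _ w erefl; set n := (s * k).+1 in hq1.
have [u1 [w1 e1]] : exists u1 w1, g ^+ (k + n) = u ^+ k * u1 + w ^+ n * w1.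
  rewrite e exprDn.
  pose V := [set a : R | exists u1 w1, a = u ^+ k * u1 + w ^+ n * w1].
  suff : V (\sum_(i < (k + n).+1) (u ^+ (k + n - i) * w ^+ i) *+ 'C(k + n, i)) by [].
  apply: (big_ind V) => [|_ _ [u1 [w1 ->]] [u2 [w2 ->]]|i _].
  - by exists 0, 0; rewrite !mulr0 addr0.
  - by exists (u1 + u2), (w1 + w2); ring.
  have [ni|ni] := leqP n i.
    exists 0, (u ^+ (k + n - i) * w ^+ (i - n) *+ 'C(k + n, i)).
    by rewrite mulr0 add0r mulrnAr mulrCA -exprD subnKC.
  exists (u ^+ (n - i) * w ^+ i *+ 'C(k + n, i)), 0.
  by rewrite mulr0 addr0 mulrnAr mulrA -exprD -addnBA // ltnW.
exists (fun j => if unlift ord0 j is Some j' then q1 j' * w1 else q ord0 ^+ k * u1).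
have -> : (s.+1 * k).+1 = (k + n)%N by rewrite mulSn addnS.
rewrite e1 big_ord_recl unlift_none hq1 exprMn mulrA; congr (_ + _).
by rewrite big_distrl; apply: eq_bigr => j _ /=; rewrite liftK mulrA.
Qed.

(** * Inverse systems and independence of the rows *)

Section InverseSystem.
Variables (R : comNzRingType) (E : zmodType) (t : nat) (Y : 'I_t -> R).
Variable f : ('I_t -> nat) -> R -> E.
Hypotheses (fD : forall al u w, f al (u + w) = f al u + f al w)
  (fY : forall al i u, f al (Y i * u) =
     if al i is 0 then 0 else f (fun j => al j - (j == i))%N u).

Lemma inv_zero al : f al 0 = 0.
Proof. by have := fD al 0 0; rewrite addr0 -{1}[f al 0]addr0 => /addrI. Qed.

Lemma inv_sub al u w : f al (u - w) = f al u - f al w.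
Proof. by apply/eqP; rewrite eq_sym subr_eq -fD subrK. Qed.

Lemma inv_sum al (T : Type) (r : seq T) (P : pred T) (F : T -> R) :
  f al (\sum_(i <- r | P i) F i) = \sum_(i <- r | P i) f al (F i).
Proof. exact: (big_morph (f al) (fD al) (inv_zero al)). Qed.

Lemma invYn al i n u : f al (Y i ^+ n * u) =
  if (n <= al i)%N then f (fun j => al j - (j == i) * n)%N u else 0.
Proof.
elim: n al u => [|n IH] al u.
  by rewrite expr0 mul1r; congr f; apply/funext => j; rewrite muln0 subn0.
rewrite exprS -mulrA fY; case ai: (al i) => [|a] //=.
rewrite IH eqxx ai subSS subn0 ltnS; case: ifP => // _; congr f; apply/funext => j.
by rewrite -subnDA mulnS.
Qed.

Lemma inv_mono al (be : 'I_t -> nat) u : (forall i, be i <= al i)%N ->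
  f al ((\prod_i Y i ^+ be i) * u) = f (fun i => al i - be i)%N u.
Proof.
have H (r : seq 'I_t) al' : uniq r -> (forall i, i \in r -> be i <= al' i)%N ->
    f al' ((\prod_(i <- r) Y i ^+ be i) * u) = f (fun i => al' i - (i \in r) * be i)%N u.
  elim: r al' => [|i r IH] al' /=.
    by move=> _ _; rewrite big_nil mul1r; congr f; apply/funext => j; rewrite mul0n subn0.
  move=> /andP[ir ur] h; rewrite big_cons -mulrA invYn h ?inE ?eqxx // IH //.
    congr f; apply/funext => j; rewrite inE -subnDA; congr (_ - _)%N.
    by have [->|ji] := eqVneq j i; rewrite ?(negPf ir) ?mul1n ?mul0n ?addn0 ?add0n.
  move=> j jr; have -> : (j == i) = false by apply: contraNF ir => /eqP <-.
  by rewrite mul0n subn0; apply: h; rewrite inE jr orbT.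
move=> h; rewrite H ?index_enum_uniq //; congr f; apply/funext => i.
by rewrite mem_index_enum mul1n.
Qed.

Section Independence.
Variables (P0 : set R) (idP0 : is_ideal P0) (fP0 : forall al u, P0 u -> f al u = 0).
Variables (s : nat) (x : 'I_s -> R).

Definition row_ok N (Q : 'I_t -> 'I_s -> R) := forall i, P0 (dotp (Q i) x - Y i ^+ N).

Lemma contr_rows_scale n (Q : 'I_n -> 'I_s -> R) (u : 'I_n -> R) c S :
  contr (fun i j => u i * Q i j) c S = (\prod_i u i) * contr Q c S.
Proof.
elim: n Q u c S => [|n IH] Q w c S /=; first by rewrite big_ord0 mul1r.
rewrite (IH (fun i => Q (lift ord0 i)) (fun i => w (lift ord0 i))) big_ord_recl -mulrA mulrCA.
congr (_ * _); rewrite -contr_scale; apply: contr_ext => // U.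
by rewrite /iota_op big_distrr /=; apply: eq_bigr => j _; ring.
Qed.

(** Rows are exchanged one at a time. The difference of two rows number [r] kills [x] modulo [P0],
    so its contraction, multiplied by [Y r' ^+ N], falls into the ideal of the other powers
    [Y i ^+ N], where [f] vanishes. *)
Lemma contr_indep1 N (Q Q' : 'I_t -> 'I_s -> R) w : (0 < N)%N ->
  (forall S, kd x w S = 0) -> row_ok N Q -> row_ok N Q' ->
  f (fun=> N.-1) (contr Q w finset.set0) = f (fun=> N.-1) (contr Q' w finset.set0).
Proof.
move=> N0 hw hQ hQ'.
pose Rr r (i : 'I_t) := if (i < r)%N then Q' i else Q i.
have R0 : contr Q w finset.set0 = contr (Rr 0%N) w finset.set0 by apply: contr_ext.
have Rt : contr Q' w finset.set0 = contr (Rr t) w finset.set0.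
  by apply: contr_ext => // i j; rewrite /Rr ltn_ord.
rewrite R0 Rt; suff H r : (r <= t)%N -> f (fun=> N.-1) (contr (Rr r) w finset.set0) =
    f (fun=> N.-1) (contr (Rr 0%N) w finset.set0) by rewrite (H t).
elim: r => [//|r IH] rt; rewrite -IH ?(ltnW rt) //; apply/eqP; rewrite -subr_eq0 -inv_sub.
pose r' := Ordinal rt; pose Qd i j := if i == r' then Rr r.+1 i j - Rr r i j else Rr r i j.
rewrite -(contr_row (Q := Qd) (r := r')) => [|i ir j|j]; last by rewrite /Qd eqxx.
  set v := contr Qd _ _; apply/eqP.
  pose J := fam_ideal P0 (fun i => if i == r' then 0 else Y i ^+ N).
  have idJ : is_ideal J by apply: fam_ideal_is.
  have P0J : P0 `<=` J by apply: fam_ideal_sub.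
  have hR r1 i : P0 (dotp (Rr r1 i) x - Y i ^+ N) by rewrite /Rr; case: ifP.
  have JQd i : J (dotp (Qd i) x).
    have [->|ir] := eqVneq i r'.
      apply: P0J; have -> : dotp (Qd r') x = (dotp (Rr r.+1 r') x - Y r' ^+ N) - (dotp (Rr r r') x - Y r' ^+ N).
        rewrite opprB addrA subrK /dotp -sumrB; apply: eq_bigr => j _.
        by rewrite /Qd eqxx mulrBl.
      exact: idlB.
    have -> : dotp (Qd i) x = dotp (Rr r i) x by apply: eq_bigr => j _; rewrite /Qd (negPf ir).
    apply: (idlBr idJ (P0J _ (hR r i))).
    have := fam_ideal_gen (fun i => if i == r' then 0 else Y i ^+ N) i (idl0 idP0).
    by rewrite (negPf ir).
  have Jxv j : J (x j * v) by apply: contr_cocycle.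
  have JYv : J (Y r' ^+ N * v).
    apply: (idlBl idJ (a := dotp (Q r') x * v)).
      by rewrite -mulrBl; apply: idlMr => //; apply: P0J.
    rewrite /dotp big_distrl; apply: idl_sum => // j _ /=.
    by rewrite -mulrA; apply: idlM.
  (* The index at [r'] is raised by [N] so that the factor [Y r' ^+ N] lowers it back to [N.-1]. *)
  pose al (i : 'I_t) := if i == r' then (N.-1 + N)%N else N.-1.
  have : f al (Y r' ^+ N * v) = 0.
    have [q /(fP0 al)] := JYv; rewrite inv_sub => /eqP; rewrite subr_eq0 => /eqP ->.
    rewrite inv_sum big1 // => i _; have [->|ir] := eqVneq i r'; first by rewrite mul0r inv_zero.
    by rewrite invYn /al (negPf ir) leqNgt prednK // leqnn.
  rewrite invYn {1}/al eqxx leq_addl => <-; congr f; apply/funext => j.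
  by rewrite /al; case: eqP => _; rewrite ?mul1n ?addnK // mul0n subn0.
rewrite /Qd (negPf ir); split=> //; rewrite /Rr ltnS.
have -> : (i <= r)%N = (i < r)%N by rewrite [RHS]ltn_neqAle; move: ir; rewrite -val_eqE /= => ->.
by [].
Qed.

(** Multiplying row [i] by a power of [Y i] raises the exponent [N], and the shift of the inverse
    system compensates; both sides are brought to exponent [N + N']. *)
Lemma contr_indep N N' (Q Q' : 'I_t -> 'I_s -> R) w : (0 < N)%N -> (0 < N')%N ->
  (forall S, kd x w S = 0) -> row_ok N Q -> row_ok N' Q' ->
  f (fun=> N.-1) (contr Q w finset.set0) = f (fun=> N'.-1) (contr Q' w finset.set0).
Proof.
move=> N0 N0' hw hQ hQ'.
have red M M' (W : 'I_t -> 'I_s -> R) : (0 < M)%N -> row_ok M W ->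
    row_ok (M + M') (fun i j => Y i ^+ M' * W i j) /\
    f (fun=> M.-1) (contr W w finset.set0) =
      f (fun=> (M + M').-1) (contr (fun i j => Y i ^+ M' * W i j) w finset.set0).
  move=> M0 hW; split=> [i|].
    have -> : dotp (fun j => Y i ^+ M' * W i j) x - Y i ^+ (M + M') = Y i ^+ M' * (dotp (W i) x - Y i ^+ M).
      rewrite mulrBr -exprD addnC /dotp big_distrr /=; congr (_ - _).
      by apply: eq_bigr => j _; rewrite mulrA.
    exact: idlM.
  rewrite contr_rows_scale inv_mono => [|i]; last by rewrite -subn1; lia.
  by congr f; apply/funext => i; lia.
have [ok1 ->] := red N N' Q N0 hQ; have [ok2 ->] := red N' N Q' N0' hQ'.
by rewrite [(N' + N)%N]addnC in ok2 *; apply: contr_indep1; rewrite ?addn_gt0 ?N0.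
Qed.
End Independence.

End InverseSystem.

(* Only the congruence D Y^k = Y^N matters for the value of det D on elements killed by P0. *)
Lemma det_indep (R : comNzRingType) (E : zmodType) t (Y : 'I_t -> R)
    (f : ('I_t -> nat) -> R -> E) (P0 : set R) (v : R) k N (Dm : 'M[R]_t) :
  (forall al u w, f al (u + w) = f al u + f al w) ->
  (forall al i u, f al (Y i * u) = if al i is 0 then 0 else f (fun j => al j - (j == i))%N u) ->
  is_ideal P0 -> (forall p, P0 p -> p * v = 0) -> (0 < k)%N -> (0 < N)%N ->
  (forall i, P0 (\sum_j Dm i j * Y j ^+ k - Y i ^+ N)) ->
  f (fun=> N.-1) (\det Dm * v) = f (fun=> k.-1) v.
Proof.
move=> fD fY idP0 vP k0 N0 hD.
pose fv al u := f al (u * v); pose de (i j : 'I_t) : R := (i == j)%:R.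
have fvD al u w : fv al (u + w) = fv al u + fv al w by rewrite /fv mulrDl fD.
have fvY al i u : fv al (Y i * u) = if al i is 0 then 0 else fv (fun j => al j - (j == i))%N u.
  by rewrite /fv -mulrA fY.
have fvP al u : P0 u -> fv al u = 0 by move=> /vP; rewrite /fv => ->; apply: inv_zero fD _.
have dote (a : 'I_t -> R) i : dotp a (de i) = a i.
  rewrite /dotp (bigD1 i) //= /de eqxx mulr1 big1 ?addr0 // => j.
  by rewrite eq_sym => /negPf ->; rewrite mulr0.
(* The top Koszul class of the [Y j ^+ k]: contraction with [Dm] gives its determinant, contraction
   with the identity rows gives 1. *)
pose W := wedge de 1.
have hW S : kd (fun j => Y j ^+ k) W S = 0.
  rewrite (kd_comb (r := index_enum 'I_t) (u := fun i => Y i ^+ k) (ga := de)).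
    by rewrite big1 // => i _; rewrite kd_wedge_self mulr0.
  move=> j; rewrite (bigD1 j) //= /de eqxx mulr1 big1 ?addr0 // => i /negPf ->.
  by rewrite mulr0 mul0r.
have := contr_indep fvD fvY idP0 fvP N0 k0 hW (Q := Dm) (Q' := de) hD _.
rewrite !contr_wedge !mulr1.
have -> : \matrix_(i, j) dotp (Dm i) (de j) = Dm by apply/matrixP => i j; rewrite mxE dote.
have -> : \matrix_(i, j) dotp (de i) (de j) = 1%:M by apply/matrixP => i j; rewrite !mxE dote.
rewrite det1 /fv mul1r; apply=> i.
have -> : dotp (de i) (fun j => Y j ^+ k) = Y i ^+ k.
  rewrite /dotp (bigD1 i) //= /de eqxx mul1r big1 ?addr0 // => j.
  by rewrite eq_sym => /negPf ->; rewrite mul0r.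
by rewrite subrr; apply: idl0.
Qed.

(** * From Cech cochains to Koszul cochains *)

Section CechNumerators.
Variables (R : comNzRingType) (s : nat) (x : 'I_s -> R).
Implicit Types (a : R) (c : cech_cochain R s) (S : {set 'I_s}).

Definition cochain_numer k c S : R := numer k (c S) (\prod_(j in S) x j).

Lemma cochain_numer_lin k a c c' S : cochain_numer k (a *: c + c') S = a * cochain_numer k c S + cochain_numer k c' S.
Proof. by rewrite /cochain_numer !ffunE numerD numerZ. Qed.

Lemma cochain_numer_up k l c S : (size (c S) <= k.+1)%N ->
  cochain_numer (k + l) c S = (\prod_(j in S) x j) ^+ l * cochain_numer k c S.
Proof. exact: numer_up. Qed.

Lemma cochain_numer_d k c S : cochain_numer k (cech_d x c) S = kd (fun j => x j ^+ k) (cochain_numer k c) S.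
Proof.
rewrite /cochain_numer /cech_d ffunE /kd.
rewrite (big_morph (fun p => numer k p _) (fun p q => numerD k p q _) (numer0 k _)).
apply: eq_bigr => j jS; rewrite numerZ; congr (_ * _).
by rewrite (finset.big_setD1 j jS) /= numer_comp.
Qed.

Lemma cochain_numer_null c : c \in cech_null x -> exists N, forall k S, (N <= k)%N -> cochain_numer k c S = 0.
Proof.
move=> /asboolP /choice[q hq]; exists (\max_S size (q S)) => k S hk.
by rewrite /cochain_numer hq numer_null //; apply: leq_trans hk; apply: (@leq_bigmax _ (fun S => size (q S))).
Qed.

(* At level k the cochain c is represented without loss by its numerators, and
   these form a cocycle of the Koszul complex of the k-th powers. *)
Definition level_ok k c := (forall S, size (c S) <= k.+1)%N /\
  forall S, kd (fun j => x j ^+ k) (cochain_numer k c) S = 0.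

Lemma cocycle_level c : cech_d x c \in cech_null x ->
  exists N, forall k, (N <= k)%N -> level_ok k c.
Proof.
move=> /cochain_numer_null[N hN]; exists (maxn N (\max_S size (c S))) => k; rewrite geq_max => /andP[Nk sk].
split=> S; last by rewrite -cochain_numer_d hN.
by apply: leq_trans (leqW sk); apply: (@leq_bigmax _ (fun S => size (c S))).
Qed.

End CechNumerators.

(** * The functional induced on local cohomology *)

Section CechFunctional.
Variables (A : comNzRingType) (I m : idealr A) (E : lmodType {ideal_quot I}).
Local Notation A0 := {ideal_quot I}.
Variables (s t : nat) (x : 'I_s -> gr I) (Y : 'I_t -> gr I).
Hypotheses (x1 : degree_one x) (Y1 : degree_one Y) (x_gen : ideal_gen (range x) =i gr_irrelevant I).
Variables (f : ('I_t -> nat) -> gr I -> E) (e : int).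
Hypotheses (fD : forall al u w, f al (u + w) = f al u + f al w)
  (fZ : forall al a u, f al (gr_const I a * u) = \pi_A0 a *: f al u)
  (fY : forall al i u, f al (Y i * u) =
     if al i is 0 then 0 else f (fun j => al j - (j == i))%N u)
  (fdeg : forall al k u, u \in gr_piece I k -> k != (\sum_i al i)%N%:Z + e -> f al u = 0).

Local Notation xp k := (fun j => x j ^+ k).
Local Notation rows k := (row_ok Y [set 0] (xp k)).

(** Each [Y i] is a combination of the [x j], hence its power s k + 1 is one of the [x j ^+ k]; the
    coefficients are cut to the only degree that contributes. *)
Lemma homogeneous_rows k : exists N (Q : 'I_t -> 'I_s -> gr I),
  [/\ (0 < N)%N, rows k N Q & forall i j, Q i j \in gr_piece I (N%:Z - k%:Z)].
Proof.
have /choice[q hq] i : exists q, Y i = \sum_j x j * q j.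
  by apply: (irrelevant_comb x_gen); apply: gr_piece_pr (Y1 i) _.
have /choice[q' hq'] i : exists q', Y i ^+ (s * k).+1 = \sum_j x j ^+ k * q' j by apply: comb_pow.
have dk j : x j ^+ k \in gr_piece I k%:Z by have := gr_pieceX k (x1 j); rewrite mul1r.
have /choice[b hb] j : exists b, pw I k b /\ x j ^+ k = ini I k b.
  by have [b ? ?] := gr_piece_ini (dk j); exists b.
exists (s * k).+1, (fun i j => gpr ((s * k).+1 - k) (q' i j)); split=> // [i|i j].
  rewrite /= /dotp; have -> : Y i ^+ (s * k).+1 = gpr (s * k).+1 (Y i ^+ (s * k).+1).
    by rewrite gr_id //; have := gr_pieceX (s * k).+1 (Y1 i); rewrite mul1r.
  rewrite hq' gpr_sum; apply/eqP; rewrite subr_eq0; apply/eqP; apply: eq_bigr => j _.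
  have [bk ->] := hb j; rewrite gprM // mulrC ifT //.
  by have := ltn_ord j; nia.
have -> : (s * k).+1%:Z - k%:Z = ((s * k).+1 - k)%N%:Z by have := ltn_ord j; nia.
exact: gpr_piece.
Qed.

Lemma contr_piece n (Q : 'I_n -> 'I_s -> gr I) c (z k l : int) :
  (forall i j, Q i j \in gr_piece I l) ->
  (forall S : {set 'I_s}, c S \in gr_piece I (z + k * #|S|%:Z)) ->
  contr Q c finset.set0 \in gr_piece I (z + n%:Z * (k + l)).
Proof.
move=> hQ; elim: n Q c z hQ => [|n IH] Q c z hQ hc.
  by have := hc finset.set0; rewrite cards0 mulr0 mul0r.
have -> : z + n.+1%:Z * (k + l) = (z + k + l) + n%:Z * (k + l) by lia.
apply: IH => [i j|S]; first exact: hQ.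
apply: gr_piece_sum => j jS; rewrite /ksign.
have -> : z + k + l + k * #|S|%:Z = 0 + (l + (z + k * #|j |: S|%:Z)).
  by rewrite cardsU1 jS add1n intS; ring.
apply: gr_pieceM; last by apply: gr_pieceM.
have -> : (-1) ^+ #|[set k0 in S | (k0 < j)%N]%SET| = gr_const I ((-1) ^+ #|[set k0 in S | (k0 < j)%N]%SET|).
  by rewrite rmorphXn rmorphN1.
exact: gr_const_piece.
Qed.

Lemma dir_prod (S : {set 'I_s}) : \prod_(j in S) x j \in gr_piece I #|S|%:Z.
Proof.
rewrite -sum1_card; elim/big_rec2: _ => [|j n p _ hp]; first by rewrite -ini1 ini_piece ?pw0.
by rewrite PoszD; apply: gr_pieceM.
Qed.

Definition cech_value k N (Q : 'I_t -> 'I_s -> gr I) (c : cech_cochain (gr I) s) : E :=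
  f (fun=> N.-1) (contr Q (cochain_numer x k c) finset.set0).

(** Both values are compared at level [k + k'] with common rows [W]; by [contr_pow] a change of
    level is only a change of rows. *)
Lemma cech_value_indep k k' N N' (Q Q' : 'I_t -> 'I_s -> gr I) c :
  level_ok x k c -> level_ok x k' c -> (0 < N)%N -> (0 < N')%N ->
  rows k N Q -> rows k' N' Q' -> cech_value k N Q c = cech_value k' N' Q' c.
Proof.
have f0 al u : [set (0 : gr I)] u -> f al u = 0 by move=> ->; exact: (inv_zero fD).
move=> ok ok' N0 N0' hQ hQ'.
have [M [W [M0 hW _]]] := homogeneous_rows (k + k').
have red k1 l N1 Q1 : level_ok x k1 c -> (0 < N1)%N -> rows k1 N1 Q1 -> (k1 + l = k + k')%N ->
    cech_value k1 N1 Q1 c = f (fun=> M.-1) (contr W (cochain_numer x (k + k') c) finset.set0).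
  move=> [sc zc] N10 hQ1 kl; rewrite -kl.
  rewrite (contr_ext (c' := fun U => (\prod_(j in U) x j) ^+ l * cochain_numer x k1 c U) (Q' := W)) //; last first.
    by move=> U; apply: cochain_numer_up.
  rewrite contr_pow finset.big_set0 expr1n mul1r.
  apply: (contr_indep fD fY (set0_ideal _) f0 N10 M0 zc) => // i.
  have := hW i; rewrite -kl => <-; congr (_ - _); apply: eq_bigr => j _.
  by rewrite -mulrA -exprD addnC.
by rewrite (red _ _ _ _ ok N0 hQ erefl) (red _ _ _ _ ok' N0' hQ' (addnC _ _)).
Qed.

Lemma cech_value_coboundary k N (Q : 'I_t -> 'I_s -> gr I) c b : (0 < N)%N -> rows k N Q ->
  (forall S, cochain_numer x k c S = kd (xp k) (cochain_numer x k b) S) -> cech_value k N Q c = 0.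
Proof.
move=> N0 hQ hc; rewrite /cech_value (contr_ext (c' := kd (xp k) (cochain_numer x k b)) (Q' := Q)) //.
pose J := fam_ideal [set 0] (fun i => Y i ^+ N).
have id0 := set0_ideal (gr I); have idJ : is_ideal J by apply: fam_ideal_is.
have JQ i : J (dotp (Q i) (xp k)).
  apply: (idlBr idJ (b := Y i ^+ N)); first by apply: fam_ideal_sub; apply: hQ.
  exact: (fam_ideal_gen (fun i => Y i ^+ N)).
have [q /eqP] := contr_coboundary (cochain_numer x k b) idJ JQ; rewrite subr_eq0 => /eqP ->.
by rewrite (inv_sum fD) big1 // => i _; rewrite (invYn fY) leqNgt prednK // leqnn.
Qed.

Definition is_cocycle c := cech_d x c \in cech_null x.

Lemma cech_functional : exists phi : cech_cochain (gr I) s -> E,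
  forall c k N Q, is_cocycle c -> level_ok x k c -> (0 < N)%N -> rows k N Q ->
    phi c = cech_value k N Q c.
Proof.
have /choice[phi hphi] : forall c, exists v, forall k N Q, is_cocycle c -> level_ok x k c -> (0 < N)%N ->
    rows k N Q -> v = cech_value k N Q c.
  move=> c; have [hc|hc] := pselect (is_cocycle c); last by exists 0 => k N Q /hc.
  have [k /(_ k (leqnn k)) hk] := cocycle_level hc.
  have [N [Q [N0 hQ _]]] := homogeneous_rows k.
  exists (cech_value k N Q c) => k' N' Q' _ ok' N0' hQ'; exact: cech_value_indep.
by exists phi => c k N Q hc; apply: hphi.
Qed.

Lemma matlis_functional : exists Phi : matlis_dual x t E,
  forall (a : gr I) (z : cech_cocycle x t) k N Q, level_ok x k (cocycle_val z) -> (0 < N)%N -> rows k N Q ->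
    matlis_val (a *: Phi) (quotmod_pi (@cech_coboundary _ _ x t) z) =
    f (fun=> N.-1) (a * contr Q (cochain_numer x k (cocycle_val z)) finset.set0).
Proof.
have [phi hphi] := cech_functional.
have zc (z : cech_cocycle x t) : is_cocycle (cocycle_val z).
  by have /asboolP[] := cocycle_valP z.
have lev (z : cech_cocycle x t) : exists N, forall k, (N <= k)%N -> level_ok x k (cocycle_val z).
  exact: (cocycle_level (zc z)).
have phiP a (z w : cech_cocycle x t) : phi (cocycle_val (a *: z + w)) =
    phi (cocycle_val (a *: z)) + phi (cocycle_val w).
  have [n1 h1] := lev (a *: z); have [n2 h2] := lev w; have [n3 h3] := lev (a *: z + w).
  have [] : [/\ n1 <= n1 + n2 + n3, n2 <= n1 + n2 + n3 & n3 <= n1 + n2 + n3]%N by split; lia.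
  move: (n1 + n2 + n3)%N => k /h1 {}h1 /h2 {}h2 /h3 {}h3.
  have [N [Q [N0 hQ _]]] := homogeneous_rows k.
  rewrite !(hphi _ _ _ _ (zc _) _ N0 hQ) // /cech_value -fD; congr f.
  rewrite -[X in _ = X + _]mul1r -contr_lin; apply: contr_ext => // U; rewrite mul1r.
  have -> : cocycle_val (a *: z + w) = 1 *: cocycle_val (a *: z) + cocycle_val w.
    by rewrite scale1r.
  by rewrite cochain_numer_lin mul1r.
have phiZ a (z : cech_cocycle x t) k N Q : level_ok x k (cocycle_val z) -> (0 < N)%N -> rows k N Q ->
    phi (cocycle_val (a *: z)) = f (fun=> N.-1) (a * contr Q (cochain_numer x k (cocycle_val z)) finset.set0).
  move=> ok N0 hQ.
  have cnZ k0 U : cochain_numer x k0 (cocycle_val (a *: z)) U = a * cochain_numer x k0 (cocycle_val z) U.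
    have -> : cocycle_val (a *: z) = a *: cocycle_val z + 0 by rewrite addr0.
    by rewrite cochain_numer_lin [X in _ + X]/cochain_numer ffunE numer0 addr0.
  have ok' : level_ok x k (cocycle_val (a *: z)).
    case: ok => h1 h2; split=> S.
      have -> : cocycle_val (a *: z) S = a *: cocycle_val z S by rewrite ffunE.
      exact: leq_trans (size_scale_leq _ _) (h1 S).
    have -> : kd (xp k) (cochain_numer x k (cocycle_val (a *: z))) S = a * kd (xp k) (cochain_numer x k (cocycle_val z)) S.
      by rewrite (kd_ext _ _ (cnZ k)) /kd big_distrr; apply: eq_bigr => j _ /=; ring.
    by rewrite h2 mulr0.
  by rewrite (hphi _ k N Q) // /cech_value -contr_scale; congr f; apply: contr_ext.
have phiD (z w : cech_cocycle x t) : phi (cocycle_val (z + w)) = phi (cocycle_val z) + phi (cocycle_val w).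
  by rewrite -[z]scale1r phiP.
have phi_cob (z : cech_cocycle x t) : z \in @cech_coboundary _ _ x t -> phi (cocycle_val z) = 0.
  move=> /asboolP[b _ /cochain_numer_null[n1 h1]]; have [n2 h2] := lev z.
  have [] : [/\ n1 <= n1 + n2 & n2 <= n1 + n2]%N by split; lia.
  move: (n1 + n2)%N => k /h1 {}h1 /h2 {}h2.
  have [N [Q [N0 hQ _]]] := homogeneous_rows k.
  rewrite (hphi _ k N Q) //; apply: (cech_value_coboundary (b := b)) => // S.
  have := h1 S; rewrite -cochain_numer_d [cocycle_val z - _]addrC -scaleN1r cochain_numer_lin mulN1r addrC => /eqP.
  by rewrite subr_eq0 => /eqP.
pose H := cech_cohomology x t; pose pi := quotmod_pi (@cech_coboundary _ _ x t).
have /choice[rep hrep] : forall u : H, exists z, u = pi z by apply: quotmod_pi_repr.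
pose Phi (u : H) := phi (cocycle_val (rep u)).
have PhiE z : Phi (pi z) = phi (cocycle_val z).
  rewrite /Phi; set w := rep _; have : z - w \in @cech_coboundary _ _ x t.
    by apply/quotmod_piE; apply: hrep.
  by move=> /phi_cob e0; rewrite -[z in RHS](subrK w) phiD e0 add0r.
have PhiD u v : Phi (u + v) = Phi u + Phi v.
  by rewrite (hrep u) (hrep v) -[pi _ + _]quotmod_piD !PhiE phiD.
have PhiZ a z k N Q : level_ok x k (cocycle_val z) -> (0 < N)%N -> rows k N Q ->
    Phi (a *: pi z) = f (fun=> N.-1) (a * contr Q (cochain_numer x k (cocycle_val z)) finset.set0).
  by move=> *; rewrite [a *: pi z]quotmod_piZ PhiE (phiZ _ _ k N Q).
have PhiM : Phi \in @matlis_pred A I s x t E.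
  apply/asboolP; split=> // [a u|].
    rewrite (hrep u); have [k /(_ k (leqnn k)) hk] := lev (rep u).
    have [N [Q [N0 hQ _]]] := homogeneous_rows k.
    have := PhiZ 1 _ _ _ _ hk N0 hQ; rewrite scale1r mul1r => ->.
    by rewrite (PhiZ _ _ _ _ _ hk N0 hQ) fZ.
  (* In degree [n] the contraction has degree n + t N, while [f] at [N.-1] sees only t (N - 1) + e;
     so only n = e - t survives. *)
  exists `|e - t%:Z|%N => n u hn /asboolP[z hz ->].
  have [k /(_ k (leqnn k)) hk] := lev z.
  have [N [Q [N0 hQ Qdeg]]] := homogeneous_rows k.
  rewrite -[quotmod_pi _ _]scale1r (PhiZ _ _ k N Q) // mul1r.
  have hc (S : {set 'I_s}) : cochain_numer x k (cocycle_val z) S \in gr_piece I (n + k%:Z * #|S|%:Z).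
    apply: gr_piece_sum => j _.
    have -> : n + k%:Z * #|S|%:Z = (n + (j * #|S|)%N%:Z) + (#|S|%:Z * (k - j)%N%:Z).
      have := ltn_ord j; rewrite ltnS; move: (nat_of_ord j) => i ik.
      by rewrite -{1}(subnKC ik) PoszM PoszD; ring.
    apply: gr_pieceM => //; apply: gr_pieceX.
    exact: dir_prod.
  apply: fdeg (contr_piece Qdeg hc) _.
  apply/eqP; rewrite sum_nat_const card_ord => en.
  have {}en : n = e - t%:Z.
    have e1 : (t * N.-1)%N%:Z = t%:Z * N%:Z - t%:Z by rewrite -[in RHS](prednK N0) PoszM intS; ring.
    by move: en; rewrite e1 [k%:Z + _]addrC subrK; lia.
  by move: hn; rewrite en; lia.
by exists (MatlisDual PhiM) => a z k N Q ok N0 hQ; apply: PhiZ.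
Qed.

End CechFunctional.

(** * The annihilator of the functional *)

Section Annihilator.
Variables (A : comNzRingType) (m I : idealr A).
Hypotheses (noethA : noetherian A) (localA : local_ring m) (Im : {subset I <= m}).
Variables (E : lmodType {ideal_quot I}).
Hypothesis hullE : injective_hull (residue_module I m) E.
Variables (K : fieldType) (pK : {rmorphism A -> K}).
Hypotheses (sK : forall b, exists a, b = pK a) (kK : forall a, pK a = 0 <-> a \in m).
Variables (P : set (gr I)) (h : gr I) (c0 : nat).
Hypotheses (pP : prime_set P) (annh : forall a, a * h = 0 <-> P a) (degh : h \in gr_piece I c0%:Z).
Variables (B : comNzRingType) (pB : {rmorphism gr I -> B}).
Hypotheses (sB : forall b, exists a, b = pB a) (kB : forall a, pB a = 0 <-> P a).
Variable kap : {rmorphism K -> B}.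
Hypothesis kapE : forall a, kap (pK a) = pB (gr_const I a).
Variables (t : nat) (Y : 'I_t -> gr I).
Hypotheses (t0 : (0 < t)%N) (Y1 : degree_one Y) (radY : radical_of P Y).
Hypothesis ev_inj : forall F, ev kap (pB \o Y) F = 0 -> F = 0.
Variables (v : nat) (g : 'I_v -> B).
Hypothesis gen : forall b, exists F : 'I_v -> {mpoly K[t]}, b = \sum_i ev kap (pB \o Y) (F i) * g i.
Variables (s : nat) (x : 'I_s -> gr I).
Hypotheses (x1 : degree_one x) (x_gen : ideal_gen (range x) =i gr_irrelevant I).

Let idP : is_ideal P. Proof. by case: pP. Qed.

Lemma const_kills a : a \in m -> gr_const I a * h = 0.
Proof. by move=> am; apply/annh/kB; rewrite -kapE (kK a).2 // rmorph0. Qed.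

(** One exponent serves all [j] because the degree bound in [radical_of] is uniform. *)
Lemma power_comb k : exists n (ga : 'I_t -> 'I_s -> gr I),
  forall j, P (x j ^+ n - \sum_i Y i ^+ k * ga i j).
Proof.
have [N hN] := radY; exists (N * (t * k).+1)%N.
have /choice[q hq] j : exists q, P (x j ^+ N - \sum_i Y i * q i).
  by apply: hN (leqnn N) _; have := gr_pieceX N (x1 j); rewrite mul1r.
have /choice[q' hq'] j : exists q', (\sum_i Y i * q j i) ^+ (t * k).+1 = \sum_i Y i ^+ k * q' i.
  exact: comb_pow.
exists (fun i j => q' j i) => j; rewrite -hq' exprM; exact: cong_exp.
Qed.

Section Value.
Variables (f : ('I_t -> nat) -> gr I -> E).
Hypotheses (fD : forall al u w, f al (u + w) = f al u + f al w)
  (fY : forall al i u, f al (Y i * u) =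
     if al i is 0 then 0 else f (fun j => al j - (j == i))%N u).
Variables (Phi : matlis_dual x t E) (a : gr I).
Hypothesis PhiE : forall (z : cech_cocycle x t) k N Q, level_ok x k (cocycle_val z) -> (0 < N)%N ->
  row_ok Y [set 0] (fun j => x j ^+ k) N Q ->
  matlis_val (a *: Phi) (quotmod_pi (@cech_coboundary _ _ x t) z) =
  f (fun=> N.-1) (a * contr Q (cochain_numer x k (cocycle_val z)) finset.set0).
Hypothesis aPhi : a *: Phi = 0.

(* The cocycle is w h times the image, under the map of Koszul complexes given by ga, of the
   generator of the top Koszul cohomology of the powers of Y. *)
Lemma annihilator_const w k : (0 < k)%N -> f (fun=> k.-1) (a * (w * h)) = 0.
Proof.
move=> k0; have [n [ga hga]] := power_comb k.
pose z : cech_cochain (gr I) s := [ffun S => wedge ga (w * h) S *: 'X^n].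
(* The values are multiples of [h], so congruences modulo [P] become equalities against them. *)
have wP p (S : {set 'I_s}) : P p -> p * wedge ga (w * h) S = 0.
  by move=> /annh ph; rewrite -[w * h]mulr1 wedge_scale mulrA mulrCA ph mulr0 mul0r.
have kd0 S : kd (fun j => x j ^+ n) (wedge ga (w * h)) S = 0.
  rewrite (kd_comb (r := index_enum 'I_t) (u := fun i => Y i ^+ k) (ga := ga)).
    by rewrite big1 // => i _; rewrite kd_wedge_self mulr0.
  by move=> j; apply/eqP; rewrite -subr_eq0 -big_distrl -mulrBl; apply/eqP/wP/hga.
have dz : cech_d x z = 0.
  apply/ffunP => S; rewrite !ffunE -[RHS](scale0r 'X^n) -(kd0 S) /kd scaler_suml.
  apply: eq_bigr => j _; rewrite ffunE linearZ /= -['X^n \Po _]/('X^n \Po (x j *: 'X)) comp_Xn_poly.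
  by rewrite exprZn !scalerA; congr (_ *: _); rewrite /ksign; ring.
have zc : z \in @cech_cocycle_pred _ _ x t.
  apply/asboolP; split=> [S hS|]; first by rewrite ffunE wedge_supp ?scale0r.
  by rewrite dz rpred0.
have cnz S : cochain_numer x n z S = wedge ga (w * h) S.
  rewrite /cochain_numer ffunE /numer (bigD1 (ord_max : 'I_n.+1)) //= subnn expr0 mulr1 coefZ coefXn eqxx mulr1.
  rewrite big1 ?addr0 // => i; rewrite -val_eqE /= => /negPf ni.
  by rewrite coefZ coefXn ni mulr0 mul0r.
have ok : level_ok x n z.
  split=> S; last by rewrite (kd_ext _ _ cnz).
  by rewrite ffunE (leq_trans (size_scale_leq _ _)) // size_polyXn.
have [N [Q [N0 hQ _]]] := homogeneous_rows x1 Y1 x_gen n.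
have := PhiE (z := CechCocycle zc) ok N0 hQ; rewrite aPhi /= => /esym.
rewrite (contr_ext (c' := wedge ga (w * h)) (Q' := Q)) // contr_wedge mulrCA.
rewrite (det_indep fD fY idP _ k0 N0) // => [p /annh ph|i].
  have -> : p * (a * (w * h)) = a * w * (p * h) by ring.
  by rewrite ph mulr0.
have -> : \sum_j (\matrix_(i, j) dotp (Q i) (ga j)) i j * Y j ^+ k - Y i ^+ N =
    \sum_l Q i l * (\sum_j Y j ^+ k * ga j l - x l ^+ n).
  have -> : Y i ^+ N = \sum_l Q i l * x l ^+ n.
    by apply/eqP; rewrite eq_sym -subr_eq0; apply/eqP/hQ.
  under [RHS]eq_bigr do rewrite mulrBr big_distrr /=.
  rewrite sumrB exchange_big /=; congr (_ - _); apply: eq_bigr => j _.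
  by rewrite mxE /dotp big_distrl /=; apply: eq_bigr => l _; ring.
apply: idl_sum => // l _; apply: idlM => //; rewrite -opprB; apply: idlN => //.
Qed.

End Value.

Lemma mpoly_lift (F : {mpoly K[t]}) : exists c : 'X_{1..t} -> A,
  (forall u, pK (c u) = F@_u) /\
  pB (\sum_(u <- msupp F) gr_const I (c u) * mono Y u) = ev kap (pB \o Y) F.
Proof.
have /choice[c hc] u : exists a, pK a = F@_u by have [a ->] := sK F@_u; exists a.
exists c; split=> //; rewrite rmorph_sum; apply: eq_bigr => u _ /=.
by rewrite rmorphM /= -kapE hc mono_ev.
Qed.

Lemma min_multinom (S : 'X_{1..t} -> Prop) u : S u ->
  exists u0, S u0 /\ forall w, S w -> (u0 <= w)%O.
Proof.
elim/(ltmwf (n := t)): u => u IH Su.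
have [[w [Sw wu]]|h0] := pselect (exists w, S w /\ (w < u)%O); first exact: IH wu Sw.
exists u; split=> // w Sw; rewrite leNgt; apply/negP => wu; apply: h0; by exists w.
Qed.

(** If [a] is not in [P], a multiple of it is a nonzero polynomial [F] in [Y] modulo [P], and the
    functional would vanish on all multiples of [F h]. The lowest monomial of [F], paired with the
    lowest index where [f] is nonzero on [h], excludes this. *)
Lemma faithful_functional : exists Phi : matlis_dual x t E, forall a, a *: Phi = 0 -> P a.
Proof.
have [K0 top] := top_class (@gr_noeth A I ((noetherianP A).1 noethA)) pP annh sB kB ev_inj gen.
have [f [e [fD fZ fY fh fdeg]]] := graded_functional noethA localA Im hullE t0 Y1 degh const_kills top.
have [Phi PhiE] := matlis_functional x1 Y1 x_gen fD fZ fY fdeg.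
exists Phi => a aPhi; apply: contrapT => nPa.
have ba : pB a <> 0 by move=> /kB.
have [F [b' [F0 eF]]] := multiple_in_ev (quot_domain pP sB kB) gen ba.
have [b eb] := sB b'; have [c [hc cF]] := mpoly_lift F.
pose Fh := \sum_(u <- msupp F) gr_const I (c u) * mono Y u.
have abF z : a * (b * z * h) = Fh * (z * h).
  apply/eqP; rewrite -subr_eq0; have -> : a * (b * z * h) - Fh * (z * h) = (a * b - Fh) * h * z by ring.
  have /annh -> : P (a * b - Fh) by apply/kB; rewrite rmorphB rmorphM -eb eF cF subrr.
  by rewrite mul0r.
(* An arbitrary index is reached from a constant one by multiplying with a monomial in [Y]. *)
have Fz (al : 'I_t -> nat) : f al (Fh * h) = 0.
  pose k := (\max_i al i).+1; pose be i := (k.-1 - al i)%N.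
  have alk i : (al i <= k.-1)%N by apply: (@leq_bigmax _ al).
  have := annihilator_const fD fY (PhiE a) aPhi (b * \prod_i Y i ^+ be i) (ltn0Sn k.-1).
  rewrite abF mulrCA (inv_mono fY) => [<-|i]; last by rewrite leq_subr.
  by congr f; apply/funext => i; rewrite subKn.
have fh' : f [multinom K0.-1 | i < t] h <> 0.
  have -> // : [multinom K0.-1 | i < t] = (fun=> K0.-1) :> ('I_t -> nat).
  by apply/funext => i; rewrite mnmE.
have [g0 [fg0 ming]] := @min_multinom (fun u => f u h <> 0) _ fh'.
have [u0 [Fu0 minF]] : exists u0, F@_u0 <> 0 /\ forall w, F@_w <> 0 -> (u0 <= w)%O.
  have [u Fu] : exists u, F@_u <> 0.
    apply: contrapT => hF; apply: F0; apply/mpolyP => u; rewrite mcoeff0.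
    by apply: contrapT => Fu; apply: hF; exists u.
  exact: (@min_multinom (fun w => F@_w <> 0) u).
(* Any other exponent of [F] exceeds [u0], so it leads to an index below [g0], where [f] vanishes on
   [h], or to none. *)
have Fterm u : (u \in msupp F) && (u != u0) ->
    f (g0 + u0)%MM (gr_const I (c u) * mono Y u * h) = 0.
  move=> /andP[]; rewrite mcoeff_msupp => /eqP Fu uu0.
  have lt0 : (u0 < u)%O by rewrite lt_neqAle eq_sym uu0 minF.
  rewrite -mulrA fZ; have [/forallP le|] := boolP [forall i, u i <= (g0 + u0)%MM i]%N; last first.
    rewrite negb_forall => /existsP[i]; rewrite -ltnNge => li.
    by rewrite /mono (bigD1 i) //= -mulrA (invYn fY) leqNgt li scaler0.
  rewrite (inv_mono fY) //; pose w := (g0 + u0 - u)%MM.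
  have -> : (fun i => (g0 + u0)%MM i - u i)%N = w :> ('I_t -> nat).
    by apply/funext => i; rewrite mnmBE.
  have [->|/ming] := pselect (f w h = 0); first by rewrite scaler0.
  have : (w + u = g0 + u0)%MM by apply: submK; apply/mnm_lepP.
  move=> wu; rewrite -(lemc_add2l _ _ u) wu lemc_add2r => /(lt_le_trans lt0).
  by rewrite ltxx.
have := Fz (g0 + u0)%MM; rewrite big_distrl (inv_sum fD) (bigD1_seq u0) ?msupp_uniq //=; last first.
  by rewrite mcoeff_msupp; apply/eqP.
rewrite [X in _ + X]big_seq_cond [X in _ + X]big1 ?addr0; last by move=> u /Fterm.
rewrite -mulrA fZ (inv_mono fY) => [|i]; last by rewrite mnmDE leq_addl.
have -> : (fun i => (g0 + u0)%MM i - u0 i)%N = g0 :> ('I_t -> nat).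
  by apply/funext => i; rewrite mnmDE addnK.
move=> c0h; apply: fg0.
have [a' ha'] := sK (F@_u0)^-1.
have : gr_const I (1 - a' * c u0) * h = 0.
  apply: const_kills; apply/kK; rewrite rmorphB rmorphM rmorph1 -ha' hc mulVf ?subrr //.
  exact/eqP.
rewrite rmorphB rmorph1 mulrBl mul1r rmorphM -mulrA => /eqP; rewrite subr_eq0 => /eqP ->.
by rewrite !fZ c0h scaler0.
Qed.
End Annihilator.

(** * Initial forms with prime annihilator *)

Section AlivePrime.
Variables (A : comNzRingType) (nA : noeth A) (I : idealr A).
Implicit Types (y z b : A) (h : gr I).

(* No power of G_+ kills h. *)
Definition alive h := forall j, exists2 b, pw I j b & ini I j b * h <> 0.

(** If no form is alive, each [z] is killed in some degree depending on [z]; noetherianity makes one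
    degree [j] serve all [z] in I^l. *)
Lemma alive_ex c l y : (forall z, pw I l z -> pw I (c + l) (z * y)) ->
  (exists2 z, pw I l z & alive (ini I (c + l) (z * y))) \/
  exists j, forall a, pw I (l + j) a -> pw I (c + l + j).+1 (a * y).
Proof.
move=> hy; have [|hN] := pselect (exists2 z, pw I l z & alive (ini I (c + l) (z * y))); [by left|right].
pose L j : set A := [set z | pw I l z /\ forall b, pw I j b -> pw I (c + l + j).+1 (b * (z * y))].
have idL j : is_ideal (L j).
  have pwi k := pw_is I k; split; first by split=> [|b _]; rewrite ?mul0r ?mulr0; apply: idl0.
    move=> a b [ha ha'] [hb hb']; split; first exact: idlD.
    by move=> e he; rewrite mulrDl mulrDr; apply: (idlD (pwi _)); [apply: ha'|apply: hb'].
  move=> a b [hb hb']; split; first exact: idlM.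
  by move=> e he; rewrite -mulrA mulrCA; apply: (idlM (pwi _)); apply: hb'.
have Lup j k : (j <= k)%N -> L j `<=` L k.
  move=> /subnKC <-; elim: (k - j)%N => [|n IH] a La; first by rewrite addn0.
  have [la La'] := IH _ La; split=> //; rewrite addnS.
  have idW : is_ideal [set b | pw I (c + l + (j + n).+1).+1 (b * (a * y))].
    exact: (colon_ideal _ (pw_is I _)).
  apply: (pwS_min idW) => b b' hb hb' /=; rewrite -mulrA addnS; apply: pwS => //.
  exact: La'.
have [||_ [j _ <-] jmax] := @noeth_max _ [set J | exists2 j, True & L j = J] nA.
- by move=> _ [j _ <-].
- by exists (L 0%N), 0%N.
exists j => a la; apply: (@pw_add_min _ I l j [set a | pw I (c + l + j).+1 (a * y)]) la.
  exact: (colon_ideal _ (pw_is I _)).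
move=> z b hz hb /=; rewrite -mulrA mulrCA.
suff [_] : L j z by apply.
have [k Lk] : exists k, L k z.
  apply: contrapT => hk; apply: hN; exists z => // k; apply: contrapT => hb'.
  apply: hk; exists k; split=> // b' hb''; apply: contrapT => hp; apply: hb'; exists b' => //.
  have -> : ini I k b' * ini I (c + l) (z * y) = ini I (k + (c + l)) (b' * (z * y)) by rewrite -iniM //; apply: hy.
  by move=> /ini0 => h; apply: hp; rewrite addnC; apply: h; apply: pwM => //; apply: hy.
rewrite -(jmax (L (maxn j k))); last by apply: Lup; rewrite leq_maxl.
  by apply: Lup Lk; rewrite leq_maxr.
by exists (maxn j k).
Qed.

Lemma alive_mul c y i : pw I c y -> alive (ini I c y) -> exists2 z, pw I i z & alive (ini I (c + i) (z * y)).
Proof.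
move=> hy al; have [|//|[j hj]] := @alive_ex c i y.
  by move=> z hz; rewrite addnC; apply: pwM.
have [b hb] := al (i + j)%N; rewrite -iniM // => /ini0 []; first exact: pwM.
by rewrite addnC addnA; apply: hj.
Qed.

Lemma ann_ideal h : is_ideal [set g | g * h = 0].
Proof.
split=> [|a b ha hb|a b hb] /=; first exact: mul0r.
  by rewrite mulrDl ha hb addr0.
by rewrite -mulrA hb mulr0.
Qed.

Lemma ann_homogeneous c h g n : h \in gr_piece I c%:Z -> g * h = 0 -> gpr n g * h = 0.
Proof.
move=> /gr_piece_ini[y hy ->] gh; have := congr1 (gpr (n + c)) gh.
by rewrite gpr0 mulrC gprM // leq_addl addnK mulrC.
Qed.

(** Compare the highest components of both factors that lie outside [P]; in the degree of their
    product all other terms are in [P]. *)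
Lemma homogeneous_prime (P : set (gr I)) : is_ideal P -> ~ P 1 ->
  (forall g n, P g -> P (gpr n g)) ->
  (forall n k f g, f \in gr_piece I n%:Z -> g \in gr_piece I k%:Z -> P (f * g) -> P f \/ P g) ->
  prime_set P.
Proof.
move=> idP P1 homP hP; split=> // a b Pab; apply: contrapT => /not_orP[nPa nPb].
have lead f : ~ P f -> exists n, ~ P (gpr n f) /\ forall k, (n < k)%N -> P (gpr k f).
  move=> nPf; have [N hN] := gr_decomp f.
  have big k : (N <= k)%N -> gpr k f = 0.
    move=> Nk; rewrite (hN N (leqnn N)) gpr_sum big1 // => i _.
    apply: gr_piece_pr (gpr_piece i f) _; rewrite eqz_nat.
    by have := ltn_ord i; case: eqP => // <-; rewrite ltnNge Nk.
  have [k nPk] : exists k, ~ P (gpr k f).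
    apply: contrapT => hk; apply: nPf; rewrite (hN N (leqnn N)); apply: idl_sum => // i _.
    by apply: contrapT => hi; apply: hk; exists (val i).
  pose T k := `[< ~ P (gpr k f) >].
  have Tk : exists k, T k by exists k; apply/asboolP.
  have Tb i : T i -> (i <= N)%N.
    by move=> /asboolP hi; rewrite leqNgt; apply/negP => /ltnW /big e; apply: hi; rewrite e; apply: idl0.
  case: (ex_maxnP Tk Tb) => n /asboolP Tn nmax; exists n; split=> // j nj.
  by apply: contrapT => /asboolP /nmax; rewrite leqNgt nj.
have [n [na an]] := lead a nPa; have [k [kb bk]] := lead b nPb.
have := homP _ (n + k)%N Pab; rewrite gprMn.
have nk : (n < (n + k).+1)%N by rewrite ltnS leq_addr.
rewrite (bigD1 (Ordinal nk)) //= addKn => Ps.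
have : P (gpr n a * gpr k b).
  rewrite -[X in P X](addrK (\sum_(i < (n + k).+1 | i != Ordinal nk) gpr i a * gpr (n + k - i) b)).
  apply: idlB => //; apply: idl_sum => // i; rewrite -val_eqE /= => ni.
  have [ni'|ni'] := ltnP n i; first by apply: idlMr => //; apply: an.
  by apply: idlM => //; apply: bk; move: ni ni'; move: (nat_of_ord i) => i'; lia.
by case/(hP _ _ _ _ (gpr_piece n a) (gpr_piece k b)).
Qed.

Variables (y : A) (c M0 : nat).
Hypotheses (hc : forall b, pw I M0 b -> pw I (c + M0) (b * y))
  (hN : ~ exists M, forall b, pw I M b -> pw I (c.+1 + M) (b * y)).

(** The annihilator is taken maximal among those of alive forms, and an alive multiple of [h] then
    has the same annihilator as [h]. *)
Lemma alive_prime : exists l z, let h := ini I (c + l) (z * y) in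
  [/\ pw I l z, pw I (c + l) (z * y), prime_set [set g | g * h = 0] & alive h].
Proof.
have hc' l z : (M0 <= l)%N -> pw I l z -> pw I (c + l) (z * y).
  move=> /subnKC <-; set k := (l - M0)%N.
  apply: (@pw_add_min _ I M0 k [set z | pw I (c + (M0 + k)) (z * y)]) => [|a b ha hb] /=.
    exact: (colon_ideal _ (pw_is I _)).
  by rewrite mulrAC addnA; apply: pwM => //; apply: hc.
pose F := [set J | exists l z, [/\ (M0 <= l)%N, pw I l z, alive (ini I (c + l) (z * y)) &
  J = [set g | g * ini I (c + l) (z * y) = 0]]].
have [||_ [l [z [Ml lz alz ->]]] hmax] := @noeth_max _ F (@gr_noeth _ I nA).
- by move=> _ [l [z [_ _ _ ->]]]; apply: ann_ideal.
- have [|[z Mz alz]|[j hj]] := @alive_ex c M0 y; first exact: hc.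
    by exists [set g | g * ini I (c + M0) (z * y) = 0], M0, z.
  case: hN; exists (M0 + j)%N => b /hj; by rewrite addSn addnA.
exists l, z => h; have pzy := hc' _ _ Ml lz.
have degh : h \in gr_piece I (c + l)%N%:Z by apply: ini_piece.
split=> //; apply: homogeneous_prime; first exact: ann_ideal.
- by rewrite /= mul1r => h0; have [b _] := alz 0%N; rewrite -/h h0 mulr0.
- by move=> g n; apply: ann_homogeneous degh.
move=> n k f g hf /gr_piece_ini[b hb ->] /= fgh.
have [bh|bh] := pselect (ini I k b * h = 0); [by right|left].
have Fmul j w : pw I j w -> alive (ini I j w * h) ->
    [set g | g * (ini I j w * h) = 0] = [set g | g * h = 0].
  move=> hw; have -> : ini I j w * h = ini I (c + (l + j)) ((w * z) * y).
    by rewrite /h -iniM // mulrA; congr ini; lia.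
  move=> al; apply: hmax; last first.
    move=> g' /= gh; have -> : ini I (c + (l + j)) ((w * z) * y) = ini I j w * h.
      by rewrite /h -iniM // mulrA; congr ini; lia.
    by rewrite mulrCA -/h gh mulr0.
  exists (l + j)%N, (w * z); split=> //; first exact: leq_trans (leq_addr _ _).
  by rewrite addnC; apply: pwM.
have [al|nal] := pselect (alive (ini I k b * h)).
  suff : [set g | g * h = 0] f by [].
  by rewrite -(Fmul _ _ hb al) /= mulrA.
(* When [ini I k b * h] is not alive, all forms of some degree [j] kill it. Some alive
   [ini I j w * h] is thus killed by [ini I k b], which by maximality kills [h]. *)
have [j hj] : exists j, forall w, pw I j w -> ini I j w * (ini I k b * h) = 0.
  apply: contrapT => hj; apply: nal => j; apply: contrapT => nb; apply: hj; exists j => w hw.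
  by apply: contrapT => nw; apply: nb; exists w.
have [w hw] := alive_mul j pzy alz.
have -> : ini I (c + l + j) (w * (z * y)) = ini I j w * h by rewrite addnC; apply: iniM.
move=> al.
case: bh; suff : [set g | g * h = 0] (ini I k b) by [].
by rewrite -(Fmul _ _ hw al) /= mulrCA hj.
Qed.
End AlivePrime.

(** * Growth and coefficient ideals *)

(** Excluding the coefficient 1 is enough: a step of the chain fails to be strict only if one
    generator is a combination of earlier ones. *)
Lemma indep_chain (R : comNzRingType) (V U : set R) M (g : 'I_M -> R) :
  is_ideal V -> is_ideal U -> V `<=` U -> (forall i, U (g i)) ->
  (forall a i, V (\sum_j a j * g j) -> a i <> 1) -> ideal_chain V U M.
Proof.
move=> idV idU VU Ug ind; pose gk k (i : 'I_M) := if (i < k)%N then g i else 0.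
exists (fun k => fam_ideal V (gk k)); split=> [k|k kM|k kM].
- exact: fam_ideal_is.
- split=> [|b [q hq]]; first exact: fam_ideal_sub.
  apply: (idlBr idU (VU _ hq)); apply: idl_sum => // i _; apply: idlMr => //.
  by rewrite /gk; case: ifP => _; [apply: Ug | apply: idl0].
split=> [b [q hq]|].
  exists (fun i : 'I_M => if (i < k)%N then q i else 0).
  rewrite (_ : \sum_i _ = \sum_i gk k i * q i) //; apply: eq_bigr => i _; rewrite /gk.
  by case: (ltnP i k) => ik; rewrite ?mul0r ?mulr0 // ltnS ltnW.
move=> /(_ (g (Ordinal kM))); case=> [|q hq].
  by have := fam_ideal_gen (gk k.+1) (Ordinal kM) (idl0 idV); rewrite /gk /= leqnn.
apply: (ind (fun j : 'I_M => (j == Ordinal kM)%:R - (if (j < k)%N then q j else 0)) (Ordinal kM)); last first.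
  by rewrite /= eqxx ltnn subr0.
rewrite (_ : \sum_j _ = g (Ordinal kM) - \sum_i gk k i * q i) //.
under eq_bigr do rewrite mulrBl; rewrite sumrB; congr (_ - _).
  by rewrite (bigD1 (Ordinal kM)) //= eqxx mul1r big1 ?addr0 // => j /negPf ->; rewrite mul0r.
by apply: eq_bigr => j _; rewrite /gk; case: ifP => _; rewrite ?mul0r // mulrC.
Qed.

(** The remaining terms have index above [d - r], hence binomials of degree at most [r.-1]. *)
Lemma hilbert_gap (A : comNzRingType) (d r : nat) (K J : ideal A) e e' :
  (0 < r)%N -> (r <= d)%N -> @hilbert_coeffs A d K e -> @hilbert_coeffs A d J e' ->
  (forall j, (j <= d - r)%N -> e' j = e j) ->
  exists C N0, forall N, (N0 <= N)%N -> exists lK lJ,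
    [/\ len (@pw A K N.+1) setT lK, len (@pw A J N.+1) setT lJ & (lK <= lJ + C * N.+1 ^ r.-1)%N].
Proof.
move=> r0 rd [N1 h1] [N2 h2] ee; exists (\sum_(i < d.+1) `|e i - e' i|)%N, (maxn N1 N2) => N.
rewrite geq_max => /andP[/h1[lK /has_lengthP LK eK] /h2[lJ /has_lengthP LJ eJ]].
exists lK, lJ; split=> //.
suff : lK%:Z - lJ%:Z <= (\sum_(i < d.+1) `|e i - e' i| * N.+1 ^ r.-1)%N%:Z.
  by rewrite -big_distrl /=; lia.
rewrite eK eJ -sumrB -[X in _ <= X]natz natr_sum; apply: ler_sum => i _.
have [ir|ir] := leqP i (d - r).
  by rewrite ee // subrr natz.
rewrite -mulrBl -mulrBr; apply: le_trans (ler_norm _) _.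
rewrite !normrM normrX normrN1 expr1n mul1r natz PoszM -abszE.
have -> : (N + d - i = N + (d - i))%N by have := ltn_ord i; lia.
rewrite ler_wpM2l // ger0_norm // lez_nat; apply: leq_trans (bin_le_pow _ _) _.
by rewrite leq_pexp2l //; lia.
Qed.

Section Growth.
Variables (A : comNzRingType) (m I : idealr A) (n : nat) (J : ideal A).
Hypotheses (n0 : (0 < n)%N) (IJ : {subset ideal_pow I n <= J}).
Variables (K : fieldType) (pK : {rmorphism A -> K}).
Variables (c l t : nat) (y z : A) (Y : 'I_t -> gr I).
Hypotheses (cn : (c < n)%N) (Jy : y \in J) (Iz : pw I l z) (Izy : pw I (c + l) (z * y)).
Local Notation h := (ini I (c + l) (z * y)).
Hypothesis Y1 : degree_one Y.
Variables (B : comNzRingType) (pB : {rmorphism gr I -> B}) (kap : {rmorphism K -> B}).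
Hypotheses (kB : forall a, pB a = 0 <-> a * h = 0)
  (kapE : forall a, kap (pK a) = pB (gr_const I a))
  (ev_inj : forall F, ev kap (pB \o Y) F = 0 -> F = 0).

(** The monomials are lifted to [W i] in I^q with q = n N - l, so that [W i * z] lies in I^(n N) and
    [W i * z * y] in J^(N+1). A relation modulo I^(n (N+1)) passes to initial forms as c < n, and
    there [ev_inj] applies. *)
Lemma monomial_chain M (u : 'I_M -> 'X_{1..t}) N : injective u -> (l <= n * N)%N ->
  (forall i, mdeg (u i) = n * N - l)%N ->
  ideal_chain (pw (ideal_pow I n) N.+1) (pw J N.+1) M.
Proof.
move=> inju lN degu; set q := (n * N - l)%N in degu.
have /choice[w hw] i : exists w, pw I 1 w /\ Y i = ini I 1 w by have [w] := gr_piece_ini (Y1 i); exists w.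
have mono_ini (v : 'X_{1..t}) : exists b, pw I (mdeg v) b /\ mono Y v = ini I (mdeg v) b.
  by have [b] := gr_piece_ini (mono_piece v Y1); exists b.
have /choice[W hW] i := mono_ini (u i).
have WP i : pw I q (W i) by have [] := hW i; rewrite degu.
have Wini i : mono Y (u i) = ini I q (W i) by have [_] := hW i; rewrite degu.
apply: (indep_chain (g := fun i => W i * z * y)); try exact: pw_is.
- by apply: pw_mono => a; apply: IJ.
- move=> i; rewrite mulrC; apply: pwS => //; apply: (pw_mono IJ).
  by rewrite pw_pow -(subnK lN); apply: (pwM (WP i) Iz).
move=> a i hV ai1; pose F := \sum_j pK (a j) *: 'X_[u j] : {mpoly K[t]}.
suff /ev_inj F0 : ev kap (pB \o Y) F = 0.
  have := congr1 (fun F => F@_(u i)) F0; rewrite mcoeff0 /F raddf_sum /=.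
  rewrite (bigD1 i) //= big1 ?addr0 => [|j ji].
    by rewrite mcoeffZ mcoeffX eqxx mulr1 ai1 rmorph1 => /eqP; rewrite oner_eq0.
  by rewrite mcoeffZ mcoeffX (inj_eq inju) (negPf ji) mulr0.
have -> : ev kap (pB \o Y) F = pB (\sum_j gr_const I (a j) * mono Y (u j)).
  rewrite /F !rmorph_sum; apply: eq_bigr => j _ /=.
  by rewrite rmorphM /= -kapE mono_ev /ev mmapZ mmapX.
apply/kB; rewrite big_distrl /=.
have -> : \sum_j gr_const I (a j) * mono Y (u j) * h = ini I (q + (c + l)) (\sum_j a j * (W j * z * y)).
  rewrite ini_sum => [|j]; last by apply: (idlM (pw_is _ _)); rewrite -mulrA; apply: pwM.
  apply: eq_bigr => j _; rewrite Wini ini_constE -mulrA -[W j * z * y]mulrA -[(q + _)%N]add0n.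
  by rewrite -!iniM ?pw0 //; apply: pwM.
apply/ini0; first by apply: idl_sum => [|j _]; [exact: pw_is|apply: (idlM (pw_is _ _)); rewrite -mulrA; apply: pwM].
by move: hV; rewrite pw_pow; apply: pw_le; rewrite /q; nia.
Qed.

(** With more than [r] variables there are too many monomials of one degree for a gap of order
    [r.-1]. *)
Lemma transcendence_bound C N0 r : (0 < r)%N ->
  (forall N, (N0 <= N)%N -> exists lK lJ, [/\ len (@pw A (ideal_pow I n) N.+1) setT lK,
     len (@pw A J N.+1) setT lJ & (lK <= lJ + C * N.+1 ^ r.-1)%N]) -> (t <= r)%N.
Proof.
move=> r0 hgap; rewrite leqNgt; apply/negP => rt.
(* [D] gives N + 1 <= D b, so the gap would force b^r <= C D^(r-1) b^(r-1), that is b <= C D^(r-1).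
   The part l + r b of [N] makes room for [r] exponents below [b]. *)
pose D := (l + r + N0).+1; pose b := (C * D ^ r.-1).+1; pose N := (l + r * b + N0)%N.
have [lK [lJ [[_ lKP] [lJP _] gap]]] : exists lK lJ, [/\ len (@pw A (ideal_pow I n) N.+1) setT lK,
     len (@pw A J N.+1) setT lJ & (lK <= lJ + C * N.+1 ^ r.-1)%N] by apply: hgap; rewrite leq_addl.
have lN : (l + r * b <= n * N)%N by rewrite /N; nia.
pose ar : 'I_t := Ordinal rt; pose T := {ffun 'I_r -> 'I_b}.
pose wd : 'I_r -> 'I_t := widen_ord (ltnW rt).
pose q := (n * N - l)%N.
(* The first [r] exponents are free below [b]; the variable [ar] fills up the degree to [q]. *)
pose u (th : T) : 'X_{1..t} := (\sum_(i < r) U_(wd i) *+ th i + U_(ar) *+ (q - \sum_(i < r) th i))%MM.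
have degu th : mdeg (u th) = q.
  rewrite mdegD mdeg_sum mdegMn mdeg1 mul1n; under eq_bigr do rewrite mdegMn mdeg1 mul1n.
  rewrite subnKC // /q leq_subRL; last by lia.
  apply: leq_trans lN; rewrite leq_add2l; apply: (@leq_trans (\sum_(i < r) b)).
    by apply: leq_sum => i _; apply: ltnW.
  by rewrite sum_nat_const card_ord mulnC.
have inju : injective u.
  move=> th th' e; apply/ffunP => i; apply: val_inj.
  have ui w : u w (wd i) = w i :> nat.
    rewrite mnmDE mnm_sumE mulmnE mnm1E -val_eqE /= gtn_eqF // mul0n addn0.
    rewrite (bigD1 i) //= mulmnE mnm1E eqxx mul1n big1 ?addn0 // => j ji.
    by rewrite mulmnE mnm1E -val_eqE /= val_eqE (negPf ji).
  by rewrite /= -(ui th) -(ui th') e.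
have lN' : (l <= n * N)%N by apply: leq_trans lN; rewrite leq_addr.
have ch := monomial_chain (inj_comp inju enum_val_inj) lN' (fun i : 'I_#|T| => degu (enum_val i)).
have := lKP _ (chain_cat ch lJP); rewrite card_ffun !card_ord => br.
have {}br : (b ^ r <= C * N.+1 ^ r.-1)%N by rewrite -(leq_add2r lJ) [X in (_ <= X)%N]addnC; apply: leq_trans gap.
have ND : (N.+1 <= D * b)%N by rewrite /N /D; have : (0 < b)%N by []; nia.
have : (b ^ r <= C * D ^ r.-1 * b ^ r.-1)%N.
  apply: leq_trans br _; rewrite -mulnA leq_mul2l -expnMn; apply/orP; right.
  by case: (posnP r.-1) => [->|r1]; rewrite ?expn0 // leq_exp2r.
rewrite -{1}(prednK r0) expnS leq_pmul2r ?expn_gt0 //.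
by rewrite /b ltnn.
Qed.

End Growth.

(** * The Ratliff-Rush closure belongs to the class *)

Section RatliffRushClass.
Variables (A : comNzRingType) (m : idealr A) (d : nat).
Hypotheses (noethA : noetherian A) (localA : local_ring m) (dimA : krull_dim A d)
  (d0 : (0 < d)%N) (cmA : cohen_macaulay m).
Let nA : noeth A := (noetherianP A).1 noethA.

Lemma m_primary_proper (J : ideal A) : 1 \notin J -> (forall a, a \in m -> exists n, a ^+ n \in J) ->
  m_primary m J.
Proof.
move=> J1 radJ; have idJ : is_ideal [set a | a \in J] := ideal_is J.
have Jm a : a \in J -> a \in m.
  by apply: (proper_sub_max noethA localA idJ); rewrite /= (negPf J1).
split=> // [a b abJ aJ|a].
  have [/radJ //|/(local_unit noethA localA)[c bc]] := boolP (b \in m).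
  by case/negP: aJ; rewrite -[a]mulr1 -bc mulrA; exact: (idlMr idJ).
split=> [/radJ //|[n /Jm]]; have [idm m1 pm] := max_prime noethA localA.
elim: n => [|n IH]; first by rewrite expr0 => /m1.
by rewrite exprS => /pm[//|/IH].
Qed.

Lemma primary_pow (Q : idealr A) n : m_primary m Q -> (0 < n)%N ->
  1 \notin ideal_pow Q n /\ forall a, a \in m -> exists k, a ^+ k \in ideal_pow Q n.
Proof.
move=> [Q1 _ radQ] n0; split=> [|a /radQ[k ak]].
  apply: contra Q1 => h; apply: ideal_pow1_sub; exact: (pw_le n0).
by exists (k * n)%N; rewrite exprM; apply: pwX.
Qed.

Lemma ratliff_rush_class (K : ideal A) i : 1 \notin K -> (forall a, a \in m -> exists n, a ^+ n \in K) ->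
  coeff_class m d i K (ratliff_rush K).
Proof.
move=> K1 radK; have [x xm regx] := regular_elt dimA cmA d0; have [k xK] := radK x xm.
have regxk b : x ^+ k * b = 0 -> b = 0.
  by elim: k {xK} => [|k IH]; rewrite ?expr0 ?mul1r // exprS -mulrA => /regx/IH.
have RK1 := ratliff_rush_proper nA xK regxk K1.
have [N hN] := ratliff_rush_pow nA xK regxk.
have [e he] := hilbert_poly noethA localA dimA cmA (ideal_is K) K1 radK.
split; [|exact: sub_ratliff_rush|].
  by apply: m_primary_proper => // a /radK[n an]; exists n; apply: sub_ratliff_rush.
exists e, e; split=> //; have [N' hN'] := he; exists (maxn N N') => n; rewrite geq_max => /andP[Nn N'n].
have [l /has_lengthP L el] := hN' n N'n; exists l => //; apply/has_lengthP.
by have := hN n.+1 (leqW Nn); rewrite /pw => ->.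
Qed.

End RatliffRushClass.

(** * The class lies in the Ratliff-Rush closure *)

Section CoefficientIdeals.
Variables (A : comNzRingType) (m : idealr A) (d : nat).
Hypotheses (noethA : noetherian A) (localA : local_ring m)
  (infA : infinite_set [set: {ideal_quot m}]).
Variables (I : idealr A) (primI : m_primary m I) (r : nat) (r_ge1 : (1 <= r)%N) (r_le : (r <= d)%N).
Variables (s : nat) (x : 'I_s -> gr I).
Hypotheses (x_deg1 : forall j, x j \in gr_piece I 1) (x_gen : ideal_gen (range x) =i gr_irrelevant I).
Variable E : lmodType {ideal_quot I}.
Hypotheses (hullE : injective_hull (residue_module I m) E)
  (dimH : forall i, (1 <= i <= r)%N -> module_dim_le (matlis_dual x i E) (i%:Z - 1)).
Let nA : noeth A := (noetherianP A).1 noethA.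

Lemma no_alive_prime n (J : ideal A) c l y z : (0 < n)%N ->
  coeff_class m d (d - r) (ideal_pow I n) J -> (c < n)%N -> y \in J ->
  pw I l z -> pw I (c + l) (z * y) -> prime_set [set g | g * ini I (c + l) (z * y) = 0] ->
  ~ alive (ini I (c + l) (z * y)).
Proof.
move=> n0 [_ IJ [e [e' [he he' ee]]]] cn Jy lz hzy; set h := ini I (c + l) (z * y).
set P := [set g | g * h = 0] => pP al.
have Im : {subset I <= m} by case: primI => _ _ radI a aI; apply/radI; exists 1%N.
have degh : h \in gr_piece I (c + l)%N%:Z by apply: ini_piece.
have [idP P1 PM] := pP.
(* A power of [a] lies in [I] and so is 0 in degree 0 of G; primality of [P] removes the
   exponent. *)
have Pm a : a \in m -> P (gr_const I a).
  case: primI => _ _ radI /radI[k /gr_const0]; rewrite rmorphXn.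
  elim: k => [|k IH]; first by rewrite expr0 => /eqP; rewrite oner_eq0.
  move=> e0; have : P (gr_const I a * gr_const I a ^+ k) by rewrite -exprS e0; apply: idl0.
  case/PM => // Pk; elim: k Pk {IH e0} => [|k IH]; first by rewrite expr0.
  by rewrite exprS => /PM[].
have homP g k : P g -> P (gpr k g) by apply: ann_homogeneous degh.
have [K [pK [sK kK infK]]] := residue_field noethA localA infA.
have [B [pB [sB kB]]] := quotient_ring idP P1.
have [kap kapE] : exists kap : {rmorphism K -> B}, forall a, kap (pK a) = pB (gr_const I a).
  apply: (factor_rmorphism (f := pK) (h := pB \o gr_const I)) => // a /kK /Pm /kB //.
have [|t [Y [t0 Y1 radY ev_inj]]] := normalization sK infK pP homP kB kapE x_deg1 x_gen.
  move=> N; have [b hb bh] := al N; exists N, (ini I N b); split=> //; exact: ini_piece.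
have [v [g gen]] := module_finite nA pP homP sB kB kapE Y1 radY.
have tr : (t <= r)%N.
  have [C [N0 hC]] := hilbert_gap r_ge1 r_le he he' ee.
  exact: (transcendence_bound n0 IJ cn Jy lz hzy Y1 kB kapE ev_inj r_ge1 hC).
have annh a : a * h = 0 <-> P a by [].
have [Phi hPhi] := faithful_functional noethA localA Im hullE sK kK pP annh degh sB kB kapE
  t0 Y1 radY ev_inj gen x_deg1 x_gen.
have nB : noeth B := noeth_surj sB (@gr_noeth _ I nA).
have [Q [Qp Qlt] Q0] := prime_chain_ev (quot_domain pP sB kB) ev_inj gen nB.
have Qpre k : (k <= t)%N -> prime_set [set a | Q k (pB a)].
  move=> /Qp[idQ Q1 QM]; split=> [|/=|a b /=]; last by rewrite rmorphM; apply: QM.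
    split=> [|a b|a b] /=; rewrite ?rmorph0 ?rmorphD ?rmorphM; [exact: idl0|exact: idlD|exact: idlM].
  by rewrite rmorph1.
have /choice[R hR] : forall k, exists R : prime_idealr (gr I), (k <= t)%N -> forall a, a \in R <-> Q k (pB a).
  move=> k; have [kt|kt] := boolP (k <= t)%N.
    by have [R hR] := prime_idealr_of (Qpre k kt); exists R.
  by have [R _] := prime_idealr_of pP; exists R.
have Q0k k : (k <= t)%N -> Q 0%N `<=` Q k.
  elim: k => [_ b //|k IH] kt b /(IH (ltnW kt)); exact: (Qlt k kt).1.
have ti : (1 <= t <= r)%N by rewrite t0.
suff : t%:Z <= t%:Z - 1 by lia.
apply: (dimH ti (n := t) (P := R)) => k kt.
  (* All primes of the chain contain [P], hence the annihilator of [Phi], and so belong to the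
     support. *)
  exists Phi => a /hPhi /kB pa; apply/(hR k kt); apply: (Q0k k kt); rewrite Q0; exact: pa.
have [sub nsub] := Qlt k kt; split=> [a /(hR k (ltnW kt)) qa|hsub].
  by apply/(hR k.+1 kt); apply: sub.
apply: nsub => b; have [a ->] := sB b => qa; apply/(hR k (ltnW kt)); apply: hsub; exact/(hR k.+1 kt).
Qed.

(** For each c <= n some power of [I] carries [y] at least [c] degrees up: a failure at the next [c]
    would produce an alive form with prime annihilator. At c = n this is the Ratliff-Rush condition
    for I^n. *)
Lemma class_sub_ratliff_rush n (J : ideal A) : (0 < n)%N ->
  coeff_class m d (d - r) (ideal_pow I n) J -> {subset J <= ratliff_rush (ideal_pow I n)}.
Proof.
move=> n0 cJ y Jy.
have H c : (c <= n)%N -> exists M, forall b, pw I M b -> pw I (c + M) (b * y).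
  elim: c => [|c IH] cn; first by exists 0%N => b _; rewrite pw0.
  have [M0 hM0] := IH (ltnW cn); apply: contrapT => hN.
  have [l [z [lz lzy pP al]]] := alive_prime nA hM0 hN.
  exact: no_alive_prime n0 cJ cn Jy lz lzy pP al.
have [M hM] := H n (leqnn n); apply/ratliff_rushP; exists M.+1 => // b.
rewrite !pw_pow => hb; have Mn : (M <= n * M.+1)%N by apply: leq_trans (leqnSn M) (leq_pmull _ n0).
have e : (n * M.+1 = M + (n * M.+1 - M))%N by rewrite subnKC.
rewrite e in hb; rewrite mulrC.
have -> : (n * M.+2 = n + M + (n * M.+1 - M))%N by rewrite -addnA subnKC // -mulnS.
apply: (@pw_add_min _ I M (n * M.+1 - M) [set b | pw I (n + M + (n * M.+1 - M)) (b * y)]) hb.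
  exact: (colon_ideal _ (pw_is I _)).
by move=> b1 b2 h1 h2 /=; rewrite mulrAC; apply: pwM => //; apply: hM.
Qed.

End CoefficientIdeals.

Theorem theorem1p1 (A : comNzRingType) (m : idealr A) (d : nat)
    (noethA : noetherian A) (localA : local_ring m)
    (dimA : krull_dim A d) (d_ge2 : (2 <= d)%N) (cmA : cohen_macaulay m)
    (infA : infinite_set [set: {ideal_quot m}])
    (I : idealr A) (primI : m_primary m I)
    (r : nat) (r_ge1 : (1 <= r)%N) (r_le : (r <= d.-1)%N)
    (s : nat) (x : 'I_s -> gr I)
    (x_deg1 : forall j, x j \in gr_piece I 1)
    (x_gen : ideal_gen (range x) =i gr_irrelevant I)
    (E : lmodType {ideal_quot I})
    (hullE : injective_hull (residue_module I m) E)
    (dimH : forall i, (1 <= i <= r)%N ->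
       module_dim_le (matlis_dual x i E) (i%:Z - 1)) :
  forall n, (1 <= n)%N ->
    coefficient_ideal m d (d - r) (ideal_pow I n)
      (ratliff_rush (ideal_pow I n)).
Proof.
move=> n n0; have d0 : (0 < d)%N by apply: ltnW.
have rd : (r <= d)%N by apply: leq_trans r_le (leq_pred d).
have [K1 radK] := primary_pow primI n0.
have cR := ratliff_rush_class noethA localA dimA d0 cmA (d - r) K1 radK.
have sub J : coeff_class m d (d - r) (ideal_pow I n) J -> {subset J <= ratliff_rush (ideal_pow I n)}.
  by move=> cJ; apply: (class_sub_ratliff_rush noethA localA infA primI r_ge1 rd x_deg1 x_gen hullE dimH n0 cJ).
(* A member of the class that contains all others is its only maximal element. *)
split.
  by split=> // J cJ sJ a; apply/idP/idP => [/(sub J cJ)|/sJ].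
by move=> J [cJ maxJ] a; rewrite (maxJ _ cR (sub J cJ)).
Qed.
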